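(* Let $G$ be a flat algebraic group over a Dedekind domain $R$. There exists a finite flat $R$-submodule $V$ of $\mathcal{O}(G)$, stable under $G$, such that the homomorphism $G\to \mathrm{GL}_V$ is a closed immersion. If $R$ is a principal ideal domain and the generic fibre of $G$ over $R$ is linearly reductive, then $G$ is the subgroup of $\mathrm{GL}_V$ fixing a finite collection of tensors in spaces $V^{\otimes m}\otimes (V^\vee)^{\otimes n}$, $m,n\ge 0$.
   Context: An algebraic group over $R$ is an affine group scheme of finite presentation over $R$; $\mathcal{O}(G)$ is its coordinate ring, on which $G$ acts by the regular representation $(gf)(x)=f(xg)$. A finite flat $R$-module is a finitely presented flat $R$-module. $V^\vee$ is the $R$-linear dual. The subgroup of $\mathrm{GL}_V$ fixing a set $S$ of tensors is the functor sending a commutative $R$-algebra $R'$ to the set of $g\in\mathrm{GL}(V_{R'})$, $V_{R'}=R'\otimes_R V$, whose induced action fixes (the image over $R'$ of) each $s\in S$. An algebraic group over a field is linearly reductive if every finite-dimensional representation of it is semisimple. *)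

(* Defs.v *)
From HB Require Import structures.
From mathcomp Require Import all_boot all_order all_algebra.
From mathcomp Require Import boolp.
From mathcomp Require mpoly.
Set Implicit Arguments.
Unset Strict Implicit.
Unset Printing Implicit Defensive.
Import GRing.Theory.
Local Open Scope ring_scope.
Local Open Scope quotient_scope.

Section TensorRel.
Variables (R : comNzRingType) (M N : lmodType R).
Implicit Types (s t : seq (M * N)).

(* The list [:: (x1, y1); ..; (xn, yn)] stands for the formal sum of the
   symbols xi ⊙ yi; no symbol for subtraction is needed, as (- x) ⊙ y is
   inverse to x ⊙ y. *)
Inductive tens_rel : seq (M * N) -> seq (M * N) -> Prop :=
| TensRefl s : tens_rel s s
| TensSym s t : tens_rel s t -> tens_rel t s
| TensTrans s t u : tens_rel s t -> tens_rel t u -> tens_rel s u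
| TensCat s s' t t' :
    tens_rel s s' -> tens_rel t t' -> tens_rel (s ++ t) (s' ++ t')
| TensCatC s t : tens_rel (s ++ t) (t ++ s)
| TensZero y : tens_rel [:: (0, y)] [::]
| TensAddl x x' y : tens_rel [:: (x + x', y)] [:: (x, y); (x', y)]
| TensAddr x y y' : tens_rel [:: (x, y + y')] [:: (x, y); (x, y')]
| TensScale a x y : tens_rel [:: (a *: x, y)] [:: (x, a *: y)].

Definition tens_eq : rel (seq (M * N)) := fun s t => `[< tens_rel s t >].

Lemma tens_eq_refl : reflexive tens_eq.
Proof. by move=> s; apply/asboolP; exact: TensRefl. Qed.

Lemma tens_eq_sym : symmetric tens_eq.
Proof. by move=> s t; apply/asboolP/asboolP; exact: TensSym. Qed.

Lemma tens_eq_trans : transitive tens_eq.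
Proof.
by move=> t s u /asboolP st /asboolP tu; apply/asboolP; apply: TensTrans tu.
Qed.

Canonical tens_equiv := EquivRel tens_eq tens_eq_refl tens_eq_sym tens_eq_trans.

Definition tensor : Type := {eq_quot tens_equiv}.
HB.instance Definition _ := Choice.on tensor.
HB.instance Definition _ := EqQuotient.on tensor.

Definition tcls s : tensor := \pi_tensor s.

Lemma tclsP s t : tcls s = tcls t <-> tens_rel s t.
Proof.
split=> [/eqP|st]; first by rewrite eqmodE => /asboolP.
by apply/eqP; rewrite eqmodE; apply/asboolP.
Qed.

Lemma tcls_repr (t : tensor) : tcls (repr t) = t.
Proof. by rewrite /tcls reprK. Qed.

Definition tens x y : tensor := tcls [:: (x, y)].

Definition tadd (t u : tensor) : tensor := tcls (repr t ++ repr u).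
Definition topp (t : tensor) : tensor :=
  tcls [seq (- p.1, p.2) | p <- repr t].
Definition tscale (a : R) (t : tensor) : tensor :=
  tcls [seq (a *: p.1, p.2) | p <- repr t].

Lemma tcls_cat s t : tadd (tcls s) (tcls t) = tcls (s ++ t).
Proof. by apply/tclsP; apply: TensCat; apply/tclsP; rewrite tcls_repr. Qed.

Lemma taddA : associative tadd.
Proof.
move=> t u v; rewrite -(tcls_repr t) -(tcls_repr u) -(tcls_repr v).
by rewrite !tcls_cat catA.
Qed.

Lemma taddC : commutative tadd.
Proof.
move=> t u; rewrite -(tcls_repr t) -(tcls_repr u) !tcls_cat.
by apply/tclsP; exact: TensCatC.
Qed.

Lemma tadd0 : left_id (tcls [::]) tadd.
Proof. by move=> t; rewrite -(tcls_repr t) tcls_cat. Qed.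

Lemma tens_rel_map (f : M -> M) : f 0 = 0 -> {morph f : x y / x + y} ->
  (forall a x, f (a *: x) = a *: f x) -> forall s t, tens_rel s t ->
  tens_rel [seq (f p.1, p.2) | p <- s] [seq (f p.1, p.2) | p <- t].
Proof.
move=> f0 fD fZ s t; elim=> {s t}.
- by move=> s; exact: TensRefl.
- by move=> s t _; exact: TensSym.
- by move=> s t u _ st _ tu; exact: TensTrans tu.
- by move=> s s' t t' _ ss _ tt; rewrite !map_cat; exact: TensCat.
- by move=> s t; rewrite !map_cat; exact: TensCatC.
- by move=> y /=; rewrite f0; exact: TensZero.
- by move=> x x' y /=; rewrite fD; exact: TensAddl.
- by move=> x y y' /=; exact: TensAddr.
- by move=> a x y /=; rewrite fZ; exact: TensScale.
Qed.

Lemma tcls_opp s : topp (tcls s) = tcls [seq (- p.1, p.2) | p <- s].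
Proof.
apply/tclsP; apply: (@tens_rel_map -%R); rewrite ?oppr0 //.
- exact: opprD.
- by move=> a x; rewrite scalerN.
by apply/tclsP; rewrite tcls_repr.
Qed.

Lemma tcls_scale a s :
  tscale a (tcls s) = tcls [seq (a *: p.1, p.2) | p <- s].
Proof.
apply/tclsP; apply: (@tens_rel_map ( *:%R a)); rewrite ?scaler0 //.
- by move=> x y; rewrite scalerDr.
- by move=> b x; rewrite !scalerA mulrC.
by apply/tclsP; rewrite tcls_repr.
Qed.

Lemma tcls_ind (P : tensor -> Prop) : P (tcls [::]) ->
  (forall x y (t : tensor), P t -> P (tadd (tens x y) t)) -> forall t : tensor, P t.
Proof.
move=> P0 PD t; rewrite -(tcls_repr t); elim: (repr t) => [//|[x y] s IHs].
by have := PD x y _ IHs; rewrite tcls_cat.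
Qed.

Lemma taddN : left_inverse (tcls [::]) topp tadd.
Proof.
move=> t; elim/tcls_ind: t => [|x y t IHt]; first by rewrite tcls_opp tcls_cat.
have -> : topp (tadd (tens x y) t) = tadd (tens (- x) y) (topp t).
  by rewrite -(tcls_repr t) tcls_cat !tcls_opp tcls_cat.
rewrite [tadd (tens (- x) y) _]taddC -taddA [X in tadd _ X]taddA.
rewrite [tadd (tens _ _) (tens _ _)]tcls_cat.
suff -> : tcls ([:: (- x, y)] ++ [:: (x, y)]) = tcls [::] by rewrite tadd0 IHt.
apply/tclsP; apply: TensTrans (TensSym (TensAddl _ _ _)) _.
by rewrite addNr; exact: TensZero.
Qed.

HB.instance Definition _ := GRing.isZmodule.Build tensor taddA taddC tadd0 taddN.

Lemma taddE (t u : tensor) : t + u = tadd t u. Proof. by []. Qed.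

Lemma tscaleDr a : {morph tscale a : t u / t + u}.
Proof.
move=> t u; rewrite -(tcls_repr t) -(tcls_repr u) !taddE tcls_cat.
by rewrite !tcls_scale map_cat tcls_cat.
Qed.

Lemma tscale_tens a x y : tscale a (tens x y) = tens (a *: x) y.
Proof. exact: tcls_scale. Qed.

Lemma tensor_ind (P : tensor -> Prop) : P 0 -> (forall x y, P (tens x y)) ->
  (forall t u : tensor, P t -> P u -> P (t + u)) -> forall t : tensor, P t.
Proof. by move=> P0 Pt PD; elim/tcls_ind => [//|x y t Pt']; apply: PD. Qed.

Lemma tscale0r a : tscale a 0 = 0.
Proof. by rewrite [0]/(tcls [::]) tcls_scale. Qed.

Lemma tensDl x x' y : tens (x + x') y = tens x y + tens x' y.
Proof. by rewrite taddE tcls_cat; apply/tclsP; exact: TensAddl. Qed.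

Lemma tensDr x y y' : tens x (y + y') = tens x y + tens x y'.
Proof. by rewrite taddE tcls_cat; apply/tclsP; exact: TensAddr. Qed.

Lemma tensZ a x y : tens (a *: x) y = tens x (a *: y).
Proof. by apply/tclsP; exact: TensScale. Qed.

Lemma tscaleA a b (t : tensor) : tscale a (tscale b t) = tscale (a * b) t.
Proof.
elim/tensor_ind: t => [|x y|t u IHt IHu]; first by rewrite !tscale0r.
  by rewrite !tscale_tens scalerA.
by rewrite !tscaleDr IHt IHu.
Qed.

Lemma tscale1 : left_id 1 tscale.
Proof.
elim/tensor_ind => [|x y|t u IHt IHu]; first by rewrite tscale0r.
  by rewrite tscale_tens scale1r.
by rewrite tscaleDr IHt IHu.
Qed.

Lemma tscaleDl (t : tensor) : {morph tscale^~ t : a b / a + b}.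
Proof.
move=> a b; elim/tensor_ind: t => [|x y|t u IHt IHu].
- by rewrite !tscale0r addr0.
- by rewrite !tscale_tens scalerDl tensDl.
by rewrite !tscaleDr IHt IHu addrACA.
Qed.

HB.instance Definition _ :=
  GRing.Zmodule_isLmodule.Build R tensor tscaleA tscale1 tscaleDr tscaleDl.

Lemma scale_tens a x y : a *: tens x y = tens (a *: x) y.
Proof. exact: tscale_tens. Qed.

Lemma scale_tensr a x y : a *: tens x y = tens x (a *: y).
Proof. by rewrite scale_tens tensZ. Qed.

Lemma tens0l y : tens 0 y = 0.
Proof. by rewrite -(scale0r (0 : M)) -scale_tens scale0r. Qed.

Lemma tens0r x : tens x 0 = 0.
Proof. by rewrite -(scale0r (0 : N)) -scale_tensr scale0r. Qed.

(* Universal property: the values below are those of the homomorphism induced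
   by f as soon as f is biadditive and R-balanced. *)
Definition balanced (Z : zmodType) (f : M -> N -> Z) :=
  [/\ forall x x' y, f (x + x') y = f x y + f x' y,
      forall x y y', f x (y + y') = f x y + f x y' &
      forall a x y, f (a *: x) y = f x (a *: y)].

Definition tlift (Z : zmodType) (f : M -> N -> Z) (t : tensor) : Z :=
  \sum_(p <- repr t) f p.1 p.2.

Section Lift.
Variables (Z : zmodType) (f : M -> N -> Z) (fb : balanced f).

Lemma tlift_cls s : tlift f (tcls s) = \sum_(p <- s) f p.1 p.2.
Proof.
case: fb => fDl fDr fZ.
have f0 y : f 0 y = 0.
  by apply: (addrI (f 0 y)); rewrite -fDl addr0 addr0.
suff H s1 s2 : tens_rel s1 s2 ->
    \sum_(p <- s1) f p.1 p.2 = \sum_(p <- s2) f p.1 p.2.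
  by apply: H; apply/tclsP; rewrite tcls_repr.
elim=> {s1 s2} //.
- by move=> s1 s2 s3 _ -> _ ->.
- by move=> s1 s2 t1 t2 _ e1 _ e2; rewrite !big_cat /= e1 e2.
- by move=> s1 s2; rewrite !big_cat /= addrC.
- by move=> y; rewrite big_seq1 big_nil /= f0.
- by move=> x x' y; rewrite big_seq1 !big_cons big_nil addr0 /= fDl.
- by move=> x y y'; rewrite big_seq1 !big_cons big_nil addr0 /= fDr.
- by move=> a x y; rewrite !big_seq1 /= fZ.
Qed.

Lemma tlift_tens x y : tlift f (tens x y) = f x y.
Proof. by rewrite tlift_cls big_seq1. Qed.

Lemma tliftD : {morph tlift f : t u / t + u}.
Proof.
move=> t u; rewrite -(tcls_repr t) -(tcls_repr u) taddE tcls_cat !tlift_cls.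
by rewrite big_cat.
Qed.

Lemma tlift0 : tlift f 0 = 0.
Proof. by rewrite [0]/(tcls [::]) tlift_cls big_nil. Qed.
End Lift.

End TensorRel.

Arguments tlift {R M N Z}.
Notation "M ⊗ N" := (tensor M N) (at level 40, left associativity).
Notation "x ⊙ y" := (tens x y) (at level 40, left associativity).

Section TensorMap.
Variables (R : comNzRingType) (M N M' N' P : lmodType R).

Lemma tens_eq_add (Z : zmodType) (f g : M ⊗ N -> Z) :
  {morph f : t u / t + u} -> {morph g : t u / t + u} ->
  (forall x y, f (x ⊙ y) = g (x ⊙ y)) -> f =1 g.
Proof.
move=> fD gD fg; have f0 : f 0 = 0.
  by apply: (addrI (f 0)); rewrite -fD addr0 addr0.
have g0 : g 0 = 0 by apply: (addrI (g 0)); rewrite -gD addr0 addr0.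
elim/tensor_ind => [|x y|t u IHt IHu]; first by rewrite f0 g0.
  exact: fg.
by rewrite fD gD IHt IHu.
Qed.

Lemma tliftZ (Z : lmodType R) (f : M -> N -> Z) : balanced f ->
  (forall a x y, f (a *: x) y = a *: f x y) -> scalable (tlift f).
Proof.
move=> fb fZ a; apply: tens_eq_add => [t u|t u|x y].
- by rewrite scalerDr tliftD.
- by rewrite tliftD// scalerDr.
by rewrite scale_tens !tlift_tens.
Qed.

Variables (f : {linear M -> M'}) (g : {linear N -> N'}).

Definition tmap : M ⊗ N -> M' ⊗ N' := tlift (fun x y => f x ⊙ g y).

Lemma tmap_balanced : balanced (fun x y => f x ⊙ g y).
Proof.
split=> [x x' y|x y y'|a x y]; first by rewrite linearD tensDl.
  by rewrite linearD tensDr.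
by rewrite !linearZ /= tensZ.
Qed.

Lemma tmap_tens x y : tmap (x ⊙ y) = f x ⊙ g y.
Proof. exact: (tlift_tens tmap_balanced). Qed.

Fact tmap_is_semilinear : semilinear tmap.
Proof.
split=> [|t u]; last exact: tliftD tmap_balanced _ _.
by apply: tliftZ tmap_balanced _ => a x y; rewrite linearZ scale_tens.
Qed.
HB.instance Definition _ :=
  GRing.isSemilinear.Build R (M ⊗ N) (M' ⊗ N') _ tmap tmap_is_semilinear.

Definition tassoc : (M ⊗ N) ⊗ P -> M ⊗ (N ⊗ P) :=
  tlift (fun (t : M ⊗ N) (z : P) => tlift (fun x y => x ⊙ (y ⊙ z)) t).

Lemma tassoc_balanced1 (z : P) : balanced (fun (x : M) (y : N) => x ⊙ (y ⊙ z)).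
Proof.
split=> [x x' y|x y y'|a x y]; rewrite ?tensDl ?tensDr //.
by rewrite tensZ scale_tens.
Qed.

Lemma tassoc_balanced :
  balanced (fun t (z : P) => tlift (fun (x : M) (y : N) => x ⊙ (y ⊙ z)) t).
Proof.
split=> [t u z|t z z'|a t z].
- exact: tliftD (tassoc_balanced1 z) _ _.
- elim/tensor_ind: t => [|x y|t u IHt IHu].
  + by rewrite !(tlift0 (tassoc_balanced1 _)) addr0.
  + by rewrite !(tlift_tens (tassoc_balanced1 _)) !tensDr.
  + by rewrite !(tliftD (tassoc_balanced1 _)) IHt IHu addrACA.
elim/tensor_ind: t => [|x y|t u IHt IHu].
- by rewrite scaler0 !(tlift0 (tassoc_balanced1 _)).
- by rewrite scale_tens !(tlift_tens (tassoc_balanced1 _)) tensZ scale_tensr.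
by rewrite scalerDr !(tliftD (tassoc_balanced1 _)) IHt IHu.
Qed.

Lemma tassoc_tens (x : M) (y : N) (z : P) : tassoc ((x ⊙ y) ⊙ z) = x ⊙ (y ⊙ z).
Proof.
by rewrite /tassoc (tlift_tens tassoc_balanced) (tlift_tens (tassoc_balanced1 _)).
Qed.

Lemma tassocD : {morph tassoc : t u / t + u}.
Proof. exact: tliftD tassoc_balanced. Qed.

Lemma tassoc0 : tassoc 0 = 0.
Proof. exact: tlift0 tassoc_balanced. Qed.

End TensorMap.

Section TensorRing.
Variables (R : comNzRingType) (A B : comAlgType R).

Definition tmul (t u : A ⊗ B) : A ⊗ B :=
  tlift (fun a b => tlift (fun (c : A) (d : B) => (a * c) ⊙ (b * d)) u) t.

Let tmul_balanced1 a b :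
  balanced (fun (c : A) (d : B) => (a * c) ⊙ (b * d) : A ⊗ B).
Proof.
split=> [x x' y|x y y'|k x y]; first by rewrite mulrDr tensDl.
  by rewrite mulrDr tensDr.
by rewrite -scalerAr tensZ -scalerAr.
Qed.

Let tmul_balanced u : balanced
  (fun a b => tlift (fun (c : A) (d : B) => (a * c) ⊙ (b * d) : A ⊗ B) u).
Proof.
split=> [x x' y|x y y'|k x y]; elim/tensor_ind: u => [|c d|t u IHt IHu];
  rewrite ?(tlift0 (tmul_balanced1 _ _)) ?(tlift_tens (tmul_balanced1 _ _))
          ?(tliftD (tmul_balanced1 _ _)) ?addr0 //.
- by rewrite mulrDl tensDl.
- by rewrite IHt IHu addrACA.
- by rewrite mulrDl tensDr.
- by rewrite IHt IHu addrACA.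
- by rewrite -!scalerAl tensZ.
by rewrite IHt IHu.
Qed.

Lemma tmul_tens a b c d : tmul (a ⊙ b) (c ⊙ d) = (a * c) ⊙ (b * d).
Proof.
by rewrite /tmul (tlift_tens (tmul_balanced _)) (tlift_tens (tmul_balanced1 _ _)).
Qed.

Lemma tmulDl : left_distributive tmul +%R.
Proof. by move=> t u v; exact: tliftD (tmul_balanced _) _ _. Qed.

Let tmul0l u : tmul 0 u = 0.
Proof. exact: tlift0 (tmul_balanced _). Qed.

Let tmulDr t u v : tmul t (u + v) = tmul t u + tmul t v.
Proof.
elim/tensor_ind: t => [|a b|t t' IHt IHt']; first by rewrite !tmul0l addr0.
  by rewrite /tmul !(tlift_tens (tmul_balanced _)) (tliftD (tmul_balanced1 _ _)).
by rewrite !tmulDl IHt IHt' addrACA.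
Qed.

Let tmul0r t : tmul t 0 = 0.
Proof. by apply: (addrI (tmul t 0)); rewrite -tmulDr !addr0. Qed.

Lemma tmulC : commutative tmul.
Proof.
move=> t; elim/tensor_ind=> [|c d|u v IHu IHv]; first by rewrite tmul0l tmul0r.
  elim/tensor_ind: t => [|a b|t u IHt IHu]; first by rewrite tmul0l tmul0r.
    by rewrite !tmul_tens ![_ * c]mulrC ![_ * d]mulrC.
  by rewrite tmulDl tmulDr IHt IHu.
by rewrite tmulDl tmulDr IHu IHv.
Qed.

Lemma tmul1 : left_id (1 ⊙ 1) tmul.
Proof.
elim/tensor_ind=> [|c d|u v IHu IHv]; first by rewrite tmul0r.
  by rewrite tmul_tens !mul1r.
by rewrite tmulDr IHu IHv.
Qed.

Lemma tmulA : associative tmul.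
Proof.
move=> t u v; elim/tensor_ind: t => [|a b|t t' IHt IHt'].
- by rewrite !tmul0l.
- elim/tensor_ind: u => [|c d|u u' IHu IHu'].
  + by rewrite !(tmul0l, tmul0r).
  + elim/tensor_ind: v => [|e f|v v' IHv IHv']; first by rewrite !tmul0r.
      by rewrite !tmul_tens !mulrA.
    by rewrite !tmulDr IHv IHv'.
  + by rewrite !(tmulDl, tmulDr) IHu IHu'.
by rewrite !tmulDl IHt IHt'.
Qed.

HB.instance Definition _ :=
  GRing.Zmodule_isComPzRing.Build (A ⊗ B) tmulA tmulC tmul1 tmulDl.

Lemma mul_tens (a c : A) (b d : B) :
  (a ⊙ b) * (c ⊙ d) = (a * c) ⊙ (b * d) :> A ⊗ B.
Proof. exact: tmul_tens. Qed.

Lemma tens_scalerAl k (t u : A ⊗ B) : k *: (t * u) = (k *: t) * u.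
Proof.
elim/tensor_ind: t => [|a b|t t' IHt IHt']; first by rewrite !(mul0r, scaler0).
  elim/tensor_ind: u => [|c d|u u' IHu IHu']; first by rewrite !(mulr0, scaler0).
    by rewrite scale_tens !mul_tens scale_tens scalerAl.
  by rewrite !mulrDr scalerDr IHu IHu'.
by rewrite !(mulrDl, scalerDr) IHt IHt'.
Qed.

Lemma one_tens : 1 = 1 ⊙ 1 :> A ⊗ B. Proof. by []. Qed.

End TensorRing.

Section BaseChange.
Variables (R : comNzRingType) (S : comAlgType R) (M : lmodType R).

Definition bc : Type := S ⊗ M.
HB.instance Definition _ := GRing.Zmodule.on bc.

Definition bcscale (s : S) (t : bc) : bc :=
  tlift (fun s' m => (s * s') ⊙ m) t.

Let bcscale_balanced s : balanced (fun (s' : S) (m : M) => (s * s') ⊙ m).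
Proof.
split=> [x x' y|x y y'|k x y]; first by rewrite mulrDr tensDl.
  by rewrite tensDr.
by rewrite -scalerAr tensZ.
Qed.

Lemma bcscale_tens s (s' : S) (m : M) : bcscale s (s' ⊙ m) = (s * s') ⊙ m.
Proof. exact: (tlift_tens (bcscale_balanced s)). Qed.

Let bcscale0 s : bcscale s 0 = 0.
Proof. exact: (tlift0 (bcscale_balanced s)). Qed.

Let bcscaleDr : right_distributive bcscale +%R.
Proof. by move=> s t u; exact: (tliftD (bcscale_balanced s)). Qed.

Let bcscaleA a b t : bcscale a (bcscale b t) = bcscale (a * b) t.
Proof.
elim/tensor_ind: t => [|s m|t u IHt IHu]; first by rewrite !bcscale0.
  by rewrite !bcscale_tens mulrA.
by rewrite !bcscaleDr IHt IHu.
Qed.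

Let bcscale1 : left_id 1 bcscale.
Proof.
elim/tensor_ind=> [|s m|t u IHt IHu]; first by rewrite bcscale0.
  by rewrite bcscale_tens mul1r.
by rewrite bcscaleDr IHt IHu.
Qed.

Let bcscaleDl t : {morph bcscale^~ t : a b / a + b}.
Proof.
move=> a b; elim/tensor_ind: t => [|s m|t u IHt IHu].
- by rewrite !bcscale0 addr0.
- by rewrite !bcscale_tens mulrDl tensDl.
by rewrite !bcscaleDr IHt IHu addrACA.
Qed.

HB.instance Definition _ := GRing.Zmodule_isLmodule.Build S bc
  bcscaleA bcscale1 bcscaleDr bcscaleDl.

Lemma scale_bc (s s' : S) (m : M) : s *: (s' ⊙ m : bc) = (s * s') ⊙ m.
Proof. exact: bcscale_tens. Qed.

Definition bci (m : M) : bc := 1 ⊙ m.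

Lemma bciD : {morph bci : x y / x + y}. Proof. exact: tensDr. Qed.

Lemma bciZ a m : bci (a *: m) = a%:A *: bci m.
Proof. by rewrite scale_bc mulr1 /bci tensZ. Qed.

Lemma bciE (s : S) m : s ⊙ m = s *: bci m.
Proof. by rewrite scale_bc mulr1. Qed.

End BaseChange.

(* An affine group scheme over R is given by its commutative Hopf algebra. *)
Record affGroup (R : comNzRingType) := AffGroup {
  coord :> comAlgType R;
  comul : {linear coord -> coord ⊗ coord};
  counit : {lrmorphism coord -> R^o};
  antip : {lrmorphism coord -> coord};
  comul_monoid : monoid_morphism comul;
  comulA : forall f, tassoc (tmap comul idfun (comul f)) =
                     tmap idfun comul (comul f);
  counitl : forall f, tlift (fun a b => (counit a : R) *: b) (comul f) = f;
  counitr : forall f, tlift (fun a b => (counit b : R) *: a) (comul f) = f;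
  antipl : forall f, tlift (fun a b => antip a * b) (comul f) = (counit f)%:A;
  antipr : forall f, tlift (fun a b => a * antip b) (comul f) = (counit f)%:A }.

(* Representations of G; the coaction v |-> \sum_i v_i ⊙ a_i encodes the
   action g v = \sum_i a_i(g) v_i of the points of G *)
Record repn (R : comNzRingType) (G : affGroup R) (V : lmodType R) := Repn {
  coact :> {linear V -> V ⊗ G};
  coactA : forall v, tassoc (tmap coact idfun (coact v)) =
                     tmap idfun (comul G) (coact v);
  coact1 : forall v, tlift (fun w a => (counit G a : R) *: w) (coact v) = v }.

(* (g f)(x) = f (x g) *)
Definition regular_repn (R : comNzRingType) (G : affGroup R) : repn G G :=
  Repn (@comulA R G) (@counitr R G).

Definition repn_point (R : comNzRingType) (G : affGroup R) (V : lmodType R)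
    (rho : repn G V) (S : comAlgType R) (g : {lrmorphism G -> S}) :
    bc S V -> bc S V :=
  tlift (fun s v => tlift (fun w a => (s * g a) ⊙ w) (rho v)).

Section RepnPoint.
Variables (R : comNzRingType) (G : affGroup R) (V : lmodType R).
Variables (rho : repn G V) (S : comAlgType R) (g : {lrmorphism G -> S}).

Lemma repn_point_balanced1 (s : S) :
  balanced (fun (w : V) (a : G) => (s * g a) ⊙ w).
Proof.
split=> [w w' a|w a a'|k w a]; first by rewrite tensDr.
  by rewrite linearD mulrDr tensDl.
by rewrite linearZ -scalerAr tensZ.
Qed.

Lemma repn_point_tens (s : S) v :
  repn_point rho g (s ⊙ v) = tlift (fun w a => (s * g a) ⊙ w) (rho v).
Proof.
have b := repn_point_balanced1.
apply: (@tlift_tens _ _ _ _ _ _ s v); split=> [t t' x|t x x'|k t x].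
- elim/tensor_ind: (rho x) => [|w a|y z IHy IHz].
  + by rewrite !(tlift0 (b _)) addr0.
  + by rewrite !(tlift_tens (b _)) mulrDl tensDl.
  + by rewrite !(tliftD (b _)) IHy IHz addrACA.
- by rewrite linearD (tliftD (b _)).
rewrite linearZ /=; elim/tensor_ind: (rho x) => [|w a|y z IHy IHz].
- by rewrite scaler0 !(tlift0 (b _)).
- by rewrite scale_tens !(tlift_tens (b _)) -scalerAl tensZ.
by rewrite scalerDr !(tliftD (b _)) IHy IHz.
Qed.
End RepnPoint.

Lemma balanced_scalel (R : comNzRingType) (M : lmodType R) (A : comAlgType R)
  (e : {lrmorphism A -> R^o}) : balanced (fun (a : A) (m : M) => (e a : R) *: m).
Proof.
split=> [x x' y|x y y'|k x y]; first by rewrite linearD scalerDl.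
  by rewrite scalerDr.
by rewrite linearZ /= [RHS]scalerA [in RHS]mulrC.
Qed.

Lemma balanced_scaler (R : comNzRingType) (M : lmodType R) (A : comAlgType R)
  (e : {lrmorphism A -> R^o}) : balanced (fun (m : M) (a : A) => (e a : R) *: m).
Proof.
split=> [x x' y|x y y'|k x y]; first by rewrite scalerDr.
  by rewrite linearD scalerDl.
by rewrite [e (_ *: _)]linearZ [LHS]scalerA mulrC.
Qed.

Lemma balanced_mul (R : comNzRingType) (A : comAlgType R)
  (f g : {linear A -> A}) : balanced (fun a b => f a * g b).
Proof.
split=> [x x' y|x y y'|k x y]; first by rewrite linearD mulrDl.
  by rewrite linearD mulrDr.
by rewrite !linearZ /= -scalerAl -scalerAr.
Qed.

Section BaseChangeGroup.
Variables (R : comNzRingType) (S : comAlgType R) (G : affGroup R).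

Definition bc_coord : Type := bc S G.
HB.instance Definition _ := GRing.Lmodule.on bc_coord.

Let one : bc_coord := (1 : S ⊗ G).
Let mul (t u : bc_coord) : bc_coord := ((t : S ⊗ G) * (u : S ⊗ G)).
Let mulA : associative mul. Proof. by move=> t u v; exact: mulrA. Qed.
Let mulC : commutative mul. Proof. by move=> t u; exact: mulrC. Qed.
Let mul1 : left_id one mul. Proof. by move=> t; exact: mul1r. Qed.
Let mulDl : left_distributive mul +%R.
Proof. by move=> t u v; exact: mulrDl. Qed.

Let eps (t : S ⊗ G) : S := tlift (fun s a => (counit G a : R) *: s) t.

Let one_neq0 : one != 0.
Proof.
apply/eqP => /(congr1 eps).
rewrite /eps (tlift0 (balanced_scaler _ _)) /one one_tens.
rewrite (tlift_tens (balanced_scaler _ _)) rmorph1 scale1r.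
by apply/eqP; rewrite oner_eq0.
Qed.

HB.instance Definition _ := GRing.Zmodule_isComNzRing.Build bc_coord
  mulA mulC mul1 mulDl one_neq0.

Lemma bc_mulE (s s' : S) (a a' : G) :
  ((s ⊙ a : bc_coord) * (s' ⊙ a' : bc_coord)) = (s * s') ⊙ (a * a').
Proof. exact: tmul_tens. Qed.

Lemma bc_ind (P : bc_coord -> Prop) : P 0 -> (forall (s : S) (a : G), P (s ⊙ a)) ->
  (forall t u, P t -> P u -> P (t + u)) -> forall t, P t.
Proof. exact: tensor_ind. Qed.

Let scaleAl (s : S) (t u : bc_coord) : s *: (t * u) = (s *: t) * u.
Proof.
elim/bc_ind: t => [|s1 a1|t t' IHt IHt']; first by rewrite !(mul0r, scaler0).
  elim/bc_ind: u => [|s2 a2|u u' IHu IHu']; first by rewrite !(mulr0, scaler0).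
    rewrite [in RHS](scale_bc s s1 a1) !bc_mulE.
    by rewrite [LHS](scale_bc s (s1 * s2) (a1 * a2)) mulrA.
  by rewrite !mulrDr scalerDr IHu IHu'.
by rewrite !(mulrDl, scalerDr) IHt IHt'.
Qed.

HB.instance Definition _ :=
  GRing.Lmodule_isLalgebra.Build S bc_coord scaleAl.
HB.instance Definition _ := GRing.Lalgebra_isComAlgebra.Build S bc_coord.

Definition bcc (a : G) : bc_coord := 1 ⊙ a.

Lemma bccE (s : S) a : (s ⊙ a : bc_coord) = s *: bcc a.
Proof. exact: bciE. Qed.
Lemma bccD : {morph bcc : a b / a + b}. Proof. exact: tensDr. Qed.
Lemma bccZ k a : bcc (k *: a) = k%:A *: bcc a. Proof. exact: bciZ. Qed.
Lemma bccM : {morph bcc : a b / a * b}.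
Proof. by move=> a b; rewrite bc_mulE mulr1. Qed.
Lemma bcc1 : bcc 1 = 1. Proof. by []. Qed.

Section Ext.
Variables (Z : lmodType S) (f : G -> Z).
Hypothesis (fD : {morph f : a b / a + b}).
Hypothesis (fZ : forall k a, f (k *: a) = k%:A *: f a).
Definition bc_ext (t : bc_coord) : Z := tlift (fun s a => s *: f a) t.

Let bc_ext_balanced : balanced (fun (s : S) (a : G) => s *: f a).
Proof.
split=> [s s' a|s a a'|k s a]; first by rewrite scalerDl.
  by rewrite fD scalerDr.
by rewrite fZ scalerA -scalerAr mulr1.
Qed.

Lemma bc_extE a : bc_ext (bcc a) = f a.
Proof. by rewrite /bc_ext (tlift_tens bc_ext_balanced) scale1r. Qed.

Lemma bc_ext_semilinear : semilinear bc_ext.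
Proof.
split=> [s t|t u]; last exact: (tliftD bc_ext_balanced).
elim/bc_ind: t => [|s1 a1|t t' IHt IHt'].
- by rewrite scaler0 /bc_ext (tlift0 bc_ext_balanced) scaler0.
- rewrite [X in bc_ext X](scale_bc s s1 a1) /bc_ext.
  by rewrite !(tlift_tens bc_ext_balanced) scalerA.
by rewrite scalerDr /bc_ext !(tliftD bc_ext_balanced) scalerDr -IHt -IHt'.
Qed.
End Ext.

Definition bcc2 (t : G ⊗ G) : bc_coord ⊗ bc_coord :=
  tlift (fun a b => bcc a ⊙ bcc b) t.

Let bcc2_balanced : balanced (fun a b => bcc a ⊙ bcc b).
Proof.
split=> [a a' b|a b b'|k a b]; rewrite ?bccD ?tensDl ?tensDr //.
by rewrite !bccZ tensZ.
Qed.

Lemma bcc2_tens a b : bcc2 (a ⊙ b) = bcc a ⊙ bcc b.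
Proof. exact: (tlift_tens bcc2_balanced). Qed.
Lemma bcc2D : {morph bcc2 : t u / t + u}.
Proof. exact: (tliftD bcc2_balanced). Qed.
Lemma bcc20 : bcc2 0 = 0. Proof. exact: (tlift0 bcc2_balanced). Qed.
Lemma bcc2Z k t : bcc2 (k *: t) = k%:A *: bcc2 t.
Proof.
elim/tensor_ind: t => [|a b|t u IHt IHu]; first by rewrite scaler0 bcc20 scaler0.
  by rewrite scale_tens !bcc2_tens bccZ scale_tens.
by rewrite scalerDr !bcc2D IHt IHu scalerDr.
Qed.
Lemma bcc2M : {morph bcc2 : t u / t * u}.
Proof.
move=> t u; elim/tensor_ind: t => [|a b|t t' IHt IHt'].
- by rewrite mul0r bcc20 mul0r.
- elim/tensor_ind: u => [|c d|u u' IHu IHu']; first by rewrite mulr0 bcc20 mulr0.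
    by rewrite mul_tens !bcc2_tens mul_tens !bccM.
  by rewrite mulrDr !bcc2D mulrDr IHu IHu'.
by rewrite mulrDl !bcc2D mulrDl IHt IHt'.
Qed.

Definition bc_comul : bc_coord -> bc_coord ⊗ bc_coord :=
  bc_ext (fun a => bcc2 (comul G a)).

Let comulD : {morph (fun a => bcc2 (comul G a)) : a b / a + b}.
Proof. by move=> a b; rewrite linearD bcc2D. Qed.
Let comulZ k a : bcc2 (comul G (k *: a)) = k%:A *: bcc2 (comul G a).
Proof. by rewrite linearZ bcc2Z. Qed.

HB.instance Definition _ :=
  GRing.isSemilinear.Build S bc_coord (bc_coord ⊗ bc_coord) _ bc_comul
    (bc_ext_semilinear comulD comulZ).

Lemma bc_comulE a : bc_comul (bcc a) = bcc2 (comul G a).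
Proof. exact: (bc_extE comulD comulZ). Qed.

Definition bc_counit : bc_coord -> S^o := bc_ext (fun a => (counit G a)%:A : S^o).

Let counitD : {morph (fun a => (counit G a)%:A : S^o) : a b / a + b}.
Proof. by move=> a b; rewrite linearD scalerDl. Qed.
Let counitZ k a : ((counit G (k *: a))%:A : S^o) = k%:A *: ((counit G a)%:A : S^o).
Proof.
by rewrite linearZ; exact: (rmorphM (in_alg S) k (counit G a)).
Qed.

HB.instance Definition _ :=
  GRing.isSemilinear.Build S bc_coord S^o _ bc_counit
    (bc_ext_semilinear counitD counitZ).

Lemma bc_counitE a : bc_counit (bcc a) = (counit G a)%:A.
Proof. exact: (bc_extE counitD counitZ). Qed.

Definition bc_antip : bc_coord -> bc_coord := bc_ext (fun a => bcc (antip G a)).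

Let antipD : {morph (fun a => bcc (antip G a)) : a b / a + b}.
Proof. by move=> a b; rewrite linearD bccD. Qed.
Let antipZ k a : bcc (antip G (k *: a)) = k%:A *: bcc (antip G a).
Proof. by rewrite linearZ bccZ. Qed.

HB.instance Definition _ :=
  GRing.isSemilinear.Build S bc_coord bc_coord _ bc_antip
    (bc_ext_semilinear antipD antipZ).

Lemma bc_antipE a : bc_antip (bcc a) = bcc (antip G a).
Proof. exact: (bc_extE antipD antipZ). Qed.

Lemma bc_lin_ind (P : bc_coord -> Prop) : P 0 ->
  (forall (s : S) t, P t -> P (s *: t)) -> (forall t u, P t -> P u -> P (t + u)) ->
  (forall a, P (bcc a)) -> forall t, P t.
Proof.
by move=> P0 PZ PD Pc; elim/bc_ind => [//|s a|//]; rewrite bccE; exact: PZ.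
Qed.

Lemma bc_lin_eq (Z : lmodType S) (f g : bc_coord -> Z) :
  semilinear f -> semilinear g ->
  (forall a, f (bcc a) = g (bcc a)) -> f =1 g.
Proof.
move=> [fZ fD] [gZ gD] fg; elim/bc_lin_ind => //.
- by rewrite -(scale0r 0) fZ gZ !scale0r.
- by move=> s t; rewrite fZ gZ => ->.
by move=> t u; rewrite fD gD => -> ->.
Qed.

Lemma bc_mul_ext (Z : comPzRingType) (scale : S -> Z -> Z)
    (f : bc_coord -> Z) :
  (forall s x y, scale s (x * y) = scale s x * y) ->
  {morph f : t u / t + u} -> (forall s t, f (s *: t) = scale s (f t)) ->
  (forall a b, f (bcc a * bcc b) = f (bcc a) * f (bcc b)) ->
  {morph f : t u / t * u}.
Proof.
move=> sA fD fZ fM.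
have f0 : f 0 = 0 by apply: (addrI (f 0)); rewrite -fD !addr0.
move=> t u; elim/bc_lin_ind: t => [|s t IHt|t t' IHt IHt'|a].
- by rewrite mul0r f0 mul0r.
- by rewrite -scalerAl !fZ IHt sA.
- by rewrite mulrDl !fD IHt IHt' mulrDl.
elim/bc_lin_ind: u => [|s t IHt|t t' IHt IHt'|b].
- by rewrite mulr0 f0 mulr0.
- by rewrite -scalerAr !fZ IHt mulrC sA mulrC.
- by rewrite mulrDr !fD IHt IHt' mulrDr.
exact: fM.
Qed.

Fact bc_comul_monoid : monoid_morphism bc_comul.
Proof.
have [c1 cM] := comul_monoid G; split.
  by apply: etrans (bc_comulE 1) _; rewrite c1 one_tens bcc2_tens.
apply: (bc_mul_ext (@tens_scalerAl _ _ _)); first exact: linearD.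
  by move=> s t; rewrite linearZ.
by move=> a b; rewrite -bccM !bc_comulE cM bcc2M.
Qed.

Fact bc_counit_monoid : monoid_morphism bc_counit.
Proof.
split; first by apply: etrans (bc_counitE 1) _; rewrite rmorph1 scale1r.
apply: (bc_mul_ext (@mulrA S)); first exact: linearD.
  by move=> s t; rewrite linearZ.
move=> a b; rewrite -bccM !bc_counitE rmorphM.
exact: (rmorphM (in_alg S)).
Qed.
HB.instance Definition _ :=
  GRing.isMonoidMorphism.Build bc_coord S^o bc_counit bc_counit_monoid.

Fact bc_antip_monoid : monoid_morphism bc_antip.
Proof.
split; first by apply: etrans (bc_antipE 1) _; rewrite rmorph1.
apply: (bc_mul_ext (@scalerAl _ _)); first exact: linearD.
  by move=> s t; rewrite linearZ.
by move=> a b; rewrite -bccM !bc_antipE rmorphM bccM.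
Qed.
HB.instance Definition _ :=
  GRing.isMonoidMorphism.Build bc_coord bc_coord bc_antip bc_antip_monoid.

Let l3 (w : (G ⊗ G) ⊗ G) : (bc_coord ⊗ bc_coord) ⊗ bc_coord :=
  tlift (fun t c => bcc2 t ⊙ bcc c) w.
Let r3 (w : G ⊗ (G ⊗ G)) : bc_coord ⊗ (bc_coord ⊗ bc_coord) :=
  tlift (fun a t => bcc a ⊙ bcc2 t) w.

Let l3b : balanced (fun t c => bcc2 t ⊙ bcc c).
Proof.
split=> [x x' y|x y y'|k x y]; first by rewrite bcc2D tensDl.
  by rewrite bccD tensDr.
by rewrite bccZ bcc2Z tensZ.
Qed.
Let r3b : balanced (fun a t => bcc a ⊙ bcc2 t).
Proof.
split=> [x x' y|x y y'|k x y]; first by rewrite bccD tensDl.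
  by rewrite bcc2D tensDr.
by rewrite bccZ bcc2Z tensZ.
Qed.

Let l3E t : tmap bc_comul idfun (bcc2 t) = l3 (tmap (comul G) idfun t).
Proof.
elim/tensor_ind: t => [|a b|t u IHt IHu].
- by rewrite bcc20 !linear0 /l3 (tlift0 l3b).
- by rewrite bcc2_tens !tmap_tens /= bc_comulE /l3 (tlift_tens l3b).
by rewrite bcc2D !linearD /= IHt IHu /l3 (tliftD l3b).
Qed.

Let r3E t : tmap idfun bc_comul (bcc2 t) = r3 (tmap idfun (comul G) t).
Proof.
elim/tensor_ind: t => [|a b|t u IHt IHu].
- by rewrite bcc20 !linear0 /r3 (tlift0 r3b).
- by rewrite bcc2_tens !tmap_tens /= bc_comulE /r3 (tlift_tens r3b).
by rewrite bcc2D !linearD /= IHt IHu /r3 (tliftD r3b).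
Qed.

Let tassoc3 w : tassoc (l3 w) = r3 (tassoc w).
Proof.
elim/tensor_ind: w => [|t c|t u IHt IHu].
- by rewrite /l3 (tlift0 l3b) !tassoc0 /r3 (tlift0 r3b).
- rewrite /l3 (tlift_tens l3b) /r3.
  elim/tensor_ind: t => [|a b|t u IHt IHu].
  + by rewrite bcc20 !tens0l !tassoc0 (tlift0 r3b).
  + by rewrite bcc2_tens !tassoc_tens (tlift_tens r3b) bcc2_tens.
  + by rewrite bcc2D !tensDl !tassocD (tliftD r3b) IHt IHu.
by rewrite /l3 (tliftD l3b) !tassocD /r3 (tliftD r3b) -/(r3 _) -/(r3 _) -IHt -IHu.
Qed.

Let tassoc_semilinear (M N P : lmodType S) : semilinear (@tassoc S M N P).
Proof.
split; last exact: tassocD.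
move=> s w; elim/tensor_ind: w => [|t c|t u IHt IHu].
- by rewrite scaler0 !tassoc0 scaler0.
- elim/tensor_ind: t => [|a b|t u IHt IHu].
  + by rewrite tens0l scaler0 !tassoc0 scaler0.
  + by rewrite !scale_tens !tassoc_tens scale_tens.
  + by rewrite tensDl scalerDr !tassocD scalerDr IHt IHu.
by rewrite scalerDr !tassocD scalerDr IHt IHu.
Qed.

Fact bc_comulA f : tassoc (tmap bc_comul idfun (bc_comul f)) =
                   tmap idfun bc_comul (bc_comul f).
Proof.
move: f; apply: bc_lin_eq => [||a].
- have [tZ tD] := @tassoc_semilinear bc_coord bc_coord bc_coord.
  by split=> [s t|t u]; rewrite ?linearZ ?linearD ?tZ ?tD.
- by split=> [s t|t u]; rewrite ?linearZ ?linearD.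
by rewrite bc_comulE l3E tassoc3 comulA -r3E.
Qed.

Fact bc_counitl f :
  tlift (fun a b => (bc_counit a : S) *: b) (bc_comul f) = f.
Proof.
have eb : balanced (fun a b : bc_coord => (bc_counit a : S) *: b)
  by exact: (@balanced_scalel S bc_coord bc_coord bc_counit).
have eZ : scalable (tlift (fun a b : bc_coord => (bc_counit a : S) *: b)).
  by apply: tliftZ eb _ => s x y; rewrite [bc_counit (_ *: _)]linearZ -scalerA.
have eD := tliftD eb.
move: f; apply: bc_lin_eq => [||a] //.
  by split=> [s t|t u]; rewrite ?linearZ ?linearD ?eZ ?eD.
rewrite bc_comulE -[in RHS](counitl a).
have gb := balanced_scalel G (counit G).
elim/tensor_ind: (comul G a) => [|b c|t u IHt IHu].
- by rewrite bcc20 (tlift0 eb) (tlift0 gb) /bcc tens0r.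
- by rewrite bcc2_tens (tlift_tens eb) (tlift_tens gb) bc_counitE bccZ.
by rewrite bcc2D eD (tliftD gb) bccD IHt IHu.
Qed.

Fact bc_counitr f :
  tlift (fun a b => (bc_counit b : S) *: a) (bc_comul f) = f.
Proof.
have eb : balanced (fun a b : bc_coord => (bc_counit b : S) *: a)
  by exact: (@balanced_scaler S bc_coord bc_coord bc_counit).
have eZ : scalable (tlift (fun a b : bc_coord => (bc_counit b : S) *: a)).
  by apply: tliftZ eb _ => s x y; rewrite !scalerA mulrC.
have eD := tliftD eb.
move: f; apply: bc_lin_eq => [||a] //.
  by split=> [s t|t u]; rewrite ?linearZ ?linearD ?eZ ?eD.
rewrite bc_comulE -[in RHS](counitr a).
have gb := balanced_scaler G (counit G).
elim/tensor_ind: (comul G a) => [|b c|t u IHt IHu].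
- by rewrite bcc20 (tlift0 eb) (tlift0 gb) /bcc tens0r.
- by rewrite bcc2_tens (tlift_tens eb) (tlift_tens gb) bc_counitE bccZ.
by rewrite bcc2D eD (tliftD gb) bccD IHt IHu.
Qed.

Fact bc_antipl f :
  tlift (fun a b => bc_antip a * b) (bc_comul f) = (bc_counit f)%:A.
Proof.
have eb : balanced (fun a b => bc_antip a * b) := balanced_mul bc_antip idfun.
have eZ : scalable (tlift (fun a b : bc_coord => bc_antip a * b)).
  by apply: tliftZ eb _ => s x y; rewrite linearZ -scalerAl.
have eD := tliftD eb.
move: f; apply: bc_lin_eq => [||a].
- by split=> [s t|t u]; rewrite ?linearZ ?linearD ?eZ ?eD.
- split=> [s t|t u]; last by rewrite [bc_counit (_ + _)]linearD scalerDl.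
  by rewrite [bc_counit (_ *: _)]linearZ [RHS]scalerA.
rewrite bc_comulE bc_counitE -bcc1 -bccZ -antipl.
have gb : balanced (fun a b => antip G a * b) := balanced_mul (antip G) idfun.
elim/tensor_ind: (comul G a) => [|b c|t u IHt IHu].
- by rewrite bcc20 (tlift0 eb) (tlift0 gb) /bcc tens0r.
- by rewrite bcc2_tens (tlift_tens eb) (tlift_tens gb) bc_antipE bccM.
by rewrite bcc2D eD (tliftD gb) bccD IHt IHu.
Qed.

Fact bc_antipr f :
  tlift (fun a b => a * bc_antip b) (bc_comul f) = (bc_counit f)%:A.
Proof.
have eb : balanced (fun a b => a * bc_antip b) := balanced_mul idfun bc_antip.
have eZ : scalable (tlift (fun a b : bc_coord => a * bc_antip b)).
  by apply: tliftZ eb _ => s x y; rewrite -scalerAl.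
have eD := tliftD eb.
move: f; apply: bc_lin_eq => [||a].
- by split=> [s t|t u]; rewrite ?linearZ ?linearD ?eZ ?eD.
- split=> [s t|t u]; last by rewrite [bc_counit (_ + _)]linearD scalerDl.
  by rewrite [bc_counit (_ *: _)]linearZ [RHS]scalerA.
rewrite bc_comulE bc_counitE -bcc1 -bccZ -antipr.
have gb : balanced (fun a b => a * antip G b) := balanced_mul idfun (antip G).
elim/tensor_ind: (comul G a) => [|b c|t u IHt IHu].
- by rewrite bcc20 (tlift0 eb) (tlift0 gb) /bcc tens0r.
- by rewrite bcc2_tens (tlift_tens eb) (tlift_tens gb) bc_antipE bccM.
by rewrite bcc2D eD (tliftD gb) bccD IHt IHu.
Qed.

Definition bc_group : affGroup S :=
  AffGroup bc_comul_monoid bc_comulA bc_counitl bc_counitr bc_antipl bc_antipr.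

End BaseChangeGroup.

Section Submodule.
Variables (R : comNzRingType) (M : lmodType R) (V : submodClosed M).
Definition submod : Type := {x : M | x \in V}.
HB.instance Definition _ := SubType.on submod.
HB.instance Definition _ := [Choice of submod by <:].
HB.instance Definition _ := [SubChoice_isSubLmodule of submod by <:].
Definition submod_val : {linear submod -> M} := val.
End Submodule.

Section Dual.
Variables (R : comNzRingType) (M : lmodType R).

Definition dual : Type := {linear M -> R^o}.
HB.instance Definition _ := gen_eqMixin dual.
HB.instance Definition _ := gen_choiceMixin dual.

Definition dual_fun (phi : dual) : {linear M -> R^o} := phi.

Lemma dual_ext (phi psi : dual) : dual_fun phi =1 dual_fun psi -> phi = psi.
Proof.
case: phi psi => [f [[f1] [f2]]] [g [[g1] [g2]]] /= /funext /= fg.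
case: g / fg g1 g2 => g1 g2.
by rewrite (Prop_irrelevance f1 g1) (Prop_irrelevance f2 g2).
Qed.

Definition dzero : dual := (\0 : M -> R^o).
Definition dopp (phi : dual) : dual := \- dual_fun phi.
Definition dadd (phi psi : dual) : dual := dual_fun phi \+ dual_fun psi.
Definition dscale (a : R) (phi : dual) : dual := a \*: dual_fun phi.

Let daddA : associative dadd.
Proof. by move=> f g h; apply: dual_ext => x /=; rewrite addrA. Qed.
Let daddC : commutative dadd.
Proof. by move=> f g; apply: dual_ext => x /=; rewrite addrC. Qed.
Let dadd0 : left_id dzero dadd.
Proof. by move=> f; apply: dual_ext => x /=; rewrite add0r. Qed.
Let daddN : left_inverse dzero dopp dadd.
Proof. by move=> f; apply: dual_ext => x /=; rewrite addNr. Qed.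
HB.instance Definition _ := GRing.isZmodule.Build dual daddA daddC dadd0 daddN.

Let dscaleA a b f : dscale a (dscale b f) = dscale (a * b) f.
Proof. by apply: dual_ext => x /=; rewrite scalerA. Qed.
Let dscale1 : left_id 1 dscale.
Proof. by move=> f; apply: dual_ext => x /=; rewrite scale1r. Qed.
Let dscaleDr : right_distributive dscale +%R.
Proof. by move=> a f g; apply: dual_ext => x /=; rewrite scalerDr. Qed.
Let dscaleDl f : {morph dscale^~ f : a b / a + b}.
Proof. by move=> a b; apply: dual_ext => x /=; rewrite scalerDl. Qed.
HB.instance Definition _ := GRing.Zmodule_isLmodule.Build R dual
  dscaleA dscale1 dscaleDr dscaleDl.
End Dual.

Section DualMap.
Variables (R : comNzRingType) (M N : lmodType R) (f : {linear M -> N}).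
Definition dual_map (phi : dual N) : dual M := dual_fun phi \o f.
Fact dual_map_is_semilinear : semilinear dual_map.
Proof. by split=> [a phi|phi psi]; apply: dual_ext. Qed.
HB.instance Definition _ := GRing.isSemilinear.Build R (dual N) (dual M) _
  dual_map dual_map_is_semilinear.
End DualMap.

Fixpoint tpow (R : comNzRingType) (M : lmodType R) (m : nat) : lmodType R :=
  if m is m'.+1 then M ⊗ tpow M m' else R^o.

Definition tspace (R : comNzRingType) (M : lmodType R) (m n : nat) : lmodType R :=
  tpow M m ⊗ tpow (dual M) n.

Fixpoint tpow_map (R : comNzRingType) (M N : lmodType R) (f : {linear M -> N})
    (m : nat) : {linear tpow M m -> tpow N m} :=
  match m return {linear tpow M m -> tpow N m} with
  | 0 => idfun
  | m'.+1 => tmap f (tpow_map f m')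
  end.

Record gl (R : comNzRingType) (M : lmodType R) := Gl {
  gl_fun :> {linear M -> M};
  gl_inv : {linear M -> M};
  gl_funK : cancel gl_fun gl_inv;
  gl_invK : cancel gl_inv gl_fun }.

(* g acts on the dual by phi |-> phi \o g^-1 *)
Definition tspace_act (R : comNzRingType) (M : lmodType R) (g : gl M) (m n : nat) :
    tspace M m n -> tspace M m n :=
  tmap (tpow_map g m) (tpow_map (dual_map (gl_inv g)) n).

Section TensorBaseChange.
Variables (R : comNzRingType) (S : comAlgType R).

Section Pow.
Variables (M : lmodType R) (N : lmodType S) (h : M -> N).
Fixpoint tpow_bc (m : nat) : tpow M m -> tpow N m :=
  match m return tpow M m -> tpow N m with
  | 0 => in_alg S
  | m'.+1 => tlift (fun x t => h x ⊙ tpow_bc t)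
  end.

Hypothesis hD : {morph h : x y / x + y}.
Hypothesis hZ : forall a x, h (a *: x) = a%:A *: h x.

Lemma tpow_bc_spec (m : nat) :
  [/\ {morph @tpow_bc m : t u / t + u},
      forall a t, @tpow_bc m (a *: t) = a%:A *: tpow_bc t &
      balanced (fun x (t : tpow M m) => h x ⊙ tpow_bc t)].
Proof.
have H m' : {morph @tpow_bc m' : t u / t + u} ->
  (forall a t, @tpow_bc m' (a *: t) = a%:A *: tpow_bc t) ->
  balanced (fun x (t : tpow M m') => h x ⊙ tpow_bc t).
  move=> tD tZ; split=> [x x' t|x t t'|a x t]; first by rewrite hD tensDl.
    by rewrite tD tensDr.
  by rewrite hZ tZ tensZ.
elim: m => [|m [IHD IHZ IHb]].
  have tD : {morph @tpow_bc 0 : t u / t + u} by exact: (rmorphD (in_alg S)).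
  have tZ a t : @tpow_bc 0 (a *: t) = a%:A *: tpow_bc t.
    exact: (rmorphM (in_alg S)).
  by split=> //; exact: H.
have tD : {morph @tpow_bc m.+1 : t u / t + u} by exact: (tliftD IHb).
have tZ a t : @tpow_bc m.+1 (a *: t) = a%:A *: tpow_bc t.
  elim/tensor_ind: t => [|x t|t u IHt IHu].
  - by rewrite scaler0 /= (tlift0 IHb) scaler0.
  - by rewrite scale_tens /= !(tlift_tens IHb) hZ scale_tens.
  by rewrite scalerDr !tD IHt IHu scalerDr.
by split=> //; exact: H.
Qed.

Lemma tpow_bc_tens m x (t : tpow M m) :
  @tpow_bc m.+1 (x ⊙ t) = h x ⊙ tpow_bc t.
Proof. by have [_ _ b] := tpow_bc_spec m; exact: (tlift_tens b). Qed.
End Pow.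

Variable (M : lmodType R).

Section DualBC.
Variable (phi : dual M).
Definition dual_ext_fun (t : bc S M) : S^o :=
  tlift (fun s x => (dual_fun phi x : R) *: s) t.

Let dual_ext_balanced :
  balanced (fun (s : S) x => (dual_fun phi x : R) *: s).
Proof.
split=> [s s' x|s x x'|a s x]; first by rewrite scalerDr.
  by rewrite linearD scalerDl.
by rewrite [dual_fun phi (_ *: _)]linearZ scalerA mulrC.
Qed.

Lemma dual_ext_funE (s : S) x : dual_ext_fun (s ⊙ x) = (dual_fun phi x : R) *: s.
Proof. exact: (tlift_tens dual_ext_balanced). Qed.

Fact dual_ext_is_semilinear : semilinear dual_ext_fun.
Proof.
split; last exact: (tliftD dual_ext_balanced).
move=> s t; elim/tensor_ind: t => [|s' x|t u IHt IHu].
- by rewrite scaler0 /dual_ext_fun !(tlift0 dual_ext_balanced) scaler0.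
- by rewrite scale_bc !dual_ext_funE scalerAr.
rewrite scalerDr /dual_ext_fun !(tliftD dual_ext_balanced).
by rewrite -/(dual_ext_fun _) -/(dual_ext_fun _) IHt IHu scalerDr.
Qed.
HB.instance Definition _ := GRing.isSemilinear.Build S (bc S M) S^o _
  dual_ext_fun dual_ext_is_semilinear.
Definition dual_bc : dual (bc S M) := dual_ext_fun.
End DualBC.

(* The image over S of a tensor over R: v |-> 1 ⊙ v on the factors V, and
   phi |-> its S-linear extension on the factors dual V *)
Definition tspace_bc (m n : nat) (t : tspace M m n) : tspace (bc S M) m n :=
  tlift (fun x y => tpow_bc (@bci R S M) x ⊙ tpow_bc dual_bc y) t.

Lemma dual_bcD : {morph dual_bc : phi psi / phi + psi}.
Proof.
move=> phi psi; apply: dual_ext; elim/tensor_ind => [|s x|t u IHt IHu].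
- by rewrite !linear0.
- by rewrite [LHS]dual_ext_funE scalerDl -!dual_ext_funE.
by rewrite !linearD IHt IHu.
Qed.

Lemma dual_bcZ a phi : dual_bc (a *: phi) = a%:A *: dual_bc phi.
Proof.
apply: dual_ext; elim/tensor_ind => [|s x|t u IHt IHu].
- by rewrite !linear0.
- rewrite [LHS]dual_ext_funE.
  transitivity (a%:A * dual_ext_fun phi (s ⊙ x)); last by [].
  by rewrite dual_ext_funE mulr_algl scalerA.
by rewrite !linearD IHt IHu.
Qed.

Lemma tspace_bc_tens m n (x : tpow M m) (y : tpow (dual M) n) :
  tspace_bc (x ⊙ y) = tpow_bc (@bci R S M) x ⊙ tpow_bc dual_bc y.
Proof.
have [xD xZ _] := tpow_bc_spec (@bciD R S M) (@bciZ R S M) m.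
have [yD yZ _] := tpow_bc_spec dual_bcD dual_bcZ n.
apply: (@tlift_tens _ _ _ _ _ _ x y).
split=> [z z' t|z t t'|a z t]; first by rewrite xD tensDl.
  by rewrite yD tensDr.
by rewrite xZ yZ tensZ.
Qed.
End TensorBaseChange.

Section GeneralLinear.
Variables (R : comNzRingType) (V : lmodType R).

(* g is the image of u under the map GL_V(B) -> GL_V(S) induced by f *)
Definition gl_image (B S : comAlgType R) (f : {lrmorphism B -> S})
    (u : gl (bc B V)) (g : bc S V -> bc S V) : Prop :=
  forall x : bc B V, g (tmap f idfun x) = tmap f idfun (u x).

(* GL_V = Spec B, with universal point u. A comAlgType is a nonzero algebra; the
   zero algebra is harmless to omit, as GL of a zero module is trivial. *)
Definition gl_represented (B : comAlgType R) (u : gl (bc B V)) : Prop :=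
  forall (S : comAlgType R) (g : gl (bc S V)),
    exists f : {lrmorphism B -> S},
      gl_image f u g /\ forall f' : {lrmorphism B -> S}, gl_image f' u g -> f' =1 f.

(* By Yoneda, the homomorphism G -> GL_V = Spec B is given by the f : B -> O(G)
   that sends u to the action on O(G) ⊗ V of the tautological point
   id in G(O(G)); closed immersion means that f is surjective. *)
Definition closed_immersion_in_gl (G : affGroup R) (rho : repn G V) : Prop :=
  exists (B : comAlgType R) (u : gl (bc B V)), gl_represented u /\
    exists f : {lrmorphism B -> G},
      gl_image f u (repn_point rho (idfun : {lrmorphism G -> G})) /\
      (forall a, exists b, f b = a).
End GeneralLinear.

Definition flat (R : comNzRingType) (M : lmodType R) : Prop :=
  forall (N N' : lmodType R) (f : {linear N -> N'}),
    injective f -> injective (tmap f (idfun : {linear M -> M})).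

Definition fin_presented (R : comNzRingType) (M : lmodType R) : Prop :=
  exists (n r : nat) (f : {linear 'rV[R]_n -> M}) (B : 'M[R]_(r, n)),
    (forall x, exists v, f v = x) /\
    (forall v, f v = 0 <-> exists u : 'rV[R]_r, v = u *m B).

Section AlgFinPresented.
(* local, since mpoly reuses names such as symmetric *)
Import mpoly.
Definition alg_fin_presented (R : comNzRingType) (A : comAlgType R) : Prop :=
  exists (n r : nat) (x : 'I_n -> A) (q : 'I_r -> {mpoly R[n]}),
    (forall a, exists p : {mpoly R[n]}, mmap (in_alg A) x p = a) /\
    (forall p : {mpoly R[n]}, mmap (in_alg A) x p = 0 <->
       exists c : 'I_r -> {mpoly R[n]}, p = \sum_(i < r) c i * q i).
End AlgFinPresented.

Definition noetherian (R : comNzRingType) : Prop :=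
  forall I : submodClosed R^o, exists (n : nat) (a : 'I_n -> R),
    forall x : R, x \in I <-> exists c : 'I_n -> R, x = \sum_(i < n) c i * a i.

(* Convention: a field is a Dedekind domain. *)
Definition dedekind (R : idomainType) : Prop :=
  [/\ noetherian R,
      forall x : {fraction R},
        integralOver (@tofrac R) x -> exists a, x = tofrac a &
      forall P : prime_idealr R, (exists2 x : R, x \in P & x != 0) ->
        forall Q : idealr R, {subset P <= Q} -> {subset Q <= P}].

Definition principal (R : idomainType) : Prop :=
  forall I : submodClosed R^o, exists a : R,
    forall x : R, x \in I <-> exists c, x = c * a.

Section FracAlg.
Variable R : idomainType.
Definition frac_alg : Type := {fraction R}.
HB.instance Definition _ := GRing.Field.on frac_alg.

Let scale (a : R) (x : frac_alg) : frac_alg := (tofrac a : frac_alg) * x.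
Let scaleA a b x : scale a (scale b x) = scale (a * b) x.
Proof. by rewrite /scale mulrA rmorphM. Qed.
Let scale1 : left_id 1 scale.
Proof. by move=> x; rewrite /scale rmorph1 mul1r. Qed.
Let scaleDr : right_distributive scale +%R.
Proof. by move=> a x y; rewrite /scale mulrDr. Qed.
Let scaleDl x : {morph scale^~ x : a b / a + b}.
Proof. by move=> a b; rewrite /scale rmorphD mulrDl. Qed.
HB.instance Definition _ := GRing.Zmodule_isLmodule.Build R frac_alg
  scaleA scale1 scaleDr scaleDl.
Let scaleAl (a : R) (x y : frac_alg) : a *: (x * y) = (a *: x) * y.
Proof. exact: mulrA. Qed.
HB.instance Definition _ := GRing.Lmodule_isLalgebra.Build R frac_alg scaleAl.
HB.instance Definition _ := GRing.Lalgebra_isComAlgebra.Build R frac_alg.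
End FracAlg.

Definition generic_fibre (R : idomainType) (G : affGroup R) :
  affGroup (frac_alg R) := bc_group (frac_alg R) G.

Section LinearlyReductive.
Variables (K : fieldType) (G : affGroup K).

Section Subrep.
Variables (W : vectType K) (rho : repn G W).
Definition subrep (U : {vspace W}) : Prop :=
  forall w, w \in U -> exists t : subvs_of U ⊗ G,
    tmap (vsval : {linear subvs_of U -> W}) idfun t = rho w.

Definition simple_subrep (U : {vspace W}) : Prop :=
  [/\ subrep U, U != 0%VS &
      forall U' : {vspace W}, subrep U' -> (U' <= U)%VS -> U' = 0%VS \/ U' = U].

Definition semisimple : Prop :=
  exists (n : nat) (U : 'I_n -> {vspace W}),
    [/\ forall i, simple_subrep (U i), directv (\sum_i U i)%VS &
        (\sum_i U i)%VS = fullv].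
End Subrep.

Definition linearly_reductive : Prop :=
  forall (W : vectType K) (rho : repn G W), semisimple rho.
End LinearlyReductive.

(* V, with the coaction rho, is a G-stable submodule of O(G): rho is the
   restriction of the regular representation *)
Definition regular_subrep (R : comNzRingType) (G : affGroup R)
    (V : submodClosed G) (rho : repn G (submod V)) : Prop :=
  forall v, tmap (submod_val V) idfun (rho v) = regular_repn G (submod_val V v).

(* Main.v *)
(* Part 1. Let E be spanned by the left legs of the comultiplication of finitely
   many generators of A = O(G). The elements x with Delta(x) in the image of
   E ⊗ A form a submodule V of E; coassociativity and the equational criterion of
   flatness show that V is G-stable. Finitely generated torsion-free modules over
   a Dedekind domain have a finite dual basis, since nonzero ideals are
   invertible; with v_i, phi_i such a basis of V and a_ij the coaction matrix,
   counitality gives v_j = sum_i epsilon(v_i) a_ij, so the a_ij generate A.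

   Part 2. Now V is free. As G fixes 1 in V, the equations of G in GL_V can be
   made homogeneous of some degree N in the matrix entries, so that G is cut out
   by the module L of all relations sum_w c_w a_w = 0 between words of length N.
   The words form a direct sum of copies of V^{⊗N}, L is a stable direct
   summand, and G is the stabilizer of the line spanned by the Pluecker vector d
   of L. On the generic fibre L has a stable complement; the rows of a multiple of
   the projector onto L have a Pluecker vector on which G acts by the inverse
   character, and dividing it by its content gives a unimodular psi. So G fixes
   d ⊗ psi. Conversely, since d and psi are unimodular, anything fixing d ⊗ psi
   fixes the line of d, over every base. *)
Require Import Defs.
From HB Require Import structures.
From mathcomp Require Import all_boot all_order all_algebra.
From mathcomp Require Import boolp perm ring.
From mathcomp Require mpoly.
Set Implicit Arguments.
Unset Strict Implicit.
Unset Printing Implicit Defensive.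
Import GRing.Theory.
Local Open Scope ring_scope.

(** * Submodules and the equational criterion of flatness *)

Section Submodules.
Variables (R : comNzRingType) (M : lmodType R).

(** The last claim concerns points over every nonzero algebra [S], flat or not, so the way back from
    fixed tensors to points of the group may not cancel scalars. It rests on identities over [R]
    that survive base change: the basis [f] of relations comes with [h] such that f h = 1, and [psi]
    with [zeta] such that sum psi zeta = 1. Scalars are cancelled only over [R] and in O(G),
    torsion-free by flatness; there the tensors are shown to be fixed by the universal point, and
    other points follow by specialization. Exterior powers are not formed: a Pluecker vector is
    recorded by its values on all r-tuples of words, that is, as a tensor. The group moves only the
    column indices of a word, so d ⊗ psi falls apart into one tensor with rN factors [V] and rN dual
    factors for each pair of families of row indices. One further tensor is the vector 1 of [V]: a
    matrix fixing it gives the value 1 to the linear form that represents the function 1, and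
    multiplication by that form raises degrees without changing the equations. *)

Definition is_submod (P : M -> Prop) : Prop :=
  P 0 /\ forall a x y, P x -> P y -> P (a *: x + y).

Definition submod_pred (P : M -> Prop) : {pred M} := [pred x | `[< P x >]].

Lemma submod_pred_closed P : is_submod P -> GRing.submod_closed (submod_pred P).
Proof.
move=> [P0 PD]; split; first exact/asboolP.
by move=> a x y /asboolP Px /asboolP Py; apply/asboolP; exact: PD.
Qed.

(** Submodules are handled as [Prop]-valued predicates, often existential; classical membership
    turns them into the bundled structure where a module type is wanted. *)
Definition mk_submod P (h : is_submod P) : submodClosed M :=
  HB.pack_for (submodClosed M) (submod_pred P)
    (GRing.isSubmodClosed.Build R M (submod_pred P) (submod_pred_closed h)).

Lemma mk_submodP P (h : is_submod P) x : reflect (P x) (x \in mk_submod h).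
Proof. exact: asboolP. Qed.
End Submodules.

Section Span.
Variables (R : comNzRingType) (M : lmodType R).
Implicit Type P : M -> Prop.

Lemma is_submod0 P : is_submod P -> P 0. Proof. by case. Qed.
Lemma is_submodD P x y : is_submod P -> P x -> P y -> P (x + y).
Proof. by move=> [_ h] Px Py; rewrite -[x]scale1r; exact: h. Qed.
Lemma is_submodZ P a x : is_submod P -> P x -> P (a *: x).
Proof. by move=> [P0 h] Px; rewrite -[_ *: _]addr0; exact: h. Qed.
Lemma is_submodB P x y : is_submod P -> P x -> P y -> P (x - y).
Proof.
by move=> h Px Py; rewrite -scaleN1r; apply: is_submodD => //; exact: is_submodZ.
Qed.
Lemma is_submod_sum P (I : finType) (F : I -> M) : is_submod P ->
  (forall i, P (F i)) -> P (\sum_i F i).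
Proof.
move=> h PF; apply: big_ind => //; first exact: is_submod0.
by move=> x y; exact: is_submodD.
Qed.

Definition span_of (I : finType) (m : I -> M) : M -> Prop :=
  fun x => exists c : I -> R, x = \sum_i c i *: m i.

Lemma span_is_submod (I : finType) (m : I -> M) : is_submod (span_of m).
Proof.
split; first by exists (fun=> 0); rewrite big1 // => i _; rewrite scale0r.
move=> a x y [c ->] [d ->]; exists (fun i => a * c i + d i).
rewrite scaler_sumr -big_split; apply: eq_bigr => i _ /=.
by rewrite scalerDl scalerA.
Qed.

Lemma mem_span (I : finType) (m : I -> M) i : span_of m (m i).
Proof.
exists (fun j => (j == i)%:R); rewrite (bigD1 i) //= eqxx scale1r big1 ?addr0 //.
by move=> j /negPf ->; rewrite scale0r.
Qed.

Lemma span_min (I : finType) (m : I -> M) P : is_submod P ->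
  (forall i, P (m i)) -> forall x, span_of m x -> P x.
Proof.
move=> h Pm x [c ->]; apply: is_submod_sum => // i; exact: is_submodZ.
Qed.

Definition fin_gen P := exists (n : nat) (m : 'I_n -> M),
  forall x, P x <-> span_of m x.

Lemma fin_gen_fin (I : finType) (m : I -> M) : fin_gen (span_of m).
Proof.
exists #|I|, (fun k => m (enum_val k)) => x; split=> [[c ->]|[c ->]].
  apply: is_submod_sum; first exact: span_is_submod.
  move=> i; apply: is_submodZ; first exact: span_is_submod.
  by rewrite -[i]enum_rankK; exact: (mem_span (fun k => m (enum_val k))).
apply: is_submod_sum; first exact: span_is_submod.
move=> i; apply: is_submodZ; first exact: span_is_submod.
exact: mem_span.
Qed.
End Span.

Section TensorSums.
Variables (R : comNzRingType).
Implicit Types M N P : lmodType R.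

Lemma tens_suml M N (I : finType) (x : I -> M) (y : N) :
  (\sum_i x i) ⊙ y = \sum_i x i ⊙ y.
Proof.
by apply: (big_morph (fun x => x ⊙ y)); [move=> u v; exact: tensDl|exact: tens0l].
Qed.

Lemma tens_sumr M N (I : finType) (x : M) (y : I -> N) :
  x ⊙ (\sum_i y i) = \sum_i x ⊙ y i.
Proof.
by apply: (big_morph (fun y => x ⊙ y)); [move=> u v; exact: tensDr|exact: tens0r].
Qed.

Lemma tcls_sum M N (s : seq (M * N)) : tcls s = \sum_(p <- s) p.1 ⊙ p.2.
Proof.
elim: s => [|[x y] s IHs]; first by rewrite big_nil.
by rewrite big_cons -IHs [RHS]tcls_cat.
Qed.

Lemma tensor_sumP M N (t : M ⊗ N) : exists (n : nat) (x : 'I_n -> M) (y : 'I_n -> N),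
  t = \sum_i x i ⊙ y i.
Proof.
rewrite -(tcls_repr t) tcls_sum; set s := repr t.
exists (size s), (fun i => (tnth (in_tuple s) i).1), (fun i => (tnth (in_tuple s) i).2).
by rewrite (big_tnth _ _ s).
Qed.

Lemma tlift_sum M N (Z : zmodType) (f : M -> N -> Z) (I : finType)
  (x : I -> M) (y : I -> N) : balanced f ->
  tlift f (\sum_i x i ⊙ y i) = \sum_i f (x i) (y i).
Proof.
move=> fb; rewrite (big_morph _ (tliftD fb) (tlift0 fb)).
by apply: eq_bigr => i _; rewrite tlift_tens.
Qed.

Lemma tmap_sum M N M' N' (f : {linear M -> M'}) (g : {linear N -> N'})
    (I : finType) (x : I -> M) (y : I -> N) :
  tmap f g (\sum_i x i ⊙ y i) = \sum_i f (x i) ⊙ g (y i).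
Proof. exact: (tlift_sum x y (tmap_balanced f g)). Qed.
End TensorSums.

Section EquationalCriterion.
Variables (R : comNzRingType) (A : lmodType R).
Hypothesis A_flat : flat A.

Section Relations.
Variables (M : lmodType R) (n : nat) (m : 'I_n -> M).

Let N := submod (mk_submod (span_is_submod m)).
(** The image of Rel ⊗ A in A^n, where Rel is the module of linear relations between the [m i]. *)
Let rel_vec (d : 'I_n -> A) : Prop :=
  exists (k : nat) (r : 'I_n -> 'I_k -> R) (b : 'I_k -> A),
    (forall i, d i = \sum_j r i j *: b j) /\
    (forall j, \sum_i r i j *: m i = 0).

Let rel_vecD d d' : rel_vec d -> rel_vec d' -> rel_vec (fun i => d i + d' i).
Proof.
move=> [k [r [b [dr rm]]]] [k' [r' [b' [dr' rm']]]].
exists (k + k')%N, (fun i j => match split j with inl j => r i j | inr j => r' i j end),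
  (fun j => match split j with inl j => b j | inr j => b' j end).
split=> [i|j]; last by case: (split j) => j'.
rewrite dr dr' big_split_ord; congr (_ + _); apply: eq_bigr => j _ /=.
  by rewrite (unsplitK (inl j)).
by rewrite (unsplitK (inr j)).
Qed.

Let rel_vec1 (r : 'I_n -> R) a : \sum_i r i *: m i = 0 -> rel_vec (fun i => r i *: a).
Proof.
move=> r0; exists 1%N, (fun i _ => r i), (fun=> a); split=> // i.
by rewrite big_ord1.
Qed.

Let rel_vec_ext d d' : d =1 d' -> rel_vec d -> rel_vec d'.
Proof. by move=> dd [k [r [b [dr rm]]]]; exists k, r, b; split=> // i; rewrite -dd. Qed.

Let rel_vec0 : rel_vec (fun=> 0).
Proof.
have : rel_vec (fun=> 0 *: 0).
  by apply: (@rel_vec1 (fun=> 0)); rewrite big1 // => i _; rewrite scale0r.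
by apply: rel_vec_ext => i; rewrite scale0r.
Qed.

Let secE (y : N) : exists c : 'I_n -> R, val y = \sum_i c i *: m i.
Proof. by have /mk_submodP := valP y. Qed.

Let sec (y : N) : 'I_n -> R := sval (cid (secE y)).

Let secP y : val y = \sum_i sec y i *: m i.
Proof. exact: (svalP (cid (secE y))). Qed.

(** A candidate inverse, on formal sums, of the map from A^n modulo [rel_vec] to N ⊗ A. The section
    [sec] is an arbitrary choice and not linear, so only the class modulo [rel_vec] has a
    meaning. *)
Let coef (s : seq (N * A)) (i : 'I_n) : A := \sum_(p <- s) sec p.1 i *: p.2.

(** Right exactness of the tensor product, by induction on the derivation of the congruence: the
    rules on single symbols change [coef] at most by a defect of linearity of [sec], and such a
    defect is a relation between the [m i]. *)
Lemma rel_vec_tens (s t : seq (N * A)) :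
  tens_rel s t -> rel_vec (fun i => coef s i - coef t i).
Proof.
have rel_sec (r : 'I_n -> R) (a : A) d : \sum_i r i *: m i = 0 ->
    (forall i, d i = r i *: a) -> rel_vec d.
  by move=> r0 dE; apply: rel_vec_ext (rel_vec1 a r0) => i; rewrite dE.
elim=> {s t}.
- by move=> s; apply: rel_vec_ext rel_vec0 => i; rewrite subrr.
- move=> s t _ [k [r [b [dr rm]]]]; exists k, r, (fun j => - b j); split=> // i.
  rewrite -opprB dr -sumrN; apply: eq_bigr => j _; by rewrite scalerN.
- move=> s t u _ h1 _ h2; apply: rel_vec_ext (rel_vecD h1 h2) => i.
  by rewrite addrA subrK.
- move=> s s' t t' _ h1 _ h2; apply: rel_vec_ext (rel_vecD h1 h2) => i.
  by rewrite /coef !big_cat /= opprD addrACA.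
- move=> s t; apply: rel_vec_ext rel_vec0 => i.
  by rewrite /coef !big_cat /= [X in X - _]addrC subrr.
- move=> y; apply: (rel_sec (sec 0) y); first by rewrite -secP.
  by move=> i; rewrite /coef big_seq1 big_nil subr0.
- move=> x x' y; apply: (rel_sec (fun i => sec (x + x') i - (sec x i + sec x' i)) y).
    under eq_bigr do rewrite scalerBl scalerDl.
    by rewrite sumrB big_split /= -!secP raddfD subrr.
  move=> i; rewrite /coef big_seq1 !big_cons big_nil addr0 /=.
  by rewrite scalerBl scalerDl.
- move=> x y y'; apply: rel_vec_ext rel_vec0 => i.
  by rewrite /coef big_seq1 !big_cons big_nil addr0 /= scalerDr subrr.
move=> a x y; apply: (rel_sec (fun i => sec (a *: x) i - a * sec x i) y).
  under eq_bigr do rewrite scalerBl -scalerA.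
  by rewrite sumrB -scaler_sumr -!secP linearZ subrr.
by move=> i; rewrite /coef !big_seq1 /= scalerBl scalerA [a * _]mulrC.
Qed.

(** Flatness makes the sum vanish already in N ⊗ A, with N the submodule generated by the [m i];
    there the vanishing is a derivation to which [rel_vec_tens] applies. *)
Lemma flat_equational (a : 'I_n -> A) : \sum_i m i ⊙ a i = 0 ->
  exists (k : nat) (r : 'I_n -> 'I_k -> R) (b : 'I_k -> A),
    (forall i, a i = \sum_j r i j *: b j) /\
    (forall j, \sum_i r i j *: m i = 0).
Proof.
move=> ma0; pose V := mk_submod (span_is_submod m).
have mV i : m i \in V by apply/mk_submodP; exact: mem_span.
pose y i : N := Sub (m i) (mV i).
have : \sum_i y i ⊙ a i = 0.
  apply: (@A_flat _ _ (submod_val V)); first exact: val_inj.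
  by rewrite linear0 tmap_sum.
have -> : \sum_i y i ⊙ a i = tcls [seq (y i, a i) | i <- index_enum 'I_n].
  by rewrite tcls_sum big_map.
move=> /tclsP /rel_vec_tens h.
(* Both [sec (y j)] and the j-th unit vector are coordinates of [m j], so they differ by a
   relation. *)
have h1 : rel_vec (fun i => a i - coef [seq (y i, a i) | i <- index_enum 'I_n] i).
  have -> : rel_vec = fun d => rel_vec d by [].
  have hj j : rel_vec (fun i => ((i == j)%:R - sec (y j) i) *: a j).
    apply: rel_vec1; under eq_bigr do rewrite scalerBl.
    rewrite sumrB -secP /=; apply/eqP; rewrite subr_eq0; apply/eqP.
    rewrite (bigD1 j) //= eqxx scale1r big1 ?addr0 //.
    by move=> i /negPf ->; rewrite scale0r.
  have : rel_vec (fun i => \sum_j ((i == j)%:R - sec (y j) i) *: a j).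
    elim: (index_enum _) => [|j s IHs].
      by apply: rel_vec_ext rel_vec0 => i; rewrite big_nil.
    by apply: rel_vec_ext (rel_vecD (hj j) IHs) => i; rewrite big_cons.
  apply: rel_vec_ext => i; rewrite /coef big_map /=.
  under eq_bigr do rewrite scalerBl.
  rewrite sumrB; congr (_ - _).
  rewrite (bigD1 i) //= eqxx scale1r big1 ?addr0 // => j ji.
  by rewrite eq_sym (negPf ji) scale0r.
have [k [r [b [ar rm]]]] := rel_vecD h1 h.
exists k, r, b; split=> // i; rewrite -ar.
by rewrite addrA subrK /coef big_nil subr0.
Qed.
End Relations.

(** For a submodule [P], the image of P ⊗ A in M ⊗ A. *)
Definition in_tens (M : lmodType R) (P : M -> Prop) (t : M ⊗ A) : Prop :=
  exists (k : nat) (x : 'I_k -> M) (a : 'I_k -> A),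
    (forall i, P (x i)) /\ t = \sum_i x i ⊙ a i.

(** The criterion for M / P without the quotient module: the witnesses in [P] join the relation with
    opposite sign, and only the rows of [m] are kept afterwards. *)
Lemma flat_equational_mod (M : lmodType R) (P : M -> Prop) (n : nat) (m : 'I_n -> M)
    (a : 'I_n -> A) : is_submod P -> in_tens P (\sum_i m i ⊙ a i) ->
  exists (k : nat) (r : 'I_n -> 'I_k -> R) (b : 'I_k -> A),
    (forall i, a i = \sum_j r i j *: b j) /\
    (forall j, P (\sum_i r i j *: m i)).
Proof.
move=> Psub [l [x [b [Px e]]]].
pose m' j := match split j with inl i => m i | inr i => x i end : M.
pose a' (j : 'I_(n + l)) := match split j with inl i => a i | inr i => - b i end : A.
have /flat_equational [k [r [c [ar rm]]]] : \sum_j m' j ⊙ a' j = 0.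
  rewrite big_split_ord /=.
  under eq_bigr do rewrite /m' /a' (unsplitK (inl _)).
  under [X in _ + X]eq_bigr do rewrite /m' /a' (unsplitK (inr _)).
  rewrite e -big_split big1 // => i _ /=.
  by rewrite -tensDr subrr tens0r.
exists k, (fun i j => r (lshift l i) j), c; split=> [i|j].
  by rewrite -ar /a' (unsplitK (inl i)).
have := rm j; rewrite big_split_ord /= => /(canRL (addrK _)).
under eq_bigr do rewrite /m' (unsplitK (inl _)).
move=> ->; rewrite sub0r -scaleN1r.
apply: is_submodZ => //; apply: is_submod_sum => // i; apply: is_submodZ => //.
by rewrite /m' (unsplitK (inr i)).
Qed.
End EquationalCriterion.

(** * Noetherian rings and Dedekind domains *)

Section Noetherian.
Variable R : comNzRingType.
Hypothesis R_noeth : noetherian R.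

Lemma fin_gen_ext (M : lmodType R) (P Q : M -> Prop) :
  (forall x, P x <-> Q x) -> fin_gen P -> fin_gen Q.
Proof. by move=> PQ [n [m h]]; exists n, m => x; rewrite -PQ. Qed.

Lemma noetherian_ideal (I : R -> Prop) : is_submod (I : R^o -> Prop) ->
  exists (n : nat) (a : 'I_n -> R),
    forall x, I x <-> exists c : 'I_n -> R, x = \sum_i c i * a i.
Proof.
move=> hI; have [n [a h]] := R_noeth (mk_submod hI); exists n, a => x.
by rewrite -h; split=> ?; exact/(mk_submodP hI).
Qed.

(** Induction on the number of generators. The coefficients of the first generator on [P] form an
    ideal; lifts of finitely many generators of it, together with generators of the part of [P] in
    the span of the other [m i], generate [P]. *)
Lemma noetherian_fin_gen (M : lmodType R) (n : nat) (m : 'I_n -> M) (P : M -> Prop) :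
  is_submod P -> (forall x, P x -> span_of m x) -> fin_gen P.
Proof.
elim: n m P => [|n IHn] m P hP Pm.
  exists 0%N, m => x; split=> [/Pm //|[c ->]].
  by rewrite big_ord0; exact: is_submod0.
pose m' i := m (lift ord0 i); pose e := m ord0.
pose I (c : R) := exists2 y, span_of m' y & P (c *: e + y).
have hm' := span_is_submod m'.
have hI : is_submod (I : R^o -> Prop).
  split; first by exists 0; [exact: is_submod0|rewrite scale0r addr0; exact: is_submod0].
  move=> a x y [u um Pu] [v vm Pv]; exists (a *: u + v).
    by apply: is_submodD => //; exact: is_submodZ.
  rewrite scalerDl -scalerA addrACA -scalerDr.
  by apply: is_submodD => //; exact: is_submodZ.
have [k [a aP]] := noetherian_ideal hI.
have Ia i : I (a i).
  by apply/aP; exists (fun j => (j == i)%:R); rewrite (bigD1 i) //= eqxx mul1r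
    big1 ?addr0 // => j /negPf ->; rewrite mul0r.
have /choice [y yP] : forall i, exists z, span_of m' z /\ P (a i *: e + z).
  by move=> i; have [z] := Ia i; exists z.
have [||l [w wP]] := IHn m' (fun x => P x /\ span_of m' x).
- split; first by split; exact: is_submod0.
  move=> b x z [? ?] [? ?]; split; apply: is_submodD => //; exact: is_submodZ.
- by move=> x [].
pose F (s : 'I_k + 'I_l) := match s with inl i => a i *: e + y i | inr j => w j end.
apply: (@fin_gen_ext _ (span_of F)); last exact: fin_gen_fin.
have PF s : P (F s).
  by case: s => i; [exact: (yP i).2|have /wP [] := mem_span w i].
move=> x; split; first exact: span_min.
move=> Px; have [c xE] := Pm _ Px.
have : I (c ord0).
  exists (\sum_i c (lift ord0 i) *: m' i); first by eexists.
  by move: Px; rewrite xE big_ord_recl.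
case/aP=> d cE; have hF := span_is_submod F.
pose x1 := \sum_i d i *: (a i *: e + y i).
have Fx1 : span_of F x1.
  apply: is_submod_sum => // i; apply: is_submodZ => //; exact: (mem_span F (inl i)).
rewrite -[x](subrK x1); apply: is_submodD => //.
have : span_of w (x - x1).
  apply/wP; split.
    by apply: is_submodB => //; apply: (span_min (m := F)) Fx1.
  have -> : x - x1 = \sum_i c (lift ord0 i) *: m' i - \sum_i d i *: y i.
    rewrite xE big_ord_recl cE /x1; under [X in _ - X]eq_bigr do rewrite scalerDr scalerA.
    by rewrite big_split /= -scaler_suml opprD addrACA subrr add0r.
  apply: is_submodB => //; first by eexists.
  by apply: is_submod_sum => // i; apply: is_submodZ => //; have [] := yP i.
by apply: span_min => // j; exact: (mem_span F (inr j)).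
Qed.

(** Otherwise choice builds a strictly increasing chain of ideals; its union is finitely generated,
    hence already reached at a finite stage. *)
Lemma noetherian_maximal (C : (R -> Prop) -> Prop) (I0 : R -> Prop) :
  is_submod (I0 : R^o -> Prop) -> C I0 ->
  exists I, [/\ is_submod (I : R^o -> Prop), C I &
    forall J, is_submod (J : R^o -> Prop) -> C J -> (forall x, I x -> J x) ->
      forall x, J x -> I x].
Proof.
move=> hI0 CI0; apply: contrapT => noM.
pose T := {I : R -> Prop | is_submod (I : R^o -> Prop) /\ C I}.
have nextE (I : T) : exists J : T, (forall x, sval I x -> sval J x) /\
    exists x, sval J x /\ ~ sval I x.
  case: I => I [hI CI] /=; apply: contrapT => noJ; apply: noM.
  exists I; split=> // J hJ CJ IJ x Jx; apply: contrapT => nIx.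
  by apply: noJ; exists (exist _ J (conj hJ CJ)); split=> //; exists x.
have [next nextP] := choice nextE.
pose it k := iter k next (exist _ I0 (conj hI0 CI0) : T).
have it_mono k l x : sval (it k) x -> sval (it (l + k)%N) x.
  by elim: l => // l IHl /IHl; have [+ _] := nextP (it (l + k)%N); apply.
pose U x := exists k, sval (it k) x.
have hU : is_submod (U : R^o -> Prop).
  split; first by exists 0%N; exact: is_submod0 hI0.
  move=> a x y [k xk] [l yl]; exists (l + k)%N.
  have [[_ h] _] := svalP (it (l + k)%N); apply: h; first exact: it_mono.
  by rewrite addnC; exact: it_mono.
have [n [a aP]] := noetherian_ideal hU.
have Ua i : U (a i).
  by apply/aP; exists (fun j => (j == i)%:R); rewrite (bigD1 i) //= eqxx mul1r
    big1 ?addr0 // => j /negPf ->; rewrite mul0r.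
have [k kP] := choice Ua.
(* The sum bounds every [k i], so this stage contains all the generators. *)
pose K := (\sum_i k i)%N.
have [_ [x [xK nxK]]] := nextP (it K); apply: nxK.
have /aP [c ->] : U x by exists K.+1.
have [hK _] := svalP (it K).
apply: (is_submod_sum (M := R^o) hK) => i.
apply: (is_submodZ (M := R^o) _ hK).
by rewrite /K (bigD1 i) //= addnC; exact: it_mono.
Qed.
End Noetherian.

(** * Invertible ideals in Dedekind domains *)

Section Dedekind.
Variable R : idomainType.
Local Notation F := (@tofrac R).
Implicit Types I J : R -> Prop.

(** The determinant trick: [q] is an eigenvalue of [M] over the field, hence a root of a monic
    characteristic polynomial over [R]. The transpose appears because eigenvectors are rows. *)
Lemma eigenvector_integral (K : fieldType) (f : {rmorphism R -> K}) (n : nat)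
    (y : 'I_n -> K) (M : 'I_n -> 'I_n -> R) (q : K) :
  (forall i, q * y i = \sum_j f (M i j) * y j) -> (exists i, y i != 0) ->
  integralOver f q.
Proof.
move=> qy [i0 yi0]; exists (char_poly (\matrix_(i, j) M j i)).
  exact: char_poly_monic.
rewrite map_char_poly -eigenvalue_root_char; apply/eigenvalueP.
exists (\row_i y i).
  apply/rowP => j; rewrite !mxE qy; apply: eq_bigr => i _.
  by rewrite !mxE mulrC.
by apply/eqP => /rowP /(_ i0); rewrite !mxE => /eqP; apply/negP.
Qed.

Lemma ideal_prime_idealr (P : R -> Prop) : is_submod (P : R^o -> Prop) -> ~ P 1 ->
  (forall x y, P (x * y) -> P x \/ P y) ->
  exists Q : prime_idealr R, forall x, x \in Q <-> P x.
Proof.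
move=> hP nP1 Pp; pose S : {pred R} := [pred x | `[< P x >]].
have hS : idealr_closed S.
  split; first by apply/asboolP; exact: (is_submod0 hP).
    by apply/asboolP.
  by move=> a x y /asboolP Px /asboolP Py; apply/asboolP; exact: hP.2.
have pS : prime_idealr_closed S.
  by move=> x y /asboolP /Pp [] h; apply/orP; [left|right]; apply/asboolP.
pose Q := HB.pack_for (prime_idealr R) S (isIdealr.Build R S hS)
  (isPrimeIdealrClosed.Build R S pS).
by exists Q => x; split=> [/asboolP|h]; last exact/asboolP.
Qed.

Hypothesis R_ded : dedekind R.
Let R_noeth : noetherian R. Proof. by case: R_ded. Qed.

(* The associated prime argument: among the ideals (a : b) contained in P a
   maximal one is prime, hence equal to P, and b / a is the required element. *)
Lemma colon_prime (P : R -> Prop) (a : R) : is_submod (P : R^o -> Prop) -> ~ P 1 ->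
  (forall x y, P (x * y) -> P x \/ P y) -> P a -> a != 0 ->
  exists b, (forall x, P x -> exists y, x * b = y * a) /\ ~ exists y, b = y * a.
Proof.
move=> hP nP1 Pp Pa a0.
pose colon b x := exists y, x * b = y * a.
have hcolon b : is_submod (colon b : R^o -> Prop).
  split; first by exists 0; rewrite !mul0r.
  move=> c x y [u xu] [v yv]; exists (c * u + v).
  by rewrite !mulrDl -!mulrA xu yv !mulrA.
have Pl c x : P x -> P (c * x) by exact: (is_submodZ (M := R^o) c hP).
pose C J := exists b, (forall x, J x <-> colon b x) /\ forall x, J x -> P x.
have [|Q [hQ [b [Qb QP]] Qmax]] := noetherian_maximal R_noeth (C := C) (hcolon 1).
  by exists 1; split=> // x [y]; rewrite mulr1 => ->; exact: Pl.
have nQ1 : ~ Q 1 by move/QP.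
(* Passing from b to b s enlarges (a : b) but keeps it inside [P] when s is outside [P], so by
   maximality nothing is gained. *)
have Qsat s y : ~ P s -> Q (s * y) -> Q y.
  move=> nPs /Qb [u syu]; apply: (Qmax (colon (b * s))).
  - exact: hcolon.
  - exists (b * s); split=> // x [v xv].
    have /QP/Pp [] // : Q (x * s) by apply/Qb; exists v; rewrite -xv mulrAC mulrA.
  - move=> x /Qb [v xv]; exists (s * v).
    by rewrite mulrA xv mulrC mulrA.
  by exists u; rewrite -syu; ring.
have Qp x y : Q (x * y) -> Q x \/ Q y.
  move=> /Qb [u xyu]; case: (pselect (Q y)) => [|nQy]; [by right|left].
  case: (pselect (forall z, colon (b * y) z -> P z)) => [colP|].
    apply: (Qmax (colon (b * y))) => //; first by exists (b * y).
      move=> z /Qb [v zv]; exists (y * v).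
      by rewrite mulrA zv mulrC mulrA.
    by exists u; rewrite -xyu mulrA mulrAC.
  (* Some s outside [P] has s b y in (a), so s y lies in [Q]. *)
  move=> /existsNP [s /not_implyP [[v sv] nPs]].
  case: nQy; apply: Qsat nPs _; apply/Qb; exists v.
  by rewrite -sv mulrA mulrAC.
have [Q' Q'E] := ideal_prime_idealr hQ nQ1 Qp.
have [P' P'E] := ideal_prime_idealr hP nP1 Pp.
exists b; split=> [x Px|[y bya]]; last first.
  by apply: nQ1; apply/Qb; exists y; rewrite mul1r.
have [_ _ Rdim] := R_ded; have sub : {subset P' <= Q'}.
  apply: Rdim; first by exists a => //; apply/Q'E/Qb; exists b; rewrite mulrC.
  by move=> z /Q'E /QP Pz; exact/P'E.
by apply/Qb/Q'E/sub/P'E.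
Qed.

(* If J = I I^-1 were proper, it would lie in a maximal ideal P, and an element
   q of the fraction field outside R with q P in R would satisfy q I^-1 <= I^-1,
   hence be integral over R. *)
Lemma dedekind_invertible (I : R -> Prop) : is_submod (I : R^o -> Prop) ->
  (exists2 a, I a & a != 0) ->
  exists (n : nat) (a : 'I_n -> R) (b : 'I_n -> {fraction R}),
    [/\ forall i, I (a i), forall i x, I x -> exists y, F y = b i * F x &
        \sum_i b i * F (a i) = 1].
Proof.
move=> hI [a0 Ia0 a0_neq0].
pose inv q := forall x, I x -> exists y, F y = q * F x.
pose J r := exists (n : nat) (a : 'I_n -> R) (b : 'I_n -> {fraction R}),
  [/\ forall i, I (a i), forall i, inv (b i) & F r = \sum_i b i * F (a i)].
case: (pselect (J 1)) => [[n [a [b [Ia ib ab]]]]|nJ1].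
  by exists n, a, b; split=> //; rewrite -ab tofrac1.
exfalso.
have J1 q r x : inv q -> I x -> F r = q * F x -> J r.
  by move=> iq Ix rE; exists 1%N, (fun=> x), (fun=> q); split=> //; rewrite big_ord1.
have inv1 : inv 1 by move=> x Ix; exists x; rewrite mul1r.
have hJ : is_submod (J : R^o -> Prop).
  split; first by apply: (J1 0 0 a0); [move=> x _; exists 0|exact: Ia0|];
    rewrite tofrac0 mul0r.
  move=> c x y [k [u [p [Iu ip xup]]]] [l [v [q [Iv iq yvq]]]].
  exists (k + l)%N, (fun i => match split i with inl i => c * u i | inr i => v i end),
    (fun i => match split i with inl i => p i | inr i => q i end); split.
  - by move=> i; case: (split i) => // j; exact: (is_submodZ (M := R^o) c hI).
  - by move=> i; case: (split i) => // j.
  rewrite tofracD tofracM xup yvq big_split_ord mulr_sumr; congr (_ + _).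
    apply: eq_bigr => i _ /=; rewrite (unsplitK (inl i)) tofracM.
    by rewrite mulrCA.
  by apply: eq_bigr => i _ /=; rewrite (unsplitK (inr i)).
pose C (P : R -> Prop) := ~ P 1 /\ forall x, J x -> P x.
have [//|P [hP [nP1 JP] Pmax]] := noetherian_maximal R_noeth (C := C) hJ.
have Pp x y : P (x * y) -> P x \/ P y.
  move=> Pxy; case: (pselect (P x)) => [|nPx]; [by left|right].
  (* The ideal P + (x): if it contains 1 then y lies in [P], and if it is proper then maximality
     puts x into [P]. *)
  pose Q z := exists c, P (z - c * x).
  have PQ z : P z -> Q z by exists 0; rewrite mul0r subr0.
  have hQ : is_submod (Q : R^o -> Prop).
    split; first exact/PQ/(is_submod0 hP).
    move=> c z w [u zu] [v wv]; exists (c * u + v).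
    rewrite mulrDl opprD addrACA -mulrA -mulrBr.
    by exact: hP.2.
  case: (pselect (Q 1)) => [[c Pc]|nQ1].
    have -> : y = y * (1 - c * x) + c * (x * y).
      by ring.
    apply: (is_submodD (M := R^o) hP); exact: (is_submodZ (M := R^o) _ hP).
  case: nPx; apply: (Pmax Q) => //.
    by split=> // z /JP /PQ.
  by exists 1; rewrite mul1r subrr; exact: (is_submod0 hP).
have Pa0 : P a0 by apply: JP; apply: (J1 1 a0 a0) => //; rewrite mul1r.
have [b [bP nb]] := colon_prime hP nP1 Pp Pa0 a0_neq0.
have Fa0 : F a0 != 0 by rewrite tofrac_eq0.
pose q := F b / F a0.
have qP x : P x -> exists y, F y = q * F x.
  move=> /bP [y xb]; exists y; apply: (mulIf Fa0).
  by rewrite -tofracM -xb tofracM /q; rewrite mulrAC divfK // mulrC.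
have q_inv c : inv c -> inv (q * c).
  move=> ic x Ix; have [z zE] := ic x Ix.
  by rewrite -mulrA -zE; apply: qP; apply: JP; exact: (J1 c z x).
(* Multiplication by [a0] turns I^-1 into an ideal of [R], hence finitely generated; its generators
   span a module stable under [q]. *)
pose I' y := exists2 c, inv c & F y = c * F a0.
have hI' : is_submod (I' : R^o -> Prop).
  split; first by exists 0; [move=> x _; exists 0|]; rewrite tofrac0 mul0r.
  move=> c x y [u iu xu] [v iv yv]; exists (F c * u + v).
    move=> z Iz; have [s sE] := iu z Iz; have [t tE] := iv z Iz.
    by exists (c * s + t); rewrite tofracD tofracM sE tE mulrDl mulrA.
  by rewrite tofracD tofracM xu yv mulrDl mulrA.
have [n [y yP]] := noetherian_ideal R_noeth hI'.
have I'y i : I' (y i).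
  by apply/yP; exists (fun j => (j == i)%:R); rewrite (bigD1 i) //= eqxx mul1r
    big1 ?addr0 // => j /negPf ->; rewrite mul0r.
have : forall i, exists M : 'I_n -> R, q * F (y i) = \sum_j F (M j) * F (y j).
  move=> i; have [c ic yc] := I'y i; have iqc := q_inv _ ic.
  have [z zE] := iqc a0 Ia0.
  have /yP [M zM] : I' z by exists (q * c).
  exists M; rewrite yc mulrA -zE zM rmorph_sum /=; apply: eq_bigr => j _.
  by rewrite tofracM.
case/choice => M qM.
have q_int : integralOver F q.
  (* As 1 belongs to I^-1, [a0] is a combination of the [y i], so they cannot all vanish. *)
  apply: (eigenvector_integral qM); apply: contrapT => y0.
  have /yP [c ca] : I' a0 by exists 1 => //; rewrite mul1r.
  case/eqP: a0_neq0; rewrite ca big1 // => i _.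
  suff -> : y i = 0 by rewrite mulr0.
  apply/eqP; rewrite -tofrac_eq0; apply: contrapT => /negP yi.
  by apply: y0; exists i.
have [_ /(_ q q_int) [r qr] _] := R_ded.
apply: nb; exists r; apply/eqP; rewrite -tofrac_eq tofracM -qr.
by rewrite /q divfK.
Qed.
End Dedekind.

(** * Modules with a finite dual basis *)

Section MkLinear.
Variables (R : comNzRingType) (M N : lmodType R) (f : M -> N).
Hypothesis hf : forall a x y, f (a *: x + y) = a *: f x + f y.
Definition mk_linear : {linear M -> N} :=
  HB.pack_for {linear M -> N} f (GRing.isLinear.Build R M N *:%R f hf).
End MkLinear.

Section DualSystems.
Variable R : comNzRingType.

Definition dual_sys (V : lmodType R) (n : nat) (v : 'I_n -> V)
    (phi : 'I_n -> {linear V -> R^o}) : Prop :=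
  forall x, x = \sum_i (phi i x : R) *: v i.

Definition dual_basis (V : lmodType R) (n : nat) (v : 'I_n -> V)
    (phi : 'I_n -> {linear V -> R^o}) : Prop :=
  forall i j, phi i (v j) = (i == j)%:R.

(* For b := False this says that V is finitely generated projective, for
   b := True that it is free of finite rank. *)
Definition has_dual_sys (b : Prop) (V : lmodType R) : Prop :=
  exists (n : nat) (v : 'I_n -> V) (phi : 'I_n -> {linear V -> R^o}),
    dual_sys v phi /\ (b -> dual_basis v phi).

(** The coordinate functions are defined on all of [R], though only their values on the ideal
    matter; this avoids a module type for [I]. *)
Definition ideal_dual_sys (b : Prop) (I : R -> Prop) : Prop :=
  exists (n : nat) (a : 'I_n -> R) (psi : 'I_n -> R -> R),
    [/\ forall i, I (a i),
        forall i c x y, I x -> I y -> psi i (c * x + y) = c * psi i x + psi i y,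
        forall x, I x -> x = \sum_i psi i x * a i &
        b -> forall i j, psi i (a j) = (i == j)%:R].

(** The coordinates [p i] exhibit M ⊗ V, naturally in M, as a retract of M^n, where injectivity is
    tested componentwise. *)
Lemma dual_sys_flat b (V : lmodType R) : has_dual_sys b V -> flat V.
Proof.
move=> [n [v [phi [vphi _]]]] N N' f finj.
pose p (M : lmodType R) i (t : M ⊗ V) : M := tlift (fun x y => (phi i y : R) *: x) t.
have pb (M : lmodType R) i : balanced (fun (x : M) y => (phi i y : R) *: x).
  split=> [x x' y|x y y'|a x y]; first by rewrite scalerDr.
    by rewrite linearD scalerDl.
  by rewrite [phi i (_ *: _)]linearZ scalerA mulrC.
have pD (M : lmodType R) i := tliftD (pb M i).
have tE (M : lmodType R) (t : M ⊗ V) : t = \sum_i p M i t ⊙ v i.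
  elim/tensor_ind: t => [|x y|t u IHt IHu].
  - by rewrite big1 // => i _; rewrite /p (tlift0 (pb M i)) tens0l.
  - rewrite {1}[y]vphi tens_sumr; apply: eq_bigr => i _.
    by rewrite /p (tlift_tens (pb M i)) tensZ.
  rewrite {1}IHt {1}IHu -big_split; apply: eq_bigr => i _ /=.
  by rewrite /p pD tensDl.
have pf i t : p N' i (tmap f idfun t) = f (p N i t).
  elim/tensor_ind: t => [|x y|t u IHt IHu].
  - by rewrite linear0 /p (tlift0 (pb N i)) (tlift0 (pb N' i)) linear0.
  - by rewrite tmap_tens /p !tlift_tens ?linearZ //; exact: pb.
  by rewrite linearD /p !pD linearD; congr (_ + _).
move=> t u tu; rewrite [t]tE [u]tE; apply: eq_bigr => i _; congr (_ ⊙ _).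
by apply: finj; rewrite -!pf; congr (p _ _ _).
Qed.

(** The matrix [E] is an idempotent on row vectors with image isomorphic to [V], so the kernel of
    the projection to [V] is the row space of 1 - E. *)
Lemma dual_sys_fin_presented b (V : lmodType R) : has_dual_sys b V -> fin_presented V.
Proof.
move=> [n [v [phi [vphi _]]]].
have hf a (x y : 'rV[R]_n) : \sum_i (a *: x + y) 0 i *: v i =
    a *: (\sum_i x 0 i *: v i) + \sum_i y 0 i *: v i.
  rewrite scaler_sumr -big_split; apply: eq_bigr => i _ /=.
  by rewrite !mxE scalerDl scalerA.
pose E := \matrix_(i, j) (phi j (v i) : R).
have phiE j (u : 'rV[R]_n) : phi j (mk_linear hf u) = (u *m E) 0 j.
  rewrite linear_sum !mxE; apply: eq_bigr => i _.
  by rewrite !mxE linearZ.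
exists n, n, (mk_linear hf), (1%:M - E); split=> [x|u].
  exists (\row_i (phi i x : R)); rewrite [RHS]vphi.
  by apply: eq_bigr => i _; rewrite mxE.
split=> [fu|[w ->]].
  exists u; rewrite mulmxBr mulmx1.
  suff -> : u *m E = 0 by rewrite subr0.
  by apply/rowP => j; rewrite -phiE fu linear0 mxE.
rewrite mulmxBr mulmx1 linearB /= [X in X - _](vphi (mk_linear hf w)).
by apply/eqP; rewrite subr_eq0; apply/eqP; apply: eq_bigr => i _; rewrite phiE.
Qed.

Section Embedded.
Variable b : Prop.
Hypothesis ideals : forall I, is_submod (I : R^o -> Prop) -> ideal_dual_sys b I.

(** Induction on m: the first coordinate maps [V] onto an ideal, whose dual system splits [V] into
    this ideal and the kernel, and the kernel embeds in one dimension less. *)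
Lemma embedded_dual_sys (m : nat) (V : lmodType R) (h : {linear V -> 'rV[R]_m}) :
  injective h -> has_dual_sys b V.
Proof.
elim: m V h => [|m IHm] V h hinj.
  exists 0%N, (fun i => 0), (fun i => \0 : {linear V -> R^o}); split=> [x|_ []//].
  by rewrite big_ord0; apply: hinj; apply/rowP => - [].
pose pi x : R^o := h x 0 ord0.
have pi_lin a x y : pi (a *: x + y) = a *: pi x + pi y.
  by rewrite /pi linearD linearZ !mxE.
have pi0 : pi 0 = 0 by rewrite /pi linear0 mxE.
have hV1 : is_submod (fun x => pi x = 0).
  by split=> // a x y px py; rewrite pi_lin px py scaler0 addr0.
pose V1 := mk_submod hV1.
have h1_lin a (x y : submod V1) :
    \row_i h (val (a *: x + y)) 0 (lift ord0 i) =
    a *: \row_i h (val x) 0 (lift ord0 i) + \row_i h (val y) 0 (lift ord0 i).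
  by apply/rowP => i; rewrite !mxE [val _](linearP (submod_val V1)) linearP !mxE.
have [|k [w [theta [wtheta wfree]]]] := IHm _ (mk_linear h1_lin).
  move=> x y /rowP xy; apply/val_inj/hinj/rowP => i.
  case: (unliftP ord0 i) => [j|] ->; first by have := xy j; rewrite !mxE.
  by have /mk_submodP := valP x; have /mk_submodP := valP y; rewrite /pi => -> ->.
pose I (c : R) := exists x, pi x = c.
have hI : is_submod (I : R^o -> Prop).
  split; first by exists 0.
  by move=> c x y [u <-] [v <-]; exists (c *: u + v).
have [n [a [psi [Ia psi_lin psiE psi_free]]]] := ideals hI.
have [p pa] := choice Ia.
have Ipi x : I (pi x) by exists x.
(* The first coordinate followed by a section of it, so that x - sg x lies in the kernel. *)
pose sg x := \sum_i psi i (pi x) *: p i.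
have sg_lin c x y : sg (c *: x + y) = c *: sg x + sg y.
  rewrite /sg scaler_sumr -big_split; apply: eq_bigr => i _ /=.
  by rewrite pi_lin psi_lin // scalerDl scalerA.
have pi_sum (l : nat) (c : 'I_l -> R) (x : 'I_l -> V) :
    pi (\sum_i c i *: x i) = \sum_i c i * pi (x i).
  apply: (big_ind2 (fun x (y : R) => pi x = y)) => //.
    by move=> x1 x2 y1 y2 <- <-; rewrite -{1}[x1]scale1r pi_lin scale1r.
  by move=> i _; rewrite -[_ *: _]addr0 pi_lin pi0 addr0.
have qP x : x - sg x \in V1.
  apply/mk_submodP; rewrite addrC -scaleN1r pi_lin scaleN1r.
  rewrite /sg pi_sum; under eq_bigr do rewrite pa.
  by rewrite -psiE // addNr.
pose q x : submod V1 := Sub (x - sg x) (qP x).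
have q_lin c x y : q (c *: x + y) = c *: q x + q y.
  apply: val_inj; rewrite linearP /= sg_lin scalerBr opprD.
  by rewrite addrACA.
have psi_lin' i c x y : (psi i (pi (c *: x + y)) : R^o) =
    c *: (psi i (pi x) : R^o) + psi i (pi y).
  by rewrite pi_lin psi_lin.
pose ph (i : 'I_(n + k)) : {linear V -> R^o} := match split i with
  | inl i => mk_linear (psi_lin' i)
  | inr j => theta j \o mk_linear q_lin
  end.
exists (n + k)%N, (fun i => match split i with inl i => p i | inr j => val (w j) end), ph.
have phl i : ph (lshift k i) = mk_linear (psi_lin' i).
  by rewrite /ph (unsplitK (inl i)).
have phr i : ph (rshift n i) = theta i \o mk_linear q_lin.
  by rewrite /ph (unsplitK (inr i)).
have psi0 i : psi i 0 = 0.
  have I0 : I 0 by exists 0.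
  by have := psi_lin i (-1) 0 0 I0 I0; rewrite mulr0 addr0 mulN1r addNr.
split=> [x|fr i j].
  rewrite big_split_ord /=.
  under eq_bigr do rewrite phl (unsplitK (inl _)) /=.
  under [X in _ + X]eq_bigr do rewrite phr (unsplitK (inr _)) /=.
  rewrite -/(sg x) -[LHS](subrK (sg x)) addrC; congr (_ + _).
  have /(congr1 (submod_val V1)) := wtheta (q x).
  rewrite linear_sum /= => ->; apply: eq_bigr => i _.
  by [].
case: (split_ordP j) => {}j ->; last first.
  have qw : q (val (w j)) = w j.
    have /mk_submodP pw := valP (w j).
    by apply: val_inj; rewrite /= /sg pw big1 ?subr0 // => l _; rewrite psi0 scale0r.
  case: (split_ordP i) => {}i ->; rewrite ?phl ?phr /=.
    have /mk_submodP pw := valP (w j).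
    by rewrite pw psi0 eq_lrshift.
  by rewrite qw wfree // eq_rshift.
have sgp : sg (p j) = p j.
  rewrite /sg pa (bigD1 j) //= psi_free // eqxx scale1r big1 ?addr0 // => l lj.
  by rewrite psi_free // (negPf lj) scale0r.
case: (split_ordP i) => {}i ->; rewrite ?phl ?phr /=.
  by rewrite pa psi_free // eq_lshift.
have -> : q (p j) = 0 by apply: val_inj; rewrite /= sgp subrr.
by rewrite linear0 eq_rlshift.
Qed.
End Embedded.
End DualSystems.

(** * Torsion-free modules over a domain *)

Section TorsionFree.
Variable R : idomainType.

Definition torsion_free (V : lmodType R) : Prop :=
  forall (a : R) (x : V), a *: x = 0 -> a = 0 \/ x = 0.

(** Take a maximal independent set of generators. A fixed nonzero [D] carries every element into its
    span, and the coordinates of D x determine x because [V] has no torsion. *)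
Lemma torsion_free_embed (V : lmodType R) (n : nat) (g : 'I_n -> V) :
  torsion_free V -> (forall x, span_of g x) ->
  exists h : {linear V -> 'rV[R]_n}, injective h.
Proof.
move=> Vtf gen.
pose indep (S : {set 'I_n}) := forall c : 'I_n -> R,
  (forall i, i \notin S -> c i = 0) -> \sum_i c i *: g i = 0 -> forall i, c i = 0.
have ind0 : `[< indep set0 >] by apply/asboolP => c c0 _ i; apply: c0; rewrite inE.
have [S /maxsetP [/asboolP indS maxS] _] := maxset_exists (P := fun S => `[< indep S >]) ind0.
pose inS (x : V) := exists2 c : 'I_n -> R, (forall i, i \notin S -> c i = 0) &
  x = \sum_i c i *: g i.
have hinS : is_submod inS.
  split; first by exists (fun=> 0) => //; rewrite big1 // => i _; rewrite scale0r.
  move=> a x y [c c0 ->] [d d0 ->]; exists (fun i => a * c i + d i).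
    by move=> i iS; rewrite c0 // d0 // mulr0 addr0.
  rewrite scaler_sumr -big_split; apply: eq_bigr => i _ /=.
  by rewrite scalerDl scalerA.
have dep k : exists d, d != 0 /\ inS (d *: g k).
  case: (boolP (k \in S)) => kS.
    exists 1; rewrite oner_eq0; split=> //; exists (fun i => (i == k)%:R).
      by move=> i; case: eqP => // -> /negP.
    rewrite (bigD1 k) //= eqxx scale1r big1 ?addr0 // => i /negPf ->.
    by rewrite scale0r.
  have ndep : ~ indep (k |: S).
    move=> ind; have /setP /(_ k) := maxS _ (asboolT ind) (subsetUr _ _).
    by rewrite !inE eqxx (negPf kS).
  apply: contrapT => nd; apply: ndep => c c0 cg.
  have ck : c k = 0.
    apply: contrapT => /eqP ck; apply: nd; exists (c k); split=> //.
    exists (fun i => if i == k then 0 else - c i).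
      move=> i iS; case: eqP => // /eqP ik; rewrite c0 ?oppr0 //.
      by rewrite !inE negb_or ik.
    move: cg; rewrite (bigD1 k) //= => /(canRL (addrK _)) ->.
    rewrite [RHS](bigD1 k) //= eqxx scale0r !add0r -sumrN.
    by apply: eq_bigr => i /negPf ->; rewrite scaleNr.
  apply: indS => // i iS; case: (eqVneq i k) => [-> //|ik].
  by apply: c0; rewrite !inE negb_or ik.
have [d dP] := choice dep.
pose D := \prod_i d i.
have D0 : D != 0 by apply/prodf_neq0 => i _; case: (dP i).
have DinS x : inS (D *: x).
  have [c ->] := gen x; rewrite scaler_sumr.
  apply: is_submod_sum => // i; rewrite scalerA mulrC -scalerA.
  apply: is_submodZ => //; rewrite /D (bigD1 i) //= mulrC -scalerA.
  by apply: is_submodZ => //; case: (dP i).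
have /choice [h hP] : forall x, exists c : 'I_n -> R,
    (forall i, i \notin S -> c i = 0) /\ D *: x = \sum_i c i *: g i.
  by move=> x; have [c] := DinS x; exists c.
have uniq x (c : 'I_n -> R) : (forall i, i \notin S -> c i = 0) ->
    D *: x = \sum_i c i *: g i -> forall i, h x i = c i.
  move=> cS xc i; apply/eqP; rewrite -subr_eq0; apply/eqP.
  apply: (indS (fun i => h x i - c i)) => [j jS|].
    by have [-> //] := hP x; rewrite cS // subrr.
  under eq_bigr do rewrite scalerBl.
  by rewrite sumrB -xc; have [_ <-] := hP x; rewrite subrr.
have h_lin a x y : \row_i h (a *: x + y) i = a *: \row_i h x i + \row_i h y i.
  apply/rowP => i; rewrite !mxE; apply: (uniq _ (fun i => a * h x i + h y i)) => [j jS|].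
    by have [-> //] := hP x; have [-> //] := hP y; rewrite mulr0 addr0.
  under eq_bigr do rewrite scalerDl -scalerA.
  rewrite big_split /= -scaler_sumr; have [_ <-] := hP x; have [_ <-] := hP y.
  by rewrite scalerDr !scalerA mulrC.
exists (mk_linear h_lin) => x y /rowP xy.
apply/eqP; rewrite -subr_eq0; apply/eqP.
have [] // := Vtf D (x - y); last by move/eqP; rewrite (negPf D0).
rewrite scalerBr; have [_ ->] := hP x; have [_ ->] := hP y.
apply/eqP; rewrite subr_eq0; apply/eqP/eq_bigr => i _.
by have := xy i; rewrite !mxE => ->.
Qed.

Lemma principal_dual_sys (I : R -> Prop) : principal R -> is_submod (I : R^o -> Prop) ->
  ideal_dual_sys True I.
Proof.
move=> prR hI; have [a aP] := prR (mk_submod hI).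
have {}aP x : I x <-> exists c, x = c * a.
  by rewrite -aP; split=> ?; exact/(mk_submodP hI).
have [a0|a0] := eqVneq a 0.
  exists 0%N, (fun=> 0), (fun _ _ => 0); split=> [[]//|[]//|x|_ []//].
  by move=> /aP [c ->]; rewrite big_ord0 a0 mulr0.
have /choice [psi psiE] : forall x, exists c, I x -> x = c * a.
  move=> x; case: (pselect (I x)) => [/aP [c xc]|nIx]; first by exists c.
  by exists 0.
have Ia : I a by apply/aP; exists 1; rewrite mul1r.
exists 1%N, (fun=> a), (fun=> psi); split=> // [_ c x y Ix Iy|x /psiE xE|_ i j].
- apply: (mulIf a0); rewrite -psiE; last exact: hI.2.
  by rewrite mulrDl -mulrA -!psiE.
- by rewrite big_ord1.
by rewrite !ord1 eqxx; apply: (mulIf a0); rewrite mul1r -psiE.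
Qed.

(** As sum b_i a_i = 1 with b_i I inside [R], multiplication by the [b i] gives coordinate
    functions. *)
Lemma dedekind_dual_sys (I : R -> Prop) : dedekind R -> is_submod (I : R^o -> Prop) ->
  ideal_dual_sys False I.
Proof.
move=> R_ded hI; case: (pselect (exists2 a, I a & a != 0)) => [Ia|nI]; last first.
  exists 0%N, (fun=> 0), (fun _ _ => 0); split=> [[]//|[]//|x Ix|//].
  rewrite big_ord0; apply: contrapT => /eqP x0; apply: nI; by exists x.
have [n [a [b [{}Ia ib ab]]]] := dedekind_invertible R_ded hI Ia.
have /choice [psi psiE] : forall i, exists p : R -> R,
    forall x, I x -> tofrac (p x) = b i * tofrac x.
  move=> i; suff /choice [p pE] : forall x, exists y, I x -> tofrac y = b i * tofrac x.
    by exists p.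
  move=> x.
  case: (pselect (I x)) => [Ix|nIx]; last by exists 0.
  by have [y] := ib i x Ix; exists y.
exists n, a, psi; split=> // [i c x y Ix Iy|x Ix].
  apply/eqP; rewrite -tofrac_eq psiE; last exact: hI.2.
  by rewrite !tofracD !tofracM !psiE // mulrDr mulrCA.
apply/eqP; rewrite -tofrac_eq rmorph_sum /=; apply/eqP.
rewrite -[LHS]mul1r -ab mulr_suml; apply: eq_bigr => i _.
by rewrite tofracM psiE // -!mulrA [tofrac x * _]mulrC.
Qed.

Lemma fin_gen_dual_sys b (V : lmodType R) :
  (forall I, is_submod (I : R^o -> Prop) -> ideal_dual_sys b I) ->
  torsion_free V -> fin_gen (fun _ : V => True) -> has_dual_sys b V.
Proof.
move=> ideals Vtf [n [g gP]].
have [|h hinj] := torsion_free_embed (g := g) Vtf; first by move=> x; exact/gP.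
exact: embedded_dual_sys hinj.
Qed.

(** Multiplication by a nonzero scalar is injective on [R], and stays injective after tensoring with
    [A]. *)
Lemma flat_torsion_free (A : lmodType R) : flat A -> torsion_free A.
Proof.
move=> Aflat a x ax0; case: (eqVneq a 0) => [|a0]; [by left|right].
have m_lin c (u v : R^o) : a *: (c *: u + v) = c *: (a *: u) + a *: v :> R^o.
  by rewrite scalerDr !scalerA mulrC.
have m_inj : injective (mk_linear m_lin) by exact: mulfI.
have : (1 : R^o) ⊙ x = 0 :> R^o ⊗ A.
  apply: (Aflat _ _ _ m_inj); rewrite linear0 tmap_tens /=.
  by rewrite tensZ ax0 tens0r.
have b : balanced (fun (c : R^o) (y : A) => (c : R) *: y).
  by split=> [u u' y|u y y'|k u y]; rewrite ?scalerDl ?scalerDr // scalerA mulrC.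
move=> /(congr1 (tlift (fun (c : R^o) (y : A) => (c : R) *: y))).
by rewrite (tlift0 b) (tlift_tens b) scale1r.
Qed.
End TorsionFree.

(** * Stable submodules of the regular representation *)

Section Unassoc.
Variables (R : comNzRingType) (M N P : lmodType R).

Definition tunassoc : M ⊗ (N ⊗ P) -> (M ⊗ N) ⊗ P :=
  tlift (fun (x : M) (t : N ⊗ P) => tlift (fun y z => (x ⊙ y) ⊙ z) t).

Let bal1 (x : M) : balanced (fun (y : N) (z : P) => (x ⊙ y) ⊙ z).
Proof.
split=> [y y' z|y z z'|a y z]; rewrite ?tensDr ?tensDl //.
by rewrite -scale_tensr tensZ.
Qed.

Let bal : balanced (fun (x : M) (t : N ⊗ P) => tlift (fun y z => (x ⊙ y) ⊙ z) t).
Proof.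
split=> [x x' t|x t t'|a x t]; last 2 first.
- exact: tliftD (bal1 x) _ _.
- elim/tensor_ind: t => [|y z|t u IHt IHu].
  + by rewrite scaler0 !(tlift0 (bal1 _)).
  + by rewrite scale_tens !(tlift_tens (bal1 _)) tensZ.
  by rewrite scalerDr !(tliftD (bal1 _)) IHt IHu.
elim/tensor_ind: t => [|y z|t u IHt IHu].
- by rewrite !(tlift0 (bal1 _)) addr0.
- by rewrite !(tlift_tens (bal1 _)) !tensDl.
by rewrite !(tliftD (bal1 _)) IHt IHu addrACA.
Qed.

Lemma tunassoc_tens (x : M) (y : N) (z : P) : tunassoc (x ⊙ (y ⊙ z)) = (x ⊙ y) ⊙ z.
Proof. by rewrite /tunassoc (tlift_tens bal) (tlift_tens (bal1 x)). Qed.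

Lemma tunassocD : {morph tunassoc : t u / t + u}.
Proof. exact: tliftD bal. Qed.

Lemma tunassoc0 : tunassoc 0 = 0.
Proof. exact: tlift0 bal. Qed.

Lemma tassocK : cancel (@tassoc R M N P) tunassoc.
Proof.
elim/tensor_ind => [|t z|t u IHt IHu]; first by rewrite tassoc0 tunassoc0.
  elim/tensor_ind: t => [|x y|t u IHt IHu].
  - by rewrite tens0l tassoc0 tunassoc0.
  - by rewrite tassoc_tens tunassoc_tens.
  by rewrite tensDl tassocD tunassocD IHt IHu.
by rewrite tassocD tunassocD IHt IHu.
Qed.

Lemma tunassocK : cancel tunassoc (@tassoc R M N P).
Proof.
elim/tensor_ind => [|x t|t u IHt IHu]; first by rewrite tunassoc0 tassoc0.
  elim/tensor_ind: t => [|y z|t u IHt IHu].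
  - by rewrite tens0r tunassoc0 tassoc0.
  - by rewrite tunassoc_tens tassoc_tens.
  by rewrite tensDr tunassocD tassocD IHt IHu.
by rewrite tunassocD tassocD IHt IHu.
Qed.

Lemma tunassoc_sumr (I : finType) (x : M) (y : I -> N) (z : I -> P) :
  tunassoc (x ⊙ \sum_i y i ⊙ z i) = \sum_i (x ⊙ y i) ⊙ z i.
Proof.
rewrite tens_sumr (big_morph _ tunassocD tunassoc0).
by apply: eq_bigr => i _; rewrite tunassoc_tens.
Qed.
End Unassoc.

Lemma flat_tensor (R : comNzRingType) (A B : lmodType R) :
  flat A -> flat B -> flat (A ⊗ B).
Proof.
move=> Af Bf N N' f finj t u tu.
have E (w : N ⊗ (A ⊗ B)) :
    tunassoc (tmap f idfun w) = tmap (tmap f idfun) idfun (tunassoc w).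
  elim/tensor_ind: w => [|x s|w w' IHw IHw'].
  - by rewrite tunassoc0 !linear0 tunassoc0.
  - elim/tensor_ind: s => [|y z|s s' IHs IHs'].
    + by rewrite tens0r tunassoc0 !linear0 tunassoc0.
    + by rewrite tunassoc_tens !tmap_tens tunassoc_tens /= tmap_tens.
    by rewrite tensDr linearD !tunassocD IHs IHs' linearD.
  by rewrite linearD !tunassocD IHw IHw' linearD.
apply: (can_inj (@tunassocK R N A B)).
apply: (Bf _ _ (tmap f idfun)); first exact: Af.
by rewrite -!E tu.
Qed.

Lemma in_tens_submod (R : comNzRingType) (A M : lmodType R) (P : M -> Prop) :
  is_submod P -> is_submod (in_tens (A := A) P).
Proof.
move=> hP; split; first by exists 0%N, (fun=> 0), (fun=> 0); rewrite big_ord0; split => [[]|].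
move=> c t u [k [x [a [Px ->]]]] [l [y [b [Py ->]]]].
exists (k + l)%N, (fun i => match split i with inl i => c *: x i | inr i => y i end),
  (fun i => match split i with inl i => a i | inr i => b i end); split.
  by move=> i; case: (split i) => // j; exact: is_submodZ.
rewrite scaler_sumr big_split_ord; congr (_ + _); apply: eq_bigr => i _ /=.
  by rewrite (unsplitK (inl i)) scale_tens.
by rewrite (unsplitK (inr i)).
Qed.

Lemma in_tens1 (R : comNzRingType) (A M : lmodType R) (P : M -> Prop) x (a : A) :
  P x -> in_tens P (x ⊙ a).
Proof. by move=> Px; exists 1%N, (fun=> x), (fun=> a); rewrite big_ord1. Qed.

Section LocalFiniteness.
Variables (R : comNzRingType) (G : affGroup R).
Hypotheses (R_noeth : noetherian R) (G_flat : flat G).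

Lemma stable_submodule (n : nat) (x : 'I_n -> G) :
  exists V : submodClosed G, [/\ fin_gen (fun v => v \in V), forall i, x i \in V &
    forall v, v \in V -> in_tens (fun w => w \in V) (comul G v)].
Proof.
have legs i : exists (k : nat) (e a : 'I_k -> G), comul G (x i) = \sum_j e j ⊙ a j.
  exact: tensor_sumP.
have /choice [k kP] := legs.
pose e (p : {i : 'I_n & 'I_(k i)}) : G := sval (cid (kP (tag p))) (tagged p).
pose E := span_of e; have hE : is_submod E by exact: span_is_submod.
pose P (v : G) := in_tens E (comul G v).
have hEA := in_tens_submod G hE.
have hP : is_submod P.
  split; first by rewrite /P linear0; exact: is_submod0.
  by move=> a u v Pu Pv; rewrite /P linearP; exact: hEA.2.
(* The counit applied to the right legs of the comultiplication returns [v]. *)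
have PE v : P v -> E v.
  move=> [l [u [a [Eu va]]]]; rewrite -(counitr v) va.
  rewrite (tlift_sum u a (balanced_scaler _ _)).
  by apply: is_submod_sum => // i; exact: is_submodZ.
exists (mk_submod hP); split.
- have [l [m mP]] : fin_gen E by exact: fin_gen_fin.
  have [l' [m' mP']] := noetherian_fin_gen R_noeth (m := m) hP (fun v Pv => (mP v).1 (PE v Pv)).
  exists l', m' => v; rewrite -mP'; split=> ?; exact/(mk_submodP hP).
- move=> i; apply/mk_submodP; rewrite /P.
  have [a ->] := svalP (cid (kP i)).
  exists (k i), (sval (cid (kP i))), a; split=> // j.
  exact: (mem_span e (Tagged (fun i => 'I_(k i)) j)).
move=> v /mk_submodP [l [u [c [Eu vuc]]]].
have := comulA v; rewrite vuc !tmap_sum => /(congr1 (@tunassoc R G G G)).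
rewrite tassocK => coassoc.
(* By coassociativity the sum equals that of u i ⊗ Delta(c i), with all [u i] in [E]. The criterion
   modulo E ⊗ A then replaces the left legs by combinations whose comultiplication lies in E ⊗ A. *)
have : in_tens (@in_tens R G G E) (\sum_i comul G (u i) ⊙ c i).
  rewrite coassoc (big_morph _ (@tunassocD R G G G) (@tunassoc0 R G G G)).
  have hEAA := in_tens_submod G hEA.
  apply: is_submod_sum => // i.
  have [r [p [q ->]]] := tensor_sumP (comul G (c i)).
  rewrite tunassoc_sumr; apply: is_submod_sum => // j.
  exact: (in_tens1 _ (in_tens1 _ (Eu i))).

case/(flat_equational_mod G_flat hEA) => r [s [b [cb sP]]].
exists r, (fun j => \sum_i s i j *: u i), b; split.
  move=> j; apply/mk_submodP; rewrite /P linear_sum.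
  by have := sP j; congr (in_tens E _); apply: eq_bigr => i _; rewrite linearZ.
under eq_bigr do rewrite cb tens_sumr.
rewrite exchange_big; apply: eq_bigr => j _ /=; rewrite tens_suml.
by apply: eq_bigr => i _; rewrite tensZ.
Qed.

Variable V : submodClosed G.
Hypothesis V_stable : forall v, v \in V -> in_tens (fun w => w \in V) (comul G v).

Let jV : {linear submod V ⊗ G -> G ⊗ G} := tmap (submod_val V) idfun.
Let jV_inj : injective jV.
Proof. by apply: G_flat; exact: val_inj. Qed.

Let rhoE (v : submod V) : exists t, jV t = comul G (val v).
Proof.
have [k [x [a [xV ->]]]] := V_stable (valP v).
exists (\sum_i (Sub (x i) (xV i) : submod V) ⊙ a i).
by rewrite [LHS]tmap_sum.
Qed.

(** The lift of Delta(v) to V ⊗ O(G) is unique because flatness makes [jV] injective; hence chosen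
    lifts depend linearly on v. *)
Let rho_fun v := sval (cid (rhoE v)).
Let rho_funP v : jV (rho_fun v) = comul G (val v).
Proof. exact: (svalP (cid (rhoE v))). Qed.

Let rho_lin c u v : rho_fun (c *: u + v) = c *: rho_fun u + rho_fun v.
Proof.
apply: jV_inj; rewrite linearP !rho_funP.
by rewrite -[RHS](linearP (comul G)).
Qed.

Let rho : {linear submod V -> submod V ⊗ G} := mk_linear rho_lin.

(** Both comodule laws hold after embedding [V] into O(G); flatness of O(G) ⊗ O(G) lets
    coassociativity be pulled back. *)
Lemma restricted_coaction : exists rho : repn G (submod V), regular_subrep rho.
Proof.
have AA_inj : injective (tmap (submod_val V) (idfun : {linear G ⊗ G -> G ⊗ G})).
  by apply: flat_tensor => //; exact: val_inj.
have valA (w : (submod V ⊗ G) ⊗ G) :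
    tmap (submod_val V) idfun (tassoc w) = tassoc (tmap jV idfun w).
  elim/tensor_ind: w => [|t z|t u IHt IHu].
  - by rewrite tassoc0 !linear0 tassoc0.
  - elim/tensor_ind: t => [|x y|t u IHt IHu].
    + by rewrite tens0l tassoc0 !linear0 tassoc0.
    + rewrite tassoc_tens !tmap_tens -[RHS]/(tassoc (tmap _ _ _ ⊙ z)).
      by rewrite tmap_tens tassoc_tens.
    rewrite tensDl tassocD [LHS]linearD [X in X + _]IHt [X in _ + X]IHu.
    by rewrite [in RHS]linearD tassocD.
  rewrite tassocD [LHS]linearD [X in X + _]IHt [X in _ + X]IHu.
  by rewrite [in RHS]linearD tassocD.
have coA v : tassoc (tmap rho idfun (rho v)) = tmap idfun (comul G) (rho v).
  apply: AA_inj; rewrite valA.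
  have -> : tmap jV idfun (tmap rho idfun (rho v)) = tmap (comul G) idfun (jV (rho v)).
    elim/tensor_ind: (rho v) => [|w a|t u IHt IHu]; rewrite ?linear0 //.
      rewrite [jV _]tmap_tens !tmap_tens.
      by rewrite -[LHS]/(jV (rho_fun w) ⊙ a) rho_funP.
    rewrite [tmap rho _ _]linearD [LHS]linearD [jV _]linearD [RHS]linearD.
    by congr (_ + _).
  rewrite [jV _]rho_funP comulA -rho_funP -[rho v]/(rho_fun v).
  elim/tensor_ind: (rho_fun v) => [|w a|t u IHt IHu]; rewrite ?linear0 //.
    by rewrite [jV _]tmap_tens !tmap_tens.
  rewrite [jV _]linearD [LHS]linearD [X in _ = tmap _ _ X]linearD [RHS]linearD.
  by congr (_ + _).
have co1 v : tlift (fun w a => (counit G a : R) *: w) (rho v) = v.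
  apply: val_inj; rewrite -[RHS]counitr -rho_funP /=.
  have [k [x [a ->]]] := tensor_sumP (rho_fun v).
  rewrite [jV _]tmap_sum !tlift_sum; [|exact: balanced_scaler..].
  by rewrite [LHS](linear_sum (submod_val V)); apply: eq_bigr => i _; rewrite linearZ.
by exists (Repn coA co1) => v; exact: rho_funP.
Qed.
End LocalFiniteness.

(** * The general linear group and the closed immersion *)

Section PointAlgebra.
Variable R : comNzRingType.

(* A set-valued functor of R-algebras with coordinate functions; its points are
   used to define the algebra of polynomial expressions in the coordinates,
   modulo equality at all points. *)
Record coord_functor := CoordFunctor {
  cf_index : Type;
  cf_point : comAlgType R -> Type;
  cf_coord : forall S : comAlgType R, cf_point S -> cf_index -> S;
  cf_base : cf_point R^o }.

Variable X : coord_functor.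

Inductive coord_term : Type :=
| CVar of cf_index X
| CConst of R
| CAdd of coord_term & coord_term
| CMul of coord_term & coord_term.

HB.instance Definition _ := gen_eqMixin coord_term.
HB.instance Definition _ := gen_choiceMixin coord_term.

Fixpoint ceval (S : comAlgType R) (x : cf_point X S) (t : coord_term) : S :=
  match t with
  | CVar i => cf_coord x i
  | CConst r => r%:A
  | CAdd t u => ceval x t + ceval x u
  | CMul t u => ceval x t * ceval x u
  end.

Definition coord_eq : rel coord_term := fun t u =>
  `[< forall (S : comAlgType R) (x : cf_point X S), ceval x t = ceval x u >].

Lemma coord_eq_refl : reflexive coord_eq.
Proof. by move=> t; apply/asboolP. Qed.
Lemma coord_eq_sym : symmetric coord_eq.
Proof. by move=> t u; apply/asboolP/asboolP => h S x; rewrite h. Qed.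
Lemma coord_eq_trans : transitive coord_eq.
Proof.
by move=> t s u /asboolP h /asboolP h'; apply/asboolP => S x; rewrite h h'.
Qed.
Canonical coord_equiv := EquivRel coord_eq coord_eq_refl coord_eq_sym coord_eq_trans.

Definition coord_alg : Type := {eq_quot coord_equiv}%qT.
HB.instance Definition _ := Choice.on coord_alg.
HB.instance Definition _ := EqQuotient.on coord_alg.

Definition ccls (t : coord_term) : coord_alg := \pi_coord_alg%qT t.

Lemma cclsP t u : ccls t = ccls u <->
  forall (S : comAlgType R) (x : cf_point X S), ceval x t = ceval x u.
Proof.
split=> [/eqP|h]; first by rewrite eqmodE => /asboolP.
by apply/eqP; rewrite eqmodE; apply/asboolP.
Qed.

Definition cval (S : comAlgType R) (x : cf_point X S) (b : coord_alg) : S :=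
  ceval x (repr b).

Lemma cval_cls (S : comAlgType R) (x : cf_point X S) t : cval x (ccls t) = ceval x t.
Proof. by apply: (cclsP _ _).1; rewrite /ccls reprK. Qed.

Lemma coord_algP (b c : coord_alg) :
  (forall (S : comAlgType R) (x : cf_point X S), cval x b = cval x c) -> b = c.
Proof.
by move=> h; rewrite -[b]reprK -[c]reprK; apply/cclsP.
Qed.

Definition cadd (b c : coord_alg) := ccls (CAdd (repr b) (repr c)).
Definition cmul (b c : coord_alg) := ccls (CMul (repr b) (repr c)).
Definition copp (b : coord_alg) := ccls (CMul (CConst (-1)) (repr b)).
Definition cscale (a : R) (b : coord_alg) := ccls (CMul (CConst a) (repr b)).
Definition cone := ccls (CConst 1).
Definition czero := ccls (CConst 0).

Lemma cval_add S x b c : @cval S x (cadd b c) = cval x b + cval x c.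
Proof. by rewrite cval_cls. Qed.
Lemma cval_mul S x b c : @cval S x (cmul b c) = cval x b * cval x c.
Proof. by rewrite cval_cls. Qed.
Lemma cval_opp S x b : @cval S x (copp b) = - cval x b.
Proof. by rewrite cval_cls /= scaleN1r mulN1r. Qed.
Lemma cval_scale S x a b : @cval S x (cscale a b) = a *: cval x b.
Proof. by rewrite cval_cls /= mulr_algl. Qed.
Lemma cval_one S x : @cval S x cone = 1.
Proof. by rewrite cval_cls /= scale1r. Qed.
Lemma cval_zero S x : @cval S x czero = 0.
Proof. by rewrite cval_cls /= scale0r. Qed.

Let cvalE := (cval_add, cval_mul, cval_opp, cval_scale, cval_one, cval_zero).

Let addA : associative cadd.
Proof. by move=> b c d; apply: coord_algP => S x; rewrite !cvalE addrA. Qed.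
Let addC : commutative cadd.
Proof. by move=> b c; apply: coord_algP => S x; rewrite !cvalE addrC. Qed.
Let add0 : left_id czero cadd.
Proof. by move=> b; apply: coord_algP => S x; rewrite !cvalE add0r. Qed.
Let addN : left_inverse czero copp cadd.
Proof. by move=> b; apply: coord_algP => S x; rewrite !cvalE addNr. Qed.
HB.instance Definition _ := GRing.isZmodule.Build coord_alg addA addC add0 addN.

Let mulA : associative cmul.
Proof. by move=> b c d; apply: coord_algP => S x; rewrite !cvalE mulrA. Qed.
Let mulC : commutative cmul.
Proof. by move=> b c; apply: coord_algP => S x; rewrite !cvalE mulrC. Qed.
Let mul1 : left_id cone cmul.
Proof. by move=> b; apply: coord_algP => S x; rewrite !cvalE mul1r. Qed.
Let mulDl : left_distributive cmul cadd.
Proof. by move=> b c d; apply: coord_algP => S x; rewrite !cvalE mulrDl. Qed.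
(** The base point, with values in [R], separates 0 from 1. *)
Let one_neq0 : cone != 0 :> coord_alg.
Proof.
apply/eqP => /(congr1 (cval (cf_base X))).
by rewrite [X in _ = X]cval_zero cval_one; apply/eqP/oner_neq0.
Qed.
HB.instance Definition _ := GRing.Zmodule_isComNzRing.Build coord_alg
  mulA mulC mul1 mulDl one_neq0.

Let scaleA a b (c : coord_alg) : cscale a (cscale b c) = cscale (a * b) c.
Proof. by apply: coord_algP => S x; rewrite !cvalE scalerA. Qed.
Let scale1 : left_id 1 cscale.
Proof. by move=> b; apply: coord_algP => S x; rewrite !cvalE scale1r. Qed.
Let scaleDr : right_distributive cscale +%R.
Proof. by move=> a b c; apply: coord_algP => S x; rewrite !cvalE scalerDr. Qed.
Let scaleDl (c : coord_alg) : {morph cscale^~ c : a b / a + b}.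
Proof. by move=> a b; apply: coord_algP => S x; rewrite !cvalE scalerDl. Qed.
HB.instance Definition _ := GRing.Zmodule_isLmodule.Build R coord_alg
  scaleA scale1 scaleDr scaleDl.
Let scaleAl (a : R) (b c : coord_alg) : a *: (b * c) = (a *: b) * c.
Proof. by apply: coord_algP => S x; rewrite !cvalE scalerAl. Qed.
HB.instance Definition _ := GRing.Lmodule_isLalgebra.Build R coord_alg scaleAl.
HB.instance Definition _ := GRing.Lalgebra_isComAlgebra.Build R coord_alg.

Section Eval.
Variables (S : comAlgType R) (x : cf_point X S).

Fact cval_semilinear : semilinear (cval x).
Proof. by split=> [a b|b c]; rewrite !cvalE. Qed.
HB.instance Definition _ := GRing.isSemilinear.Build R coord_alg S _ (cval x)
  cval_semilinear.
Fact cval_monoid : monoid_morphism (cval x).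
Proof. by split=> [|b c]; rewrite !cvalE. Qed.
HB.instance Definition _ := GRing.isMonoidMorphism.Build coord_alg S (cval x)
  cval_monoid.

Definition coord_eval : {lrmorphism coord_alg -> S} := cval x.

Lemma coord_eval_unique (f : {lrmorphism coord_alg -> S}) :
  (forall i, f (ccls (CVar i)) = cf_coord x i) -> f =1 coord_eval.
Proof.
move=> fi b; rewrite -[b]reprK -[LHS]/(f (ccls _)) -[RHS]/(cval x (ccls _)).
rewrite cval_cls; elim: (repr b) => [i|r|t IHt u IHu|t IHt u IHu] /=.
- exact: fi.
- have -> : ccls (CConst r) = r%:A.
    by apply: coord_algP => T y; rewrite cval_scale cval_one cval_cls.
  by rewrite linearZ rmorph1.
- rewrite -IHt -IHu -rmorphD; congr (f _).
  by apply: coord_algP => T y; rewrite cval_add !cval_cls.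
rewrite -IHt -IHu -rmorphM; congr (f _).
by apply: coord_algP => T y; rewrite cval_mul !cval_cls.
Qed.
End Eval.
End PointAlgebra.

Lemma scale_regular (S : comPzRingType) (a : S) (b : S^o) : a *: b = a * (b : S).
Proof. by []. Qed.

(** * Automorphisms of a projective module as matrices *)

Section MatrixEndomorphisms.
Variables (R : comNzRingType) (V : lmodType R) (n : nat).
Variables (v : 'I_n -> V) (phi : 'I_n -> {linear V -> R^o}).
Hypothesis vphi : dual_sys v phi.

(** The idempotent matrix E whose image is [V]; it is the identity when [v] is a basis. *)
Definition dual_gram (i j : 'I_n) : R := phi i (v j).

Section OverAlgebra.
Variable S : comAlgType R.

Definition bc_coordinate (i : 'I_n) : {linear bc S V -> S^o} :=
  dual_ext_fun (phi i : dual V).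
Local Notation crd := bc_coordinate.
Local Notation bv i := (bci S (v i)).

Lemma bc_coordinate_bci i x : crd i (bci S x) = (phi i x : R)%:A.
Proof. exact: dual_ext_funE. Qed.

Lemma bc_dual_sys (t : bc S V) : t = \sum_i (crd i t : S) *: bv i.
Proof.
elim/tensor_ind: t => [|s x|t u IHt IHu].
- by rewrite big1 // => i _; rewrite linear0 scale0r.
- rewrite {1}(vphi x) tens_sumr; apply: eq_bigr => i _.
  rewrite -tensZ bciE; congr (_ *: _); rewrite -[RHS]/(dual_ext_fun _ _).
  by rewrite dual_ext_funE.
rewrite {1}IHt {1}IHu -big_split; apply: eq_bigr => i _ /=.
by rewrite linearD scalerDl.
Qed.

Lemma bc_coordinate_sum i t : crd i t = \sum_j dual_gram i j *: crd j t.
Proof.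
rewrite {1}[t]bc_dual_sys linear_sum; apply: eq_bigr => j _.
by rewrite linearZ bc_coordinate_bci /= [LHS]scale_regular mulrC mulr_algl.
Qed.

Definition entry (g : bc S V -> bc S V) (i j : 'I_n) : S := crd i (g (bv j)).

Lemma bc_linear_ext (g h : {linear bc S V -> bc S V}) :
  (forall i j, entry g i j = entry h i j) -> g =1 h.
Proof.
move=> gh t; rewrite [t]bc_dual_sys !linear_sum; apply: eq_bigr => j _.
rewrite !linearZ /=; congr (_ *: _).
by rewrite [LHS]bc_dual_sys [RHS]bc_dual_sys; apply: eq_bigr => i _; congr (_ *: _); exact: gh.
Qed.

Section MxEnd.
Variable X : 'I_n -> 'I_n -> S.
Let mx_end_fun (t : bc S V) : bc S V :=
  \sum_i (\sum_j X i j * crd j t) *: bv i.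
Let mx_end_lin s t u : mx_end_fun (s *: t + u) = s *: mx_end_fun t + mx_end_fun u.
Proof.
rewrite /mx_end_fun scaler_sumr -big_split; apply: eq_bigr => i _ /=.
rewrite scalerA -scalerDl; congr (_ *: _).
rewrite mulr_sumr -big_split; apply: eq_bigr => j _ /=.
by rewrite linearP mulrDr /= scale_regular mulrCA.
Qed.
Definition mx_end : {linear bc S V -> bc S V} := mk_linear mx_end_lin.
Lemma mx_endE t : mx_end t = \sum_i (\sum_j X i j * crd j t) *: bv i.
Proof. by []. Qed.
End MxEnd.

(** Automorphisms of the image of E: X Y = Y X = E with E X = X and E Y = Y. Then X E = X Y X = E X
    = X as well. *)
Definition mx_inverse (X Y : 'I_n -> 'I_n -> S) : Prop :=
  [/\ forall i j, \sum_k X i k * Y k j = (dual_gram i j)%:A,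
      forall i j, \sum_k Y i k * X k j = (dual_gram i j)%:A,
      forall i j, \sum_k dual_gram i k *: X k j = X i j &
      forall i j, \sum_k dual_gram i k *: Y k j = Y i j].

Lemma mx_inverse_sym X Y : mx_inverse X Y -> mx_inverse Y X.
Proof. by case. Qed.

Lemma mx_endK X Y : mx_inverse X Y -> cancel (mx_end Y) (mx_end X).
Proof.
move=> [XY _ _ EY] t; rewrite mx_endE [RHS]bc_dual_sys; apply: eq_bigr => i _.
congr (_ *: _); transitivity (\sum_j X i j * \sum_l Y j l * crd l t).
  apply: eq_bigr => j _; congr (_ * _); rewrite mx_endE linear_sum.
  under eq_bigr do rewrite linearZ /= bc_coordinate_bci scale_regular mulr_suml.
  rewrite exchange_big; apply: eq_bigr => l _ /=.
  rewrite -EY mulr_suml; apply: eq_bigr => k _.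
  by rewrite mulrAC [_ * _%:A]mulrC mulr_algl.
under eq_bigr do rewrite mulr_sumr.
rewrite exchange_big [RHS]bc_coordinate_sum; apply: eq_bigr => l _ /=.
by under eq_bigr do rewrite mulrA; rewrite -mulr_suml XY mulr_algl.
Qed.

Definition mx_gl X Y (h : mx_inverse X Y) : gl (bc S V) :=
  Gl (mx_endK (mx_inverse_sym h)) (mx_endK h).

Lemma entry_mulE (g h : {linear bc S V -> bc S V}) i j :
  \sum_k entry g i k * entry h k j = entry (g \o h) i j.
Proof.
rewrite /entry /= [in RHS](bc_dual_sys (h (bv j))) !linear_sum; apply: eq_bigr => k _.
by rewrite !linearZ /= [RHS]scale_regular mulrC.
Qed.

Lemma entry_gram (g : bc S V -> bc S V) i j :
  \sum_k dual_gram i k *: entry g k j = entry g i j.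
Proof. by rewrite /entry -bc_coordinate_sum. Qed.

Lemma bc_coordinate_apply (g : {linear bc S V -> bc S V}) i t :
  crd i (g t) = \sum_j entry g i j * crd j t.
Proof.
rewrite {1}[t]bc_dual_sys !linear_sum; apply: eq_bigr => j _.
by rewrite !linearZ /= [LHS]scale_regular mulrC.
Qed.

Lemma bc_coordinate_inj (t u : bc S V) : (forall i, crd i t = crd i u) -> t = u.
Proof.
by move=> tu; rewrite [t]bc_dual_sys [u]bc_dual_sys; apply: eq_bigr => i _; rewrite tu.
Qed.

Lemma entry_gramr (g : {linear bc S V -> bc S V}) i j :
  \sum_k entry g i k * (dual_gram k j)%:A = entry g i j.
Proof.
rewrite -[RHS](entry_mulE g idfun); apply: eq_bigr => k _.
by rewrite /entry /= -bc_coordinate_bci.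
Qed.

Lemma gl_mx_inverse (g : gl (bc S V)) : mx_inverse (entry g) (entry (gl_inv g)).
Proof.
split=> i j; rewrite ?entry_gram // entry_mulE /entry /=.
  by rewrite gl_invK bc_coordinate_bci.
by rewrite gl_funK bc_coordinate_bci.
Qed.

Lemma entry_mx_end X i j : (forall i j, \sum_k dual_gram i k *: X k j = X i j) ->
  entry (mx_end X) i j = \sum_k X i k * (dual_gram k j)%:A.
Proof.
move=> EX; rewrite /entry mx_endE linear_sum.
under eq_bigr do rewrite linearZ /= bc_coordinate_bci scale_regular mulr_suml.
rewrite exchange_big; apply: eq_bigr => l _ /=.
rewrite -[X i l]EX mulr_suml; apply: eq_bigr => k _.
rewrite -[dual_ext_fun _ _]/(crd l (bv j)) bc_coordinate_bci mulrAC.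
by rewrite [X k l * _]mulrC mulr_algl.
Qed.
End OverAlgebra.

(** The entries of the inverse, under the flag [false], are coordinates of their own; they replace
    the inversion of a determinant. The base point is the identity. *)
Definition gl_functor : coord_functor R :=
  @CoordFunctor R (bool * 'I_n * 'I_n) (fun S => gl (bc S V))
    (fun S g p => entry (if p.1.1 then g : bc S V -> bc S V else gl_inv g) p.1.2 p.2)
    (@Gl _ (bc R^o V) idfun idfun (fun t => erefl) (fun t => erefl)).

Local Notation B := (coord_alg gl_functor).
Local Notation gen b i j := (ccls (CVar (X := gl_functor) (b, i, j)) : B).

Lemma gen_mx_inverse : mx_inverse (fun i j => gen true i j) (fun i j => gen false i j).
Proof.
split=> i j; apply: coord_algP => S g; have [h1 h2 h3 h4] := gl_mx_inverse g;
  rewrite -!/(coord_eval g _).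
- rewrite linearZ rmorph1 rmorph_sum /= -h1; apply: eq_bigr => k _.
  by rewrite rmorphM /= !cval_cls.
- rewrite linearZ rmorph1 rmorph_sum /= -h2; apply: eq_bigr => k _.
  by rewrite rmorphM /= !cval_cls.
- rewrite linear_sum /= cval_cls /= -h3; apply: eq_bigr => k _.
  by rewrite -!/(coord_eval g _) linearZ /= cval_cls.
rewrite linear_sum /= cval_cls /= -h4; apply: eq_bigr => k _.
by rewrite -!/(coord_eval g _) linearZ /= cval_cls.
Qed.

Definition gl_universal : gl (bc B V) := mx_gl gen_mx_inverse.

Lemma bc_coordinate_map (S T : comAlgType R) (f : {lrmorphism S -> T}) (t : bc S V) i :
  @bc_coordinate T i (tmap f idfun t) = f (@bc_coordinate S i t).
Proof.
elim/tensor_ind: t => [|s x|t u IHt IHu].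
- by rewrite !linear0.
- rewrite tmap_tens -[LHS]/(dual_ext_fun _ _) -[X in f X]/(dual_ext_fun _ _).
  by rewrite !dual_ext_funE linearZ.
by rewrite !linearD /= IHt IHu.
Qed.

Lemma gen_gramr b i j : \sum_k gen b i k * (dual_gram k j)%:A = gen b i j.
Proof.
apply: coord_algP => S g; rewrite -!/(coord_eval g _) rmorph_sum /= cval_cls /=.
have -> (h : bool) : entry (if h then g : bc S V -> bc S V else gl_inv g) i j =
    \sum_k entry (if h then g : bc S V -> bc S V else gl_inv g) i k * (dual_gram k j)%:A.
  by case: h; rewrite entry_gramr.
apply: eq_bigr => k _; rewrite -!/(coord_eval g _) rmorphM /= (rmorph_alg (coord_eval g)).
by rewrite cval_cls.
Qed.

Lemma entry_universal i j : entry gl_universal i j = gen true i j.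
Proof.
have [_ _ EX _] := gen_mx_inverse.
by rewrite entry_mx_end // gen_gramr.
Qed.

Lemma gl_imageP (S : comAlgType R) (f : {lrmorphism B -> S})
    (g : {linear bc S V -> bc S V}) :
  gl_image f gl_universal g <-> forall i j, f (gen true i j) = entry g i j.
Proof.
split=> [fg i j|fg x].
  have := fg (bci B (v j)); rewrite tmap_tens rmorph1 => /(congr1 (@bc_coordinate S i)).
  by rewrite bc_coordinate_map -entry_universal.
apply: bc_coordinate_inj => i; rewrite bc_coordinate_map !bc_coordinate_apply rmorph_sum.
apply: eq_bigr => j _.
by rewrite bc_coordinate_map rmorphM /= entry_universal fg.
Qed.

Lemma gl_functor_represented : gl_represented gl_universal.
Proof.
move=> S g; exists (coord_eval (g : cf_point gl_functor S)); split.
  by apply/gl_imageP => i j; rewrite /= cval_cls.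
move=> f /gl_imageP fg; apply: coord_eval_unique => - [[[] i] j] /=; first exact: fg.
(* The entries of the inverse are forced: if Y' is their image under [f], then Y' = Y' E = Y' X Y =
   E Y = Y. *)
have [XY YX EX EY] := gl_mx_inverse g.
have [XYb YXb EXb EYb] := gen_mx_inverse.
rewrite -gen_gramr rmorph_sum -EY.
under eq_bigr => k _ do rewrite rmorphM /= (rmorph_alg f) -XY mulr_sumr.
rewrite exchange_big; apply: eq_bigr => l _ /=.
under eq_bigr => k _ do rewrite -fg mulrA -(rmorphM f).
by rewrite -mulr_suml -(rmorph_sum f) YXb /= (rmorph_alg f) mulr_algl.
Qed.
End MatrixEndomorphisms.

(** * Matrix coefficients of a representation *)

Section CoactionMatrix.
Variables (R : comNzRingType) (G : affGroup R) (V : lmodType R) (rho : repn G V).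
Variables (n : nat) (v : 'I_n -> V) (phi : 'I_n -> {linear V -> R^o}).
Hypothesis vphi : dual_sys v phi.
Local Notation E := (dual_gram v phi).

Section Slice.
Variables (M : lmodType R) (i : 'I_n).
Let slice_balanced : balanced (fun (w : V) (a : M) => (phi i w : R) *: a).
Proof.
split=> [x x' y|x y y'|a x y]; first by rewrite linearD scalerDl.
  by rewrite scalerDr.
by rewrite [phi i (_ *: _)]linearZ scalerA mulrC.
Qed.
Definition slice (t : V ⊗ M) : M := tlift (fun w a => (phi i w : R) *: a) t.
Lemma slice_tens w a : slice (w ⊙ a) = (phi i w : R) *: a.
Proof. exact: (tlift_tens slice_balanced). Qed.
Lemma sliceD : {morph slice : t u / t + u}.
Proof. exact: (tliftD slice_balanced). Qed.
Lemma slice0 : slice 0 = 0.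
Proof. exact: (tlift0 slice_balanced). Qed.
Lemma slice_sum (I : finType) (w : I -> V) (a : I -> M) :
  slice (\sum_k w k ⊙ a k) = \sum_k (phi i (w k) : R) *: a k.
Proof. exact: (tlift_sum _ _ slice_balanced). Qed.
End Slice.

Lemma sliceE (M : lmodType R) (t : V ⊗ M) : t = \sum_i v i ⊙ slice i t.
Proof.
elim/tensor_ind: t => [|x y|t u IHt IHu].
- by rewrite big1 // => i _; rewrite slice0 tens0r.
- rewrite {1}[x]vphi tens_suml; apply: eq_bigr => i _.
  by rewrite slice_tens tensZ.
rewrite {1}IHt {1}IHu -big_split; apply: eq_bigr => i _ /=.
by rewrite sliceD tensDr.
Qed.

Lemma slice_gram (M : lmodType R) (t : V ⊗ M) i :
  \sum_k E i k *: slice k t = slice i t.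
Proof. by rewrite {2}[t]sliceE slice_sum. Qed.

Definition coact_mx (i j : 'I_n) : G := slice i (rho (v j)).

Lemma coact_mxE j : rho (v j) = \sum_i v i ⊙ coact_mx i j.
Proof. exact: sliceE. Qed.

Lemma coact_mx_gram i j : \sum_k E i k *: coact_mx k j = coact_mx i j.
Proof. exact: slice_gram. Qed.

Lemma coactE w : rho w = \sum_i v i ⊙ (\sum_j (phi j w : R) *: coact_mx i j).
Proof.
rewrite {1}[w]vphi linear_sum.
under eq_bigr do rewrite linearZ /= coact_mxE scaler_sumr.
rewrite exchange_big; apply: eq_bigr => i _ /=; rewrite tens_sumr.
by apply: eq_bigr => j _; rewrite scale_tensr.
Qed.

Lemma comul_coact_mx i j : comul G (coact_mx i j) = \sum_k coact_mx i k ⊙ coact_mx k j.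
Proof.
have := coactA rho (v j); rewrite coact_mxE !tmap_sum => /(congr1 (slice i)).
rewrite [RHS]slice_sum.
have -> : \sum_k (phi i (v k) : R) *: comul G (coact_mx k j) = comul G (coact_mx i j).
  by rewrite -[in RHS]coact_mx_gram linear_sum; apply: eq_bigr => k _; rewrite linearZ.
move=> <-; rewrite (big_morph _ (@tassocD R V G G) (@tassoc0 R V G G)).
rewrite (big_morph _ (@sliceD _ i) (@slice0 _ i)); apply: eq_bigr => k _.
rewrite coact_mxE tens_suml (big_morph _ (@tassocD R V G G) (@tassoc0 R V G G)).
under eq_bigr do rewrite tassoc_tens.
rewrite slice_sum -[in RHS]coact_mx_gram tens_suml.
by apply: eq_bigr => l _; rewrite scale_tens.
Qed.

Lemma counit_coact_mx i j : counit G (coact_mx i j) = E i j.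
Proof.
have := coact1 rho (v j); rewrite coact_mxE tlift_sum; last exact: balanced_scaler.
move=> /(congr1 (phi i)); rewrite linear_sum => eq_ij.
rewrite -coact_mx_gram linear_sum /= /dual_gram -[RHS]eq_ij; apply: eq_bigr => k _.
by rewrite !linearZ /= !scale_regular mulrC.
Qed.

Lemma coact_mx_gramr i j : \sum_k coact_mx i k * (E k j)%:A = coact_mx i j.
Proof.
rewrite [RHS]/coact_mx coactE slice_sum; under [RHS]eq_bigr do rewrite scaler_sumr.
rewrite exchange_big; apply: eq_bigr => k _ /=; rewrite mulrC mulr_algl.
rewrite -[in LHS]coact_mx_gram scaler_sumr; apply: eq_bigr => l _.
by rewrite !scalerA mulrC.
Qed.

Section Point.
Variables (S : comAlgType R) (x : {lrmorphism G -> S}).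

(** In matrix terms the antipode laws say that the antipode of the coaction matrix is its inverse,
    with the idempotent E in the place of 1. *)
Lemma point_mx_inverse :
  mx_inverse v phi (fun i j => x (coact_mx i j)) (fun i j => x (antip G (coact_mx i j))).
Proof.
have conv (f g : {lrmorphism G -> G}) :
    (forall a, tlift (fun a b => f a * g b) (comul G a) = (counit G a)%:A) ->
    forall i j, \sum_k x (f (coact_mx i k)) * x (g (coact_mx k j)) = (E i j)%:A.
  move=> h i j; have := h (coact_mx i j); rewrite comul_coact_mx.
  rewrite tlift_sum; last exact: (balanced_mul f g).
  rewrite counit_coact_mx => /(congr1 x); rewrite rmorph_alg rmorph_sum /= => <-.
  by apply: eq_bigr => k _; rewrite rmorphM.
split=> [||i j|i j].
- exact: (conv idfun (antip G) (@antipr R G)).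
- exact: (conv (antip G) idfun (@antipl R G)).
- rewrite -[in RHS]coact_mx_gram linear_sum; apply: eq_bigr => k _.
  by rewrite linearZ.
rewrite -[in RHS]coact_mx_gram !linear_sum; apply: eq_bigr => k _.
by rewrite !linearZ.
Qed.

Lemma repn_pointE : repn_point rho x =1 mx_end v phi (fun i j => x (coact_mx i j)).
Proof.
pose M := mx_end v phi (fun i j => x (coact_mx i j)).
have tE s w : tlift (fun w a => (s * x a) ⊙ w) (rho w) = M (s ⊙ w) :> bc S V.
  rewrite coactE tlift_sum; last exact: repn_point_balanced1.
  rewrite [RHS]mx_endE; apply: eq_bigr => i _.
  rewrite bciE; congr (_ *: _); rewrite linear_sum mulr_sumr; apply: eq_bigr => j _.
  rewrite linearZ /= dual_ext_funE.
  by rewrite -scalerAr -scalerAr mulrC.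
have b : balanced (fun (s : S) w => tlift (fun w a => (s * x a) ⊙ w) (rho w) : bc S V).
  split=> [s s' w|s w w'|a s w]; rewrite !tE.
  - by rewrite tensDl [LHS]linearD.
  - by rewrite tensDr [LHS]linearD.
  by rewrite tensZ.
elim/tensor_ind => [|s w|t u IHt IHu].
- by rewrite linear0 /repn_point (tlift0 b).
- by rewrite repn_point_tens tE.
by rewrite linearD -IHt -IHu; exact: (tliftD b).
Qed.

Definition point_gl : gl (bc S V) := mx_gl vphi point_mx_inverse.
Lemma point_glE : repn_point rho x =1 point_gl. Proof. exact: repn_pointE. Qed.
End Point.
End CoactionMatrix.

Section ClosedImmersion.
Variables (R : comNzRingType) (G : affGroup R) (V : submodClosed G).
Variables (rho : repn G (submod V)) (n : nat) (v : 'I_n -> submod V).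
Variable phi : 'I_n -> {linear submod V -> R^o}.
Hypotheses (rho_reg : regular_subrep rho) (vphi : dual_sys v phi).
Local Notation a := (coact_mx rho v phi).

Lemma regular_val_coact_mx j : val (v j) = \sum_i (counit G (val (v i)) : R) *: a i j.
Proof.
have := counitl (val (v j)); have := rho_reg (v j); rewrite /= => <-.
rewrite (coact_mxE rho vphi) tmap_sum tlift_sum; last exact: balanced_scalel.
by move=> {1}<-.
Qed.

Lemma regular_closed_immersion (l : nat) (x : 'I_l -> G) :
  (forall f, exists p, mpoly.mmap (in_alg G) x p = f) -> (forall i, x i \in V) ->
  closed_immersion_in_gl rho.
Proof.
move=> x_gen xV; pose g := point_gl rho vphi (idfun : {lrmorphism G -> G}).
exists (coord_alg (gl_functor v phi)), (gl_universal vphi); split.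
  exact: gl_functor_represented.
have [f [fg _]] := gl_functor_represented vphi g.
exists f; split.
  by move=> y; rewrite (point_glE rho vphi) -fg.
have fa i j : exists b, f b = a i j.
  exists (ccls (CVar (X := gl_functor v phi) (true, i, j))).
  rewrite ((gl_imageP vphi f g).1 fg) entry_mx_end.
    by rewrite (coact_mx_gramr rho vphi).
  by move=> k l'; rewrite (coact_mx_gram rho vphi).
have fsum (I : Type) (r : seq I) (F : I -> G) : (forall i, exists b, f b = F i) ->
    exists b, f b = \sum_(i <- r) F i.
  move=> h; apply: (big_ind (fun y => exists b, f b = y)) =>
    [|_ _ [b <-] [c <-]|i _]; last exact: h.
    by exists 0; rewrite rmorph0.
  by exists (b + c); rewrite rmorphD.
have fprod (I : Type) (r : seq I) (F : I -> G) : (forall i, exists b, f b = F i) ->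
    exists b, f b = \prod_(i <- r) F i.
  move=> h; apply: (big_ind (fun y => exists b, f b = y)) =>
    [|_ _ [b <-] [c <-]|i _]; last exact: h.
    by exists 1; rewrite rmorph1.
  by exists (b * c); rewrite rmorphM.
have fZ c u : (exists b, f b = u) -> exists b, f b = c *: u.
  by move=> [b <-]; exists (c *: b); rewrite linearZ.
have fV w : w \in V -> exists b, f b = w.
  move=> wV; pose w' : submod V := Sub w wV.
  have -> : w = val w' by [].
  rewrite [w']vphi; rewrite -[val _]/(submod_val V _) linear_sum.
  apply: (fsum) => i; rewrite linearZ /=; apply: (fZ); rewrite regular_val_coact_mx.
  by apply: (fsum) => k; apply: (fZ).
move=> u; have [p <-] := x_gen u; rewrite /mpoly.mmap.
apply: (fsum) => m; rewrite mulr_algl; apply: (fZ); apply: (fprod) => i.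
have [b bx] := fV _ (xV i).
by eexists; rewrite -bx -(rmorphXn f).
Qed.
End ClosedImmersion.

(** * Coordinates of tensors *)

Lemma big_ffun_recl (T : finType) (m : nat) (Z : nmodType) (F : T -> {ffun 'I_m -> T} -> Z) :
  \sum_(I : {ffun 'I_m.+1 -> T}) F (I ord0) [ffun k => I (lift ord0 k)] =
  \sum_i \sum_J F i J.
Proof.
rewrite pair_big /=.
pose h (p : T * {ffun 'I_m -> T}) : {ffun 'I_m.+1 -> T} :=
  [ffun k => if unlift ord0 k is Some l then p.2 l else p.1].
pose h' (I : {ffun 'I_m.+1 -> T}) := (I ord0, [ffun k => I (lift ord0 k)]).
have hK : cancel h h'.
  move=> [i J]; rewrite /h' /h ffunE unlift_none; congr (_, _).
  by apply/ffunP => k; rewrite !ffunE liftK.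
have hK' : cancel h' h.
  move=> I; apply/ffunP => k; rewrite ffunE /h' /=.
  by case: unliftP => [l|] ->; rewrite ?ffunE.
rewrite (reindex h) /=; last by exists h' => ? _.
apply: eq_bigr => p _; rewrite -[in RHS](hK p) /h' /=; congr (F _ _).
Qed.

Section PureTensors.
Variables (R : comNzRingType).

Fixpoint tpure (M : lmodType R) (m : nat) : ('I_m -> M) -> tpow M m :=
  match m return ('I_m -> M) -> tpow M m with
  | 0 => fun _ => (1 : R^o)
  | m'.+1 => fun x => x ord0 ⊙ tpure (fun i => x (lift ord0 i))
  end.

Lemma eq_tpure (M : lmodType R) (m : nat) (x y : 'I_m -> M) :
  x =1 y -> tpure x = tpure y.
Proof.
elim: m x y => [//|m IHm] x y xy /=; rewrite xy; congr (_ ⊙ _).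
by apply: IHm => i; exact: xy.
Qed.

Lemma tpow_map_pure (M N : lmodType R) (g : {linear M -> N}) (m : nat) (x : 'I_m -> M) :
  tpow_map g m (tpure x) = tpure (fun i => g (x i)).
Proof.
elim: m x => [//|m IHm] x.
by rewrite [LHS]tmap_tens [X in _ ⊙ X]IHm.
Qed.

Lemma tpow_coordinates (M : lmodType R) (n : nat) (e : 'I_n -> M)
    (f : 'I_n -> {linear M -> R^o}) (m : nat) : dual_sys e f ->
  exists c : {ffun 'I_m -> 'I_n} -> {linear tpow M m -> R^o},
    (forall t, t = \sum_I (c I t : R) *: tpure (fun k => e (I k))) /\
    (forall I x, c I (tpure x) = \prod_k (f (I k) (x k) : R)).
Proof.
move=> ef; elim: m => [|m [c [cE c_pure]]].
  exists (fun=> idfun); split=> [t|I x]; last by rewrite big_ord0.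
  rewrite (big_pred1 (ffun0 (card_ord 0))) /=.
    by rewrite -[RHS]/(t * 1) mulr1.
  by move=> I; symmetry; apply/eqP/ffunP => - [].
pose tl (I : {ffun 'I_m.+1 -> 'I_n}) := [ffun k => I (lift ord0 k)].
have b i J : balanced (fun (x : M) (t : tpow M m) => (f i x : R) * (c J t : R)).
  split=> [x x' t|x t t'|a x t].
  - by rewrite linearD mulrDl.
  - by rewrite linearD mulrDr.
  by rewrite [f i (_ *: _)]linearZ [c J (_ *: _)]linearZ /= !scale_regular mulrCA mulrA.
pose d i J (t : tpow M m.+1) : R^o :=
  tlift (fun (x : M) (t : tpow M m) => (f i x : R) * (c J t : R)) t.
have d_lin i J a t u : d i J (a *: t + u) = a *: d i J t + d i J u.
  rewrite /d (tliftD (b i J)); congr (_ + _).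
  apply: (tliftZ (Z := R^o)) (b i J) _ _ _ => {}a x {}t.
  by rewrite [f i (_ *: _)]linearZ /= -mulrA.
exists (fun I : {ffun _} => mk_linear (d_lin (I ord0) (tl I))); split=> [t|I x]; last first.
  rewrite -[LHS]/(d _ _ _) /d (tlift_tens (b _ _)) big_ord_recl c_pure; congr (_ * _).
  by apply: eq_bigr => k _; rewrite ffunE.
rewrite -[RHS]/(\sum_(I : {ffun 'I_m.+1 -> 'I_n}) d (I ord0) (tl I) t *:
  tpure (fun k => e (I k))).
under eq_bigr => I _.
  have -> : tpure (fun k => e (I k)) = e (I ord0) ⊙ tpure (fun k => e (tl I k)).
    rewrite /=; congr (_ ⊙ _); apply: eq_tpure => k; by rewrite ffunE.
  over.
rewrite (big_ffun_recl (fun i J => d i J t *: (e i ⊙ tpure (fun k => e (J k)) : tpow M m.+1))).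
elim/tensor_ind: t => [|x t|t u IHt IHu].
- rewrite big1 // => i _; rewrite big1 // => J _.
  by rewrite /d (tlift0 (b i J)) scale0r.
- rewrite {1}[x]ef {1}[t]cE tens_suml; apply: eq_bigr => i _.
  rewrite tens_sumr; apply: eq_bigr => J _.
  by rewrite /d (tlift_tens (b i J)) -scale_tens -scale_tensr scalerA.
rewrite {1}IHt {1}IHu -big_split; apply: eq_bigr => i _ /=.
rewrite -big_split; apply: eq_bigr => J _ /=.
by rewrite /d (tliftD (b i J)) scalerDl.
Qed.

(** Coordinates that separate tensors and are explicit on pure tensors suffice to test invariance.
    On the dual factors [e] and [f] exchange their roles through evaluation. *)
Lemma tspace_coordinates (M : lmodType R) (n : nat) (e : 'I_n -> M)
    (f : 'I_n -> {linear M -> R^o}) (m m' : nat) : dual_sys e f -> dual_basis e f ->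
  exists c : {ffun 'I_m -> 'I_n} -> {ffun 'I_m' -> 'I_n} -> {linear tspace M m m' -> R^o},
    (forall t u, (forall I J, c I J t = c I J u) -> t = u) /\
    (forall I J (x : 'I_m -> M) (y : 'I_m' -> dual M), c I J (tpure x ⊙ tpure y) =
       (\prod_k (f (I k) (x k) : R)) * \prod_k (dual_fun (y k) (e (J k)) : R)).
Proof.
move=> ef efb.
have ev_lin j a (y z : dual M) : dual_fun (a *: y + z) (e j) =
    a *: dual_fun y (e j) + dual_fun z (e j) by [].
have fe : dual_sys (fun i => f i : dual M) (fun j => mk_linear (ev_lin j)).
  move=> y; apply: dual_ext => x; rewrite {1}[x]ef linear_sum.
  have -> (l : nat) (a : 'I_l -> R) (z : 'I_l -> dual M) :
      dual_fun (\sum_i a i *: z i) x = \sum_i a i * (dual_fun (z i) x : R).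
    by apply: (big_morph (fun z : dual M => dual_fun z x : R)).
  by apply: eq_bigr => i _; rewrite linearZ /= [LHS]scale_regular mulrC.
have [c [cE c_pure]] := tpow_coordinates m ef.
have [d [dE d_pure]] := tpow_coordinates m' fe.
have b I J : balanced (fun t u => (c I t : R) * (d J u : R)).
  split=> [x x' t|x t t'|a x t].
  - by rewrite linearD mulrDl.
  - by rewrite linearD mulrDr.
  by rewrite [c I (_ *: _)]linearZ [d J (_ *: _)]linearZ /= !scale_regular mulrCA mulrA.
pose h I J (t : tspace M m m') : R^o := tlift (fun t u => (c I t : R) * (d J u : R)) t.
have h_lin I J a t u : h I J (a *: t + u) = a *: h I J t + h I J u.
  rewrite /h (tliftD (b I J)); congr (_ + _).
  apply: (tliftZ (Z := R^o)) (b I J) _ _ _ => {}a x {}t.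
  by rewrite [c I (_ *: _)]linearZ /= -mulrA.
have hE t : t = \sum_I \sum_J h I J t *:
    (tpure (fun k => e (I k)) ⊙ tpure (fun k => f (J k) : dual M) : tspace M m m').
  elim/tensor_ind: t => [|x t|t u IHt IHu].
  - rewrite big1 // => i _; rewrite big1 // => J _.
    by rewrite /h (tlift0 (b i J)) scale0r.
  - rewrite {1}[x]cE {1}[t]dE tens_suml; apply: eq_bigr => i _.
    rewrite tens_sumr; apply: eq_bigr => J _.
    by rewrite /h (tlift_tens (b i J)) -scale_tens -scale_tensr scalerA.
  rewrite {1}IHt {1}IHu -big_split; apply: eq_bigr => i _ /=.
  rewrite -big_split; apply: eq_bigr => J _ /=.
  by rewrite /h (tliftD (b i J)) scalerDl.
exists (fun I J => mk_linear (h_lin I J)); split=> [t u tu|I J x y].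
  rewrite [t]hE [u]hE; apply: eq_bigr => I _; apply: eq_bigr => J _.
  by congr (_ *: _); exact: tu.
rewrite -[LHS]/(h _ _ _) /h (tlift_tens (b I J)) c_pure d_pure.
by [].
Qed.
End PureTensors.

Section TensorStabilizers.
Variables (R : comNzRingType) (V : lmodType R) (n : nat).
Variables (e : 'I_n -> V) (f : 'I_n -> {linear V -> R^o}).
Hypotheses (ef : dual_sys e f) (efb : dual_basis e f).

Lemma bc_dual_basis (S : comAlgType R) :
  dual_basis (fun i => bci S (e i)) (@bc_coordinate R V n f S).
Proof.
by move=> i j; rewrite bc_coordinate_bci efb; case: eqP; rewrite ?scale1r ?scale0r.
Qed.

Lemma tpow_bc_pure (S : comAlgType R) (M : lmodType R) (N : lmodType S) (h : M -> N)
    (hD : {morph h : x y / x + y}) (hZ : forall a x, h (a *: x) = a%:A *: h x)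
    (m : nat) (x : 'I_m -> M) :
  tpow_bc h (tpure x) = tpure (fun i => h (x i)).
Proof.
elim: m x => [|m IHm] x; first exact: (rmorph1 (in_alg S)).
rewrite -[LHS]/(@tpow_bc R S M N h m.+1 (_ ⊙ _)) (tpow_bc_tens hD hZ).
by rewrite IHm.
Qed.

Lemma tspace_bc_balanced (S : comAlgType R) (m m' : nat) :
  balanced (fun (x : tpow V m) (y : tpow (dual V) m') =>
    tpow_bc (@bci R S V) x ⊙ tpow_bc (@dual_bc R S V) y).
Proof.
have [xD xZ _] := tpow_bc_spec (@bciD R S V) (@bciZ R S V) m.
have [yD yZ _] := tpow_bc_spec (@dual_bcD R S V) (@dual_bcZ R S V) m'.
split=> [z z' t|z t t'|a z t]; first by rewrite xD tensDl.
  by rewrite yD tensDr.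
by rewrite xZ yZ tensZ.
Qed.

Lemma tspace_bcD (S : comAlgType R) (m m' : nat) :
  {morph @tspace_bc R S V m m' : t u / t + u}.
Proof. exact: (tliftD (@tspace_bc_balanced S m m')). Qed.

Lemma tspace_bc0 (S : comAlgType R) (m m' : nat) : @tspace_bc R S V m m' 0 = 0.
Proof. exact: (tlift0 (@tspace_bc_balanced S m m')). Qed.

Lemma tspace_bcZ (S : comAlgType R) (m m' : nat) a (t : tspace V m m') :
  tspace_bc S (a *: t) = a%:A *: tspace_bc S t.
Proof.
have [xD xZ _] := tpow_bc_spec (@bciD R S V) (@bciZ R S V) m.
elim/tensor_ind: t => [|x y|t u IHt IHu].
- by rewrite scaler0 tspace_bc0 scaler0.
- by rewrite scale_tens !tspace_bc_tens xZ scale_tens.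
by rewrite scalerDr !tspace_bcD IHt IHu scalerDr.
Qed.

(** Invariance of a tensor given by coordinates over [R] becomes a system of equations in matrix
    entries, uniform in [S]. The inverse enters transposed since g acts on the dual by composition
    with g^-1. *)
Lemma tensor_with_coordinates (m m' : nat)
    (C : {ffun 'I_m -> 'I_n} -> {ffun 'I_m' -> 'I_n} -> R) :
  exists t : tspace V m m', forall (S : comAlgType R) (g : gl (bc S V)),
    tspace_act g (tspace_bc S t) = tspace_bc S t <->
    forall (I : {ffun 'I_m -> 'I_n}) (J : {ffun 'I_m' -> 'I_n}),
    \sum_I' \sum_J' C I' J' *: (\prod_k entry e f g (I k) (I' k) *
      \prod_k entry e f (gl_inv g) (J' k) (J k)) = (C I J)%:A.
Proof.
pose b (I : {ffun 'I_m -> 'I_n}) (J : {ffun 'I_m' -> 'I_n}) : tspace V m m' :=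
  tpure (fun k => e (I k)) ⊙ tpure (fun k => f (J k) : dual V).
exists (\sum_I \sum_J C I J *: b I J) => S g.
have bcb (I : {ffun 'I_m -> 'I_n}) (J : {ffun 'I_m' -> 'I_n}) : tspace_bc S (b I J) =
    tpure (fun k => bci S (e (I k))) ⊙ tpure (fun k => dual_bc S (f (J k) : dual V)).
  rewrite tspace_bc_tens (tpow_bc_pure (@bciD R S V) (@bciZ R S V)).
  by rewrite (tpow_bc_pure (@dual_bcD R S V) (@dual_bcZ R S V)).
have [c [c_inj c_pure]] := tspace_coordinates m m' (bc_dual_sys ef (S := S)) (@bc_dual_basis S).
have act_lin : semilinear (@tspace_act S (bc S V) g m m').
  by split=> [s t|t u]; [exact: linearZ|exact: linearD].
have cb I J I' J' : c I J (tspace_bc S (b I' J')) = ((I' == I) && (J' == J))%:R.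
  rewrite bcb c_pure.
  have -> : \prod_k (bc_coordinate f S (I k) (bci S (e (I' k))) : S) = (I' == I)%:R.
    have [->|II] := eqVneq I' I.
      by rewrite big1 // => k _; rewrite bc_dual_basis eqxx.
    have [k Ik] : exists k, I' k != I k.
      apply/existsP; apply: contraR II; rewrite negb_exists => /forallP h.
      by apply/eqP/ffunP => k; apply/eqP; have := h k; rewrite negbK.
    by rewrite (bigD1 k) //= bc_dual_basis eq_sym (negPf Ik) mul0r.
  have -> : \prod_k (dual_fun (dual_bc S (f (J' k) : dual V)) (bci S (e (J k))) : S) = (J' == J)%:R.
    have [->|JJ] := eqVneq J' J.
      by rewrite big1 // => k _; rewrite bc_dual_basis eqxx.
    have [k Jk] : exists k, J' k != J k.
      apply/existsP; apply: contraR JJ; rewrite negb_exists => /forallP h.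
      by apply/eqP/ffunP => k; apply/eqP; have := h k; rewrite negbK.
    by rewrite (bigD1 k) //= bc_dual_basis (negPf Jk) mul0r.
  by rewrite -natrM mulnb.
have cact (I I' : {ffun 'I_m -> 'I_n}) (J J' : {ffun 'I_m' -> 'I_n}) :
    c I J (tspace_act g (tspace_bc S (b I' J'))) =
    \prod_k entry e f g (I k) (I' k) * \prod_k entry e f (gl_inv g) (J' k) (J k).
  by rewrite bcb /tspace_act tmap_tens !tpow_map_pure c_pure.
have bcE : tspace_bc S (\sum_I \sum_J C I J *: b I J) =
    \sum_I \sum_J (C I J)%:A *: tspace_bc S (b I J).
  rewrite (big_morph _ (@tspace_bcD S m m') (@tspace_bc0 S m m')); apply: eq_bigr => I _.
  rewrite (big_morph _ (@tspace_bcD S m m') (@tspace_bc0 S m m')); apply: eq_bigr => J _.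
  exact: tspace_bcZ.
have actE : tspace_act g (tspace_bc S (\sum_I \sum_J C I J *: b I J)) =
    \sum_I \sum_J (C I J)%:A *: tspace_act g (tspace_bc S (b I J)).
  have [actZ actD] := act_lin.
  have act0 : @tspace_act S (bc S V) g m m' 0 = 0 by exact: linear0.
  rewrite bcE (big_morph _ actD act0); apply: eq_bigr => I _.
  rewrite (big_morph _ actD act0); apply: eq_bigr => J _; exact: actZ.
have cbc I J : c I J (tspace_bc S (\sum_I \sum_J C I J *: b I J)) = (C I J)%:A.
  rewrite bcE linear_sum (bigD1 I) //= linear_sum (bigD1 J) //= big1 => [|J' JJ].
    rewrite addr0 big1 => [|I' II].
      by rewrite addr0 linearZ /= cb !eqxx /= scale_regular mulr1.
    rewrite linear_sum big1 // => J' _.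
    by rewrite linearZ /= cb (negPf II) scale_regular mulr0.
  by rewrite linearZ /= cb (negPf JJ) andbF scale_regular mulr0.
have cactbc (I : {ffun 'I_m -> 'I_n}) (J : {ffun 'I_m' -> 'I_n}) :
    c I J (tspace_act g (tspace_bc S (\sum_I \sum_J C I J *: b I J))) =
    \sum_I' \sum_J' C I' J' *: (\prod_k entry e f g (I k) (I' k) *
      \prod_k entry e f (gl_inv g) (J' k) (J k)).
  rewrite actE linear_sum; apply: eq_bigr => I' _; rewrite linear_sum.
  by apply: eq_bigr => J' _; rewrite linearZ /= cact scale_regular mulr_algl.
split=> [fix_t I J|h]; first by rewrite -cactbc fix_t cbc.
by apply: c_inj => I J; rewrite cactbc cbc.
Qed.
End TensorStabilizers.

(** * Linear reductivity *)

Section Semisimple.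
Variables (K : fieldType) (G : affGroup K) (W : vectType K) (rho : repn G W).
Implicit Types (U L : {vspace W}) (p : {linear W -> W}).

Lemma tmap_comp_sub (M N P Q : lmodType K) (f : {linear M -> N}) (g : {linear N -> P})
    (t : M ⊗ Q) :
  tmap g idfun (tmap f (idfun : {linear Q -> Q}) t) = tmap (g \o f) idfun t.
Proof.
have [k [x [a ->]]] := tensor_sumP t.
by rewrite !tmap_sum.
Qed.

Lemma tmap_additive (M N Q : lmodType K) (f g h : {linear M -> N}) (t : M ⊗ Q) :
  (forall x, f x = g x + h x) -> tmap f idfun t = tmap g idfun t + tmap h idfun t.
Proof.
move=> fgh; have [k [x [a ->]]] := tensor_sumP t.
rewrite !tmap_sum -big_split; apply: eq_bigr => i _.
by rewrite fgh tensDl.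
Qed.

(** An element of W ⊗ O(G) comes from U ⊗ O(G) exactly when every endomorphism vanishing on [U]
    kills it; for the converse the identity minus a projector onto [U] suffices. Stability is thus
    tested without lifts to the subspace. *)
Lemma subrepP U : subrep rho U <->
  forall p, (forall w, w \in U -> p w = 0) -> forall w, w \in U -> tmap p idfun (rho w) = 0.
Proof.
split=> [hU p pU w wU|hU w wU].
  have [t <-] := hU w wU; rewrite tmap_comp_sub.
  have [k [x [a ->]]] := tensor_sumP t.
  by rewrite tmap_sum big1 // => i _; rewrite /= pU ?tens0l // subvsP.
exists (tmap (vsproj U : {linear W -> subvs_of U}) idfun (rho w)); rewrite tmap_comp_sub.
pose q : {linear W -> W} := idfun \- projv U.
have := hU q; move=> /(_ _ w wU) q0.
have -> : tmap (vsval \o (vsproj U : {linear W -> subvs_of U})) idfun (rho w) =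
    tmap (vsval \o (vsproj U : {linear W -> subvs_of U})) idfun (rho w) + tmap q idfun (rho w).
  by rewrite q0 ?addr0 // => u uU; rewrite /= projv_id ?subrr.
rewrite -(tmap_additive (f := idfun)); last first.
  by move=> x /=; rewrite unlock /= addrC subrK.
have [k [x [a ->]]] := tensor_sumP (rho w).
by rewrite tmap_sum.
Qed.

Lemma subrep0 : subrep rho 0%VS.
Proof.
by apply/subrepP => p _ w; rewrite memv0 => /eqP ->; rewrite !linear0.
Qed.

Lemma subrepD U L : subrep rho U -> subrep rho L -> subrep rho (U + L)%VS.
Proof.
move=> /subrepP hU /subrepP hL; apply/subrepP => p p0 w /memv_addP [u uU [l lL ->]].
rewrite !linearD /= hU ?hL ?addr0 // => x xU; apply: p0.
  by rewrite -[x]add0r; apply: memv_add => //; exact: mem0v.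
by rewrite -[x]addr0; apply: memv_add => //; exact: mem0v.
Qed.

Lemma subrepI U L : subrep rho U -> subrep rho L -> subrep rho (U :&: L)%VS.
Proof.
move=> /subrepP hU /subrepP hL; apply/subrepP => p p0 w /memv_capP [wU wL].
(* [p] is the sum of [p1], which vanishes on [U], and [p2], which vanishes on [L]. *)
pose p1 : {linear W -> W} := p \o addv_pi2 U L.
pose p2 : {linear W -> W} := p \- p1.
rewrite (tmap_additive (g := p1) (h := p2)); last by move=> x /=; rewrite addrC subrK.
rewrite hU ?hL ?addr0 // => x xUL /=; first by rewrite addv_pi2_id // subrr.
apply: p0; rewrite memv_cap memv_pi2 andbT.
have xe : addv_pi1 U L x + addv_pi2 U L x = x.
  by apply: addv_pi1_pi2; rewrite -[x]addr0; apply: memv_add => //; exact: mem0v.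
have -> : addv_pi2 U L x = x - addv_pi1 U L x by rewrite -{2}xe addrC addKr.
by apply: memvB => //; exact: memv_pi1.
Qed.

Lemma subrep_sum (I : finType) (P : pred I) (U : I -> {vspace W}) :
  (forall i, subrep rho (U i)) -> subrep rho (\sum_(i | P i) U i)%VS.
Proof.
move=> hU; apply: big_ind => [|L L'|i _]; [exact: subrep0|exact: subrepD|exact: hU].
Qed.

(** The complement is the sum of a maximal set of simple summands meeting [L] trivially: any other
    simple summand meets L + C nontrivially by maximality, and so lies in it by simplicity. *)
Lemma semisimple_complement L : semisimple rho -> subrep rho L ->
  exists C, [/\ subrep rho C, (L :&: C = 0)%VS & (L + C = fullv)%VS].
Proof.
move=> [n [U [Us _ Ufull]]] hL.
have hU i : subrep rho (U i) by case: (Us i).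
pose disj (S : {set 'I_n}) := (L :&: (\sum_(i in S) U i) == 0)%VS.
have disj0 : disj set0 by rewrite /disj big_set0 capv0.
have [S /maxsetP [/eqP disjS maxS] _] := maxset_exists disj0.
pose C := (\sum_(i in S) U i)%VS.
have hC : subrep rho C by exact: subrep_sum.
exists C; split=> //; apply/eqP; rewrite eqEsubv subvf -Ufull.
apply/subv_sumP => i _.
have [_ U0 Umin] := Us i.
have [||cap0|capU] := Umin (U i :&: (L + C))%VS.
- by apply: subrepI => //; exact: subrepD.
- exact: capvSl.
- have iS : i \notin S.
    apply: contra U0 => iS; rewrite -subv0 -cap0 subv_cap subvv.
    apply: subv_trans (addvSr _ _); exact: (sumv_sup i).
  have : disj (i |: S).
    rewrite /disj big_setU1 //= -subv0; apply/subvP => x /memv_capP [xL].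
    move=> /memv_addP [u uU [c cC xuc]].
    have : u \in (U i :&: (L + C))%VS.
      rewrite memv_cap uU /=; have -> : u = x - c by rewrite xuc addrK.
      by apply: memv_add => //; rewrite memvN.
    rewrite cap0 memv0 => /eqP u0; rewrite u0 add0r in xuc.
    by rewrite -disjS memv_cap xL xuc.
  move=> /maxS /(_ (subsetUr _ _)) /setP /(_ i).
  by rewrite !inE eqxx (negPf iS).
by rewrite -capU capvSr.
Qed.

Lemma semisimple_projector L : semisimple rho -> subrep rho L ->
  exists e : {linear W -> W}, [/\ forall w, w \in L -> e w = w, forall w, e w \in L &
    forall w, tmap e idfun (rho w) = rho (e w)].
Proof.
move=> ss hL; have [C [hC LC0 LC]] := semisimple_complement ss hL.
move/subrepP: (hL) => hL'; move/subrepP: hC => hC.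
have CL0 : (C :&: L = 0)%VS by rewrite capvC.
pose e : {linear W -> W} := daddv_pi L C; exists e.
have eL w : w \in L -> e w = w by exact: daddv_pi_id.
have eC w : w \in C -> e w = 0.
  move=> wC; have /(daddv_pi_add LC0) : w \in (L + C)%VS by rewrite LC memvf.
  by rewrite [daddv_pi C L w]daddv_pi_id // => /(canRL (addrK _)); rewrite subrr.
split=> // [w|w]; first exact: memv_pi.
have : w \in (L + C)%VS by rewrite LC memvf.
move=> /memv_addP [l lL [c cC ->]].
rewrite [rho (l + c)]linearD [LHS]linearD [X in _ + X]hC // addr0.
rewrite linearD eL // eC // addr0.
pose q : {linear W -> W} := idfun \- e.
have q0 : tmap q idfun (rho l) = 0.
  by apply: hL' => // x xL; rewrite /= eL // subrr.
rewrite -[LHS]addr0 -q0 -(tmap_additive (f := idfun)); last first.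
  by move=> x /=; rewrite addrC subrK.
have [k [x [a ->]]] := tensor_sumP (rho l).
by rewrite tmap_sum.
Qed.
End Semisimple.

(** * Representations given by matrices of functions *)

Section MatrixRepresentation.
Variables (K : fieldType) (H : affGroup K) (T : finType) (b : T -> T -> H).
Hypothesis comul_b : forall x y, comul H (b x y) = \sum_z b x z ⊙ b z y.
Hypothesis counit_b : forall x y, counit H (b x y) = (x == y)%:R.
Local Notation W := {ffun T -> K^o}.

Definition delta_ffun (x : T) : W := [ffun z => (z == x)%:R].

Lemma sum_delta_ffun (f : W) : f = \sum_x (f x : K) *: delta_ffun x.
Proof.
apply/ffunP => z; rewrite sum_ffunE (bigD1 z) //= big1 ?addr0 => [|x xz].
  by rewrite !ffunE eqxx [RHS]mulr1.
by rewrite !ffunE eq_sym (negPf xz) [LHS]mulr0.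
Qed.

Let act (f : W) : W ⊗ H := \sum_x delta_ffun x ⊙ (\sum_y (f y : K) *: b x y).
Let act_lin a f g : act (a *: f + g) = a *: act f + act g.
Proof.
rewrite /act scaler_sumr -big_split; apply: eq_bigr => x _ /=.
rewrite scale_tensr -tensDr scaler_sumr -big_split; congr (_ ⊙ _).
by apply: eq_bigr => y _ /=; rewrite !ffunE scalerA -scalerDl.
Qed.

Lemma act_delta y : act (delta_ffun y) = \sum_x delta_ffun x ⊙ b x y.
Proof.
apply: eq_bigr => x _; congr (_ ⊙ _).
rewrite (bigD1 y) //= ffunE eqxx scale1r big1 ?addr0 // => z zy.
by rewrite ffunE (negPf zy) scale0r.
Qed.

Let actA f : tassoc (tmap (mk_linear act_lin) idfun (act f)) = tmap idfun (comul H) (act f).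
Proof.
rewrite /act !tmap_sum (big_morph _ (@tassocD K W H H) (@tassoc0 K W H H)).
under eq_bigr => x _ do rewrite -[mk_linear _ _]/(act _) act_delta tens_suml
  (big_morph _ (@tassocD K W H H) (@tassoc0 K W H H)).
rewrite exchange_big; apply: eq_bigr => z _ /=.
under eq_bigr => x _ do rewrite tassoc_tens.
rewrite -tens_sumr linear_sum; congr (_ ⊙ _).
under [RHS]eq_bigr => y _ do rewrite linearZ /= comul_b scaler_sumr.
rewrite exchange_big; apply: eq_bigr => x _ /=; rewrite tens_sumr.
by apply: eq_bigr => y _; rewrite scale_tensr.
Qed.

Let act1 f : tlift (fun w a => (counit H a : K) *: w) (act f) = f.
Proof.
rewrite /act tlift_sum; last exact: balanced_scaler.
rewrite [RHS]sum_delta_ffun; apply: eq_bigr => x _; congr (_ *: _).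
rewrite linear_sum (bigD1 x) //= big1 => [|y xy].
  by rewrite linearZ /= counit_b eqxx addr0 [LHS]mulr1.
by rewrite linearZ /= counit_b eq_sym (negPf xy) [LHS]mulr0.
Qed.

Definition matrix_repn : repn H W := @Repn K H W (mk_linear act_lin) actA act1.

(** Complete reducibility is applied to the span of the [F i], which the assumption on [F] makes
    stable. In matrix form, the projector [e] is the identity on the span, has its columns in the
    span, and commutes with [b]. *)
Lemma matrix_projector (r : nat) (F : 'I_r -> T -> K) (A : 'I_r -> 'I_r -> H) :
  linearly_reductive H ->
  (forall i x, \sum_y F i y *: b x y = \sum_j F j x *: A i j) ->
  exists e : T -> T -> K,
    [/\ forall i x, \sum_y e x y * F i y = F i x,
        forall y, exists c : 'I_r -> K, forall x, e x y = \sum_j c j * F j x &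
        forall x y, \sum_z e x z *: b z y = \sum_z e z y *: b x z].
Proof.
move=> red stab; pose w i : W := [ffun x => F i x].
pose L := (\sum_i <[w i]>)%VS.
have act_w i : act (w i) = \sum_j w j ⊙ A i j.
  rewrite /act; under eq_bigr => x _.
    under [X in _ ⊙ X]eq_bigr => y _ do rewrite ffunE.
    rewrite stab tens_sumr; over.
  rewrite exchange_big; apply: eq_bigr => j _ /=.
  rewrite [w j]sum_delta_ffun tens_suml; apply: eq_bigr => x _.
  by rewrite ffunE -scale_tensr -scale_tens.
have wL i : w i \in L by rewrite memvE; apply: sumv_sup (subvv _).
have Lw f : f \in L -> exists c : 'I_r -> K, f = \sum_j c j *: w j.
  move=> /memv_sumP [u uw ->]; have /choice [c cP] : forall j, exists c : K, u j = c *: w j.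
    by move=> j; apply/vlineP/uw.
  by exists c; apply: eq_bigr => j _; rewrite cP.
have hL : subrep matrix_repn L.
  apply/subrepP => p pL f /Lw [c ->].
  have -> : matrix_repn (\sum_j c j *: w j) = \sum_j c j *: act (w j).
    by rewrite (linear_sum (mk_linear act_lin)); apply: eq_bigr => j _; exact: linearZ.
  rewrite linear_sum big1 // => i _.
  rewrite [LHS]linearZ /= act_w tmap_sum big1 ?scaler0 //.
  by move=> j _; rewrite pL // tens0l.
have [e [eL e_im e_com]] := semisimple_projector (red _ matrix_repn) hL.
exists (fun x y => e (delta_ffun y) x); split=> [i x|y|x y].
- have := eL _ (wL i); rewrite {1}[w i]sum_delta_ffun linear_sum => /ffunP /(_ x).
  rewrite sum_ffunE [in RHS]ffunE => <-; apply: eq_bigr => y _.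
  by rewrite linearZ /= ![in RHS]ffunE mulrC.
- have [c ec] := Lw _ (e_im (delta_ffun y)); exists c => x.
  rewrite ec sum_ffunE; apply: eq_bigr => j _; by rewrite !ffunE.
have coord_lin a (f g : W) : ((a *: f + g) x : K^o) = a *: f x + g x by rewrite !ffunE.
pose ev := mk_linear coord_lin.
have evb : balanced (fun (f : W) (a : H) => (ev f : K) *: a).
  split=> [f f' a|f a a'|k f a]; first by rewrite linearD scalerDl.
    by rewrite scalerDr.
  by rewrite [ev (_ *: _)]linearZ scalerA mulrC.
have := e_com (delta_ffun y); rewrite -[matrix_repn (delta_ffun y)]/(act _) act_delta.
rewrite tmap_sum -[matrix_repn _]/(act _) /act.
move=> /(congr1 (tlift (fun (f : W) (a : H) => (ev f : K) *: a))).
rewrite !(tlift_sum _ _ evb) => h; apply: etrans h _.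
rewrite (bigD1 x) //= [X in _ + X]big1 ?addr0 => [|z zx].
  by rewrite ffunE eqxx scale1r.
by rewrite ffunE eq_sym (negPf zx) scale0r.
Qed.
End MatrixRepresentation.

(** * Descent from the fraction field *)

Section FractionReduction.
Variable R : idomainType.
Local Notation F := (@tofrac R).

Lemma fraction_denominator (q : {fraction R}) :
  exists d, d != 0 /\ exists n, F d * q = F n.
Proof.
elim/quotW: q => x; exists \d_x; split; first exact: denom_ratioP.
exists \n_x; apply/eqP; rewrite -[_ * _]/(FracField.mul _ _) !piE.
rewrite equivfE /FracField.mulf !numden_Ratio ?mulf_neq0 ?oner_eq0 ?denom_ratioP //.
by rewrite mulr1 mulrC !mul1r mulrC.
Qed.

Lemma common_denominator (I : finType) (q : I -> {fraction R}) :
  exists s, s != 0 /\ exists p : I -> R, forall i, F s * q i = F (p i).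
Proof.
have /choice [d dP] := fun i => fraction_denominator (q i).
have d0 i : d i != 0 by case: (dP i).
have /choice [n nP] := fun i => (dP i).2.
exists (\prod_i d i); split; first by apply/prodf_neq0.
exists (fun i => (\prod_(j | j != i) d j) * n i) => i.
rewrite (bigD1 i) //= !tofracM -nP mulrA; congr (_ * _).
by rewrite mulrC.
Qed.

Variable G : affGroup R.
Hypothesis G_flat : flat G.

Lemma bcc_inj : injective (@bcc R (frac_alg R) G).
Proof.
pose f : R^o -> frac_alg R := F.
have f_lin a x y : f (a *: x + y) = a *: f x + f y.
  by rewrite /f tofracD tofracM.
have finj : injective (mk_linear f_lin).
  move=> x y xy; have {xy} : F x = F y by exact: xy.
  by move/eqP; rewrite tofrac_eq => /eqP.
move=> x y xy; have : (1 : R^o) ⊙ x = (1 : R^o) ⊙ y :> R^o ⊗ G.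
  apply: (G_flat finj); rewrite !tmap_tens.
  by have -> : mk_linear f_lin 1 = 1 by exact: (tofrac1 R).
have b : balanced (fun (c : R^o) (y : G) => (c : R) *: y).
  by split=> [u u' z|u z z'|k u z]; rewrite ?scalerDl ?scalerDr // scalerA mulrC.
move=> /(congr1 (tlift (fun (c : R^o) (y : G) => (c : R) *: y))).
by rewrite !(tlift_tens b) !scale1r.
Qed.

Variables (T : finType) (b : T -> T -> G).
Hypothesis comul_b : forall x y, comul G (b x y) = \sum_z b x z ⊙ b z y.
Hypothesis counit_b : forall x y, counit G (b x y) = (x == y)%:R.

(** Clearing denominators in the projector over the fraction field gives [e], which is s times a
    projector. Its coefficients on the basis [f] are again in [R] because [h] reads them off, and
    the commutation descends since O(G) embeds in its generic fibre. *)
Lemma reductive_projector (r : nat) (f : 'I_r -> T -> R) (h : T -> 'I_r -> R)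
    (A : 'I_r -> 'I_r -> G) : linearly_reductive (generic_fibre G) ->
  (forall i j, \sum_y f i y * h y j = (i == j)%:R) ->
  (forall i x, \sum_y f i y *: b x y = \sum_j f j x *: A i j) ->
  exists s, s != 0 /\ exists e : T -> T -> R,
    [/\ forall i x, \sum_y e x y * f i y = s * f i x,
        forall x y, e x y = \sum_j f j x * \sum_z h z j * e z y &
        forall x y, \sum_z e x z *: b z y = \sum_z e z y *: b x z].
Proof.
move=> red fh stab; pose K := frac_alg R.
have alg_F (a : R) : a%:A = F a :> K by rewrite /GRing.scale /= /GRing.scale /= mulr1.
pose bK x y : generic_fibre G := bcc K (b x y).
have bcc_sum (I : finType) (u : I -> R) (v : I -> G) :
    \sum_i (F (u i) : K) *: (bcc K (v i) : generic_fibre G) = bcc K (\sum_i u i *: v i).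
  rewrite (big_morph _ (@bccD R K G) (id1 := 0)); last by rewrite /bcc tens0r.
  by apply: eq_bigr => i _; rewrite bccZ alg_F.
have comulK x y : comul (generic_fibre G) (bK x y) = \sum_z bK x z ⊙ bK z y.
  rewrite -[LHS]/(bc_comul _) bc_comulE comul_b.
  rewrite (big_morph _ (@bcc2D R K G) (@bcc20 R K G)); apply: eq_bigr => z _.
  by rewrite bcc2_tens.
have counitK x y : counit (generic_fibre G) (bK x y) = (x == y)%:R.
  rewrite -[LHS]/(bc_counit _) bc_counitE counit_b alg_F.
  by case: eqP; rewrite ?tofrac1 ?tofrac0.
have [|e [eF e_im e_com]] := matrix_projector (b := bK) comulK counitK
    (F := fun i x => F (f i x)) (A := fun i j => bcc K (A i j)) red.
  by move=> i x; rewrite !bcc_sum stab.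
have [s [s0 [e' e'E]]] := common_denominator (fun p : T * T => e p.1 p.2).
exists s; split=> //; exists (fun x y => e' (x, y)); split=> [i x|x y|x y].
- apply/eqP; rewrite -tofrac_eq tofracM -eF mulr_sumr rmorph_sum; apply/eqP.
  by apply: eq_bigr => y _ /=; rewrite tofracM -e'E mulrA.
- have [c ec] := e_im y.
  have cE j : c j = \sum_z F (h z j) * e z y.
    under eq_bigr do rewrite ec mulr_sumr.
    rewrite exchange_big (bigD1 j) //= [X in _ + X]big1 ?addr0 => [|k kj].
      under eq_bigr do rewrite mulrCA -tofracM mulrC.
      rewrite -mulr_suml -rmorph_sum /=.
      by under eq_bigr do rewrite mulrC; rewrite fh eqxx tofrac1 mul1r.
    under eq_bigr do rewrite mulrCA -tofracM mulrC.
    rewrite -mulr_suml -rmorph_sum /=.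
    by under eq_bigr do rewrite mulrC; rewrite fh (negPf kj) tofrac0 mul0r.
  apply/eqP; rewrite -tofrac_eq -e'E /= ec mulr_sumr rmorph_sum; apply/eqP.
  apply: eq_bigr => j _ /=; rewrite tofracM cE mulrC -!mulrA mulrCA; congr (_ * _).
  rewrite rmorph_sum mulrC mulr_sumr; apply: eq_bigr => z _ /=.
  by rewrite tofracM -e'E /= mulrCA.
apply: bcc_inj; rewrite -!bcc_sum.
under eq_bigr do rewrite -e'E -scalerA.
under [RHS]eq_bigr do rewrite -e'E -scalerA.
by rewrite -!scaler_sumr; congr (_ *: _); exact: e_com.
Qed.
End FractionReduction.

(** * Minors and words *)

Section Minors.
Variables (S : comPzRingType) (W : finType) (r : nat).
Implicit Types (f : 'I_r -> W -> S) (h : W -> 'I_r -> S).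

(** Columns may come in any order and with repetitions, so that the minors form an alternating
    tensor. *)
Definition minors f (w : {ffun 'I_r -> W}) : S := \det (\matrix_(i, j) f i (w j)).

Lemma det_trE (A : 'M[S]_r) : \det A = \sum_(s : 'S_r) (-1) ^+ s * \prod_j A (s j) j.
Proof.
by rewrite -det_tr; apply: eq_bigr => s _; congr (_ * _); apply: eq_bigr => j _; rewrite mxE.
Qed.

(** A form of the Cauchy-Binet formula in which only [f] is antisymmetrized: the sum runs over all
    tuples and no factor r! arises. *)
Lemma det_minors f h : \det (\matrix_(i, j) \sum_w f i w * h w j) =
  \sum_(w : {ffun 'I_r -> W}) minors f w * \prod_j h (w j) j.
Proof.
rewrite det_trE.
under eq_bigr => s _.
  under eq_bigr => j _ do rewrite mxE.
  rewrite (bigA_distr_bigA (fun j w => f (s j) w * h w j)) mulr_sumr.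
  under eq_bigr => w _ do rewrite big_split mulrA /=.
  over.
rewrite exchange_big; apply: eq_bigr => w _ /=.
rewrite -mulr_suml; congr (_ * _); rewrite /minors det_trE.
by apply: eq_bigr => s _; congr (_ * _); apply: eq_bigr => j _; rewrite mxE.
Qed.

Lemma minors_mulmx (A : 'M[S]_r) f w :
  minors (fun i x => \sum_j A i j * f j x) w = \det A * minors f w.
Proof.
rewrite /minors -det_mulmx; congr (\det _); apply/matrixP => i j; rewrite !mxE.
by apply: eq_bigr => k _; rewrite mxE.
Qed.

Lemma minors_act f (rho : W -> W -> S) (x : {ffun 'I_r -> W}) :
  minors (fun i z => \sum_y f i y * rho z y) x =
  \sum_(y : {ffun 'I_r -> W}) minors f y * \prod_j rho (x j) (y j).
Proof. exact: (det_minors f (fun y j => rho (x j) y)). Qed.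

(* By Cramer's rule: proportional maximal minors mean equal row spaces. *)
Lemma minors_row_space f f' h (u v : S) :
  (forall i j, \sum_w f i w * h w j = (i == j)%:R) -> u * v = 1 ->
  (forall w, minors f' w = u * minors f w) ->
  forall i w, f' i w = \sum_j (\sum_z f' i z * h z j) * f j w.
Proof.
move=> fh uv minE i w.
(* The determinant of f' g depends on [f'] only through its minors, for arbitrary g. *)
have detE g : \det (\matrix_(i, j) \sum_w f' i w * g w j) =
    u * \det (\matrix_(i, j) \sum_w f i w * g w j).
  rewrite !det_minors mulr_sumr; apply: eq_bigr => x _.
  by rewrite minE mulrA.
pose A : 'M[S]_r := \matrix_(i, j) \sum_w f' i w * h w j.
have detA : \det A = u.
  rewrite /A detE; have -> : \matrix_(i, j) \sum_w f i w * h w j = 1%:M :> 'M[S]_r.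
    by apply/matrixP => k l; rewrite !mxE fh.
  by rewrite det1 mulr1.
(* The unit vector at [w] minus its projection through [h], so that f y = 0; the claim amounts to f'
   y = 0. *)
pose y z : S := (z == w)%:R - \sum_j h z j * f j w.
have fy k : \sum_z f k z * y z = 0.
  under eq_bigr do rewrite mulrBr mulr_sumr.
  rewrite sumrB exchange_big /= (bigD1 w) //= eqxx mulr1 big1 ?addr0; last first.
    by move=> z /negPf ->; rewrite mulr0.
  rewrite (bigD1 k) //=; under eq_bigr do rewrite mulrA.
  rewrite -mulr_suml fh eqxx mul1r [X in _ - (_ + X)]big1 ?addr0 ?subrr // => j jk.
  by under eq_bigr do rewrite mulrA; rewrite -mulr_suml fh eq_sym (negPf jk) mul0r.
pose b : 'cV[S]_r := \col_k \sum_z f' k z * y z.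
have adjb : \adj A *m b = 0.
  apply/colP => l; rewrite !mxE.
  (* With column l of [h] replaced by y, f g has a zero column; by [detE] the determinant of f' g
     vanishes, and its expansion along that column is entry l of adj(A) b. *)
  pose g z j := if j == l then y z else h z j.
  have := detE g; rewrite [X in _ = u * X](expand_det_col _ l) [X in _ = u * X]big1; last first.
    by move=> k _; rewrite mxE /g eqxx fy mul0r.
  rewrite mulr0 => det0; apply: etrans det0; rewrite (expand_det_col _ l).
  apply: eq_bigr => k _.
  rewrite !mxE /g eqxx mulrC; congr (_ * _).
  rewrite /cofactor; congr (_ * \det _); apply/matrixP => p q.
  by rewrite !mxE eq_sym (negPf (neq_lift _ _)).
have b0 : b = 0.
  have : A *m (\adj A *m b) = 0 by rewrite adjb mulmx0.
  rewrite mulmxA mul_mx_adj detA mul_scalar_mx => /(congr1 ( *:%R v)).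
  by rewrite scalerA mulrC uv scale1r scaler0.
have /colP /(_ i) := b0; rewrite !mxE.
under eq_bigr do rewrite mulrBr mulr_sumr.
rewrite sumrB (bigD1 w) //= eqxx mulr1 big1 ?addr0; last first.
  by move=> z /negPf ->; rewrite mulr0.
rewrite exchange_big /= => /eqP; rewrite subr_eq0 => /eqP ->.
by apply: eq_bigr => j _; rewrite mulr_suml; apply: eq_bigr => z _; rewrite mulrA.
Qed.
End Minors.

Section KroneckerPower.
Variables (S : comPzRingType) (Q T : finType).
Implicit Type gamma : T -> T -> S.

Definition kpow gamma (x y : {ffun Q -> T}) : S := \prod_k gamma (x k) (y k).

Lemma kpow_mul gamma gamma' x z :
  \sum_y kpow gamma x y * kpow gamma' y z =
  kpow (fun p q => \sum_t gamma p t * gamma' t q) x z.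
Proof.
rewrite /kpow (bigA_distr_bigA (fun k t => gamma (x k) t * gamma' t (z k))).
by apply: eq_bigr => y _; rewrite big_split.
Qed.

Lemma kpow1 x y : kpow (fun p q => (p == q)%:R) x y = (x == y)%:R.
Proof.
have [->|xy] := eqVneq x y; first by rewrite /kpow big1 // => k _; rewrite eqxx.
have [k xyk] : exists k, x k != y k.
  apply/existsP; apply: contraR xy; rewrite negb_exists => /forallP h.
  by apply/eqP/ffunP => k; apply/eqP; have := h k; rewrite negbK.
by rewrite /kpow (bigD1 k) //= (negPf xyk) mul0r.
Qed.

Lemma eq_kpow gamma gamma' : gamma =2 gamma' -> kpow gamma =2 kpow gamma'.
Proof. by move=> e x y; apply: eq_bigr => k _; rewrite e. Qed.
End KroneckerPower.

Section Words.
Variables (S : comPzRingType) (n N : nat).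
Local Notation word := {ffun 'I_N -> 'I_n * 'I_n}.
Implicit Types X Y : 'I_n -> 'I_n -> S.

(* Words of length N in the n x n variables; a matrix Y acts on them through the
   substitution X := X Y, which only moves the column indices. *)
Definition letter_act X (p q : 'I_n * 'I_n) : S := (p.1 == q.1)%:R * X p.2 q.2.
Definition word_act X : word -> word -> S := kpow (letter_act X).
Definition word_val X (w : word) : S := \prod_k X (w k).1 (w k).2.

Lemma sum_pair_delta (i : 'I_n) (F : 'I_n -> 'I_n -> S) :
  \sum_p (i == p.1)%:R * F p.1 p.2 = \sum_l F i l.
Proof.
rewrite -(pair_big xpredT xpredT (fun k l => (i == k)%:R * F k l)) /=.
rewrite (bigD1 i) //= [X in _ + X]big1 ?addr0 => [|k ki].
  by apply: eq_bigr => l _; rewrite eqxx mul1r.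
by rewrite big1 // => l _; rewrite eq_sym (negPf ki) mul0r.
Qed.

Lemma word_val_mul X Y y :
  word_val (fun i j => \sum_k X i k * Y k j) y = \sum_x word_val X x * word_act Y x y.
Proof.
rewrite /word_val /word_act /kpow.
under [RHS]eq_bigr do rewrite -big_split /=.
rewrite -(bigA_distr_bigA (fun k p => X p.1 p.2 * letter_act Y p (y k))).
apply: eq_bigr => k _; rewrite /letter_act.
under [RHS]eq_bigr do rewrite mulrCA eq_sym.
by rewrite (sum_pair_delta _ (fun i l => X i l * Y l (y k).2)).
Qed.

Lemma word_act_mul X Y x z :
  \sum_y word_act X x y * word_act Y y z = word_act (fun i j => \sum_k X i k * Y k j) x z.
Proof.
rewrite kpow_mul; apply: eq_kpow => p q; rewrite /letter_act.
under eq_bigr do rewrite -mulrA.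
rewrite (sum_pair_delta _ (fun i l => X p.2 l * ((i == q.1)%:R * Y l q.2))).
by rewrite mulr_sumr; apply: eq_bigr => l _; rewrite mulrCA.
Qed.

Lemma eq_word_act X Y : X =2 Y -> word_act X =2 word_act Y.
Proof. by move=> XY; apply: eq_kpow => p q; rewrite /letter_act XY. Qed.

Lemma eq_word_val X Y : X =2 Y -> word_val X =1 word_val Y.
Proof. by move=> XY w; apply: eq_bigr => k _; rewrite XY. Qed.

Lemma word_act1 x y : word_act (fun i j => (i == j)%:R) x y = (x == y)%:R.
Proof.
rewrite -kpow1; apply: eq_kpow => p q.
by rewrite /letter_act -natrM mulnb; case: p q => [? ?] [? ?].
Qed.
End Words.

Section AlgMinors.
Variables (R : comNzRingType) (S : comAlgType R) (W : finType) (r : nat).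
Lemma minors_alg (f : 'I_r -> W -> R) w :
  minors (fun i x => (f i x)%:A : S) w = (minors f w)%:A.
Proof.
rewrite /minors -[RHS]/(in_alg S _) -det_map_mx; congr (\det _).
by apply/matrixP => i j; rewrite !mxE.
Qed.

Lemma sum_alg (I : finType) (a : I -> R) (s : I -> S) :
  \sum_i a i *: s i = \sum_i (a i)%:A * s i.
Proof. by apply: eq_bigr => i _; rewrite mulr_algl. Qed.

Lemma alg_sum (I : finType) (F : I -> R) : (\sum_i F i)%:A = \sum_i (F i)%:A :> S.
Proof. exact: scaler_suml. Qed.

Lemma alg_mul (a b : R) : (a * b)%:A = a%:A * b%:A :> S.
Proof. exact: (rmorphM (in_alg S)). Qed.

Lemma alg_nat (b : bool) : (b%:R)%:A = b%:R :> S.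
Proof. by case: b; rewrite ?scale1r ?scale0r. Qed.
End AlgMinors.

(** * The stabilizer of a Pluecker vector *)

Section Stabilizer.
Variables (R : comNzRingType) (n N r : nat).
Local Notation word := {ffun 'I_N -> 'I_n * 'I_n}.
Variables (f : 'I_r -> word -> R) (h : word -> 'I_r -> R).
Hypothesis fh : forall i j, \sum_y f i y * h y j = (i == j)%:R.
Variable psi : {ffun 'I_r -> word} -> R.

(** Here [Y] stands for the inverse of [X]; [psi] is a vector of the dual, so [Y] multiplies it from
    the other side. *)
Definition plucker_fixed (S : comAlgType R) (X Y : 'I_n -> 'I_n -> S) : Prop :=
  forall x x' : {ffun 'I_r -> word},
    \sum_y \sum_y' (minors f y * psi y') *:
      ((\prod_j word_act X (x j) (y j)) * \prod_j word_act Y (y' j) (x' j)) =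
    (minors f x * psi x')%:A.

Lemma plucker_fixed_split (S : comAlgType R) (X Y : 'I_n -> 'I_n -> S)
    (x x' : {ffun 'I_r -> word}) :
  \sum_y \sum_y' (minors f y * psi y') *:
      ((\prod_j word_act X (x j) (y j)) * \prod_j word_act Y (y' j) (x' j)) =
  minors (fun i z => \sum_y (f i y)%:A * word_act X z y) x *
  \sum_(y' : {ffun 'I_r -> word}) psi y' *: \prod_j word_act Y (y' j) (x' j).
Proof.
rewrite minors_act mulr_suml; apply: eq_bigr => y _.
rewrite mulr_sumr; apply: eq_bigr => y' _.
by rewrite minors_alg -scalerA mulr_algl -!scalerAl -!scalerAr.
Qed.

(** Let d' and s be the transforms of d and psi, so that d' ⊗ s = d ⊗ psi. Pairing with [zeta] gives
    d = t d', and pairing with eta makes t a unit; proportional minors then show that [X] preserves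
    the relations. The identity matrix satisfies them, and the action of [X] carries the words of
    the identity to those of [X]. *)
Lemma plucker_fixed_vanish (zeta : {ffun 'I_r -> word} -> R) (S : comAlgType R)
    (X Y : 'I_n -> 'I_n -> S) :
  \sum_x psi x * zeta x = 1 -> plucker_fixed X Y ->
  (forall i, \sum_y f i y *: word_val (fun i j => (i == j)%:R : S) y = 0) ->
  forall i, \sum_y f i y *: word_val X y = 0.
Proof.
move=> psi_zeta fixXY f1 i.
pose f' i z := \sum_y (f i y)%:A * word_act X z y.
pose s x' := \sum_(y' : {ffun 'I_r -> word}) psi y' *: \prod_j word_act Y (y' j) (x' j).
pose t : S := \sum_x zeta x *: s x.
have fixE (x x' : {ffun 'I_r -> word}) :
    minors f' x * s x' = (minors f x)%:A * (psi x')%:A.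
  by rewrite -plucker_fixed_split fixXY alg_mul.
have dE x : (minors f x)%:A = minors f' x * t.
  rewrite /t mulr_sumr; under eq_bigr => x' _ do
    rewrite -scalerAr fixE -[_ *: (_ * _)]mulr_algl mulrCA -alg_mul [zeta x' * _]mulrC.
  by rewrite -mulr_sumr -alg_sum psi_zeta scale1r mulr1.
(* The pairing with eta is det(f h) = 1, so the Pluecker vector is unimodular over every base. *)
pose eta (x : {ffun 'I_r -> word}) := \prod_j h (x j) j.
have d_eta : \sum_x minors f x * eta x = 1.
  rewrite -det_minors -[RHS](det1 R r); congr (\det _).
  by apply/matrixP => k l; rewrite !mxE fh.
pose u : S := \sum_x minors f' x * (eta x)%:A.
have ut : u * t = 1.
  rewrite /u mulr_suml; under eq_bigr do rewrite mulrAC -dE -alg_mul.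
  by rewrite -alg_sum d_eta scale1r.
have rowE := minors_row_space (S := S) (f := fun i x => (f i x)%:A) (f' := f')
  (h := fun x j => (h x j)%:A) (u := u) (v := t).
have {}rowE : forall k w, f' k w = \sum_j (\sum_z f' k z * (h z j)%:A) * (f j w)%:A.
  apply: rowE => // [k l|w].
    under eq_bigr do rewrite -alg_mul.
    by rewrite -alg_sum fh alg_nat.
  by rewrite minors_alg dE mulrCA ut mulr1.
have X1 y : word_val X y =
    \sum_x word_val (fun i j => (i == j)%:R : S) x * word_act X x y.
  rewrite -word_val_mul; apply: eq_word_val => k l.
  rewrite (bigD1 k) //= eqxx mul1r big1 ?addr0 // => m mk.
  by rewrite eq_sym (negPf mk) mul0r.
rewrite sum_alg; under eq_bigr => y _ do rewrite X1 mulr_sumr.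
rewrite exchange_big /=.
under eq_bigr => x _.
  under eq_bigr => y _ do rewrite mulrCA.
  rewrite -mulr_sumr -/(f' i x) rowE mulr_sumr.
  over.
rewrite exchange_big big1 //= => j _.
under eq_bigr do rewrite mulrCA.
rewrite -mulr_sumr; under [X in _ * X]eq_bigr do rewrite mulrC.
by rewrite -(sum_alg (f j) (word_val _)) f1 mulr0.
Qed.
End Stabilizer.

Lemma torsion_free_cancel (R : idomainType) (V : lmodType R) (c : R) (x y : V) :
  torsion_free V -> c != 0 -> c *: x = c *: y -> x = y.
Proof.
move=> Vtf c0 cxy; apply/eqP; rewrite -subr_eq0; apply/eqP.
have /Vtf [/eqP|//] : c *: (x - y) = 0 by rewrite scalerBr cxy subrr.
by rewrite (negPf c0).
Qed.

(** * Invariance under the universal point *)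

Section UniversalFixed.
Variables (R : idomainType) (A : comAlgType R) (n N r : nat).
Hypotheses (R_pid : principal R) (A_tf : torsion_free A).
Local Notation word := {ffun 'I_N -> 'I_n * 'I_n}.
Variables (f : 'I_r -> word -> R) (h : word -> 'I_r -> R).
Hypothesis fh : forall i j, \sum_y f i y * h y j = (i == j)%:R.
Variables (X Y : 'I_n -> 'I_n -> A) (AX AY : 'I_r -> 'I_r -> A).
Hypothesis XY1 : forall i j, \sum_k X i k * Y k j = (i == j)%:R.
Hypothesis stabX : forall i x, \sum_y f i y *: word_act X x y = \sum_j f j x *: AX i j.
Hypothesis stabY : forall i x, \sum_y f i y *: word_act Y x y = \sum_j f j x *: AY i j.
Variables (s : R) (e : word -> word -> R).
Hypothesis s_neq0 : s != 0.
Hypothesis e_fix : forall i x, \sum_y e x y * f i y = s * f i x.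
Hypothesis e_im : forall x y, e x y = \sum_j f j x * \sum_z h z j * e z y.
Hypothesis e_comm : forall x y,
  \sum_z e x z *: word_act Y z y = \sum_z e z y *: word_act Y x z.

(** [c] is the content of [q], a generator of the ideal of its entries; the coefficients expressing
    c in these entries are [zeta]. *)
Lemma primitive_multiple (I : finType) (q : I -> R) : (exists i, q i != 0) ->
  exists c psi zeta, [/\ c != 0, forall i, q i = c * psi i & \sum_i psi i * zeta i = 1 :> R].
Proof.
move=> [i0 qi0]; have hI := span_is_submod (q : I -> R^o).
have [c cP] := R_pid (mk_submod hI).
have {}cP x : span_of (q : I -> R^o) x <-> exists d, x = d * c.
  by rewrite -cP; split=> ?; exact/(mk_submodP hI).
have /choice [psi psiE] : forall i, exists d, q i = d * c.
  by move=> i; apply/cP; exact: mem_span.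
have [zeta zE] : span_of (q : I -> R^o) c by apply/cP; exists 1; rewrite mul1r.
have c0 : c != 0.
  by apply: contraNneq qi0 => c0; rewrite psiE c0 mulr0.
exists c, psi, zeta; split=> // [i|]; first by rewrite psiE mulrC.
apply: (mulIf c0); rewrite mul1r [RHS]zE mulr_suml; apply: eq_bigr => i _.
by rewrite psiE [RHS]scale_regular mulrAC mulrC mulrCA mulrA.
Qed.

(** The coordinates, in the basis [f], of the columns of [e]; as matrices, e = f^T psi0. *)
Let psi0 (j : 'I_r) (y : word) : R := \sum_z h z j * e z y.

Let stab_coef (Z : 'I_n -> 'I_n -> A) (AZ : 'I_r -> 'I_r -> A) :
  (forall i x, \sum_y f i y *: word_act Z x y = \sum_j f j x *: AZ i j) ->
  forall i j, AZ i j = \sum_z h z j *: \sum_y f i y *: word_act Z z y.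
Proof.
move=> stab i j; under eq_bigr do rewrite stab scaler_sumr.
rewrite exchange_big (bigD1 j) //= [X in _ + X]big1 ?addr0 => [|k kj].
  under eq_bigr do rewrite scalerA mulrC.
  by rewrite -scaler_suml fh eqxx scale1r.
under eq_bigr do rewrite scalerA mulrC.
by rewrite -scaler_suml fh (negPf kj) scale0r.
Qed.

(** Since [e] commutes with [Y], moving [Y] across [e] lets it act on the basis [f], hence through
    the transpose of [AY]. *)
Let psi0_act j x : \sum_y (psi0 j y)%:A * word_act Y y x = \sum_l AY l j * (psi0 l x)%:A.
Proof.
rewrite -sum_alg /psi0.
under eq_bigr do rewrite scaler_suml.
rewrite exchange_big /=.
under eq_bigr => z _.
  under eq_bigr do rewrite -scalerA.
  rewrite -scaler_sumr e_comm.
  under eq_bigr => y _ do rewrite e_im scaler_suml.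
  rewrite exchange_big /=.
  over.
under eq_bigr do rewrite scaler_sumr.
rewrite exchange_big; apply: eq_bigr => l _ /=.
rewrite (stab_coef stabY) mulr_suml; apply: eq_bigr => z _.
rewrite -scalerAl; congr (_ *: _); rewrite mulr_suml; apply: eq_bigr => y _.
by rewrite [RHS]mulrC mulr_algl scalerA mulrC.
Qed.

(** [AX] and [AY] are the matrices of mutually inverse transformations of the span of [f]. *)
Let det_AXAY : (\det (\matrix_(i, j) AX i j)) * (\det (\matrix_(i, j) AY i j)) = 1.
Proof.
rewrite mulrC -det_mulmx -[RHS](det1 A r); congr (\det _); apply/matrixP => i l.
rewrite !mxE; under eq_bigr do rewrite !mxE (stab_coef stabX) mulr_sumr.
rewrite exchange_big /=.
have E z : \sum_k AY i k * \sum_y f k y *: word_act X z y = (f i z)%:A.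
  under eq_bigr do rewrite mulr_sumr.
  rewrite exchange_big /=.
  under eq_bigr => y _.
    under eq_bigr do rewrite -scalerAr scalerAl.
    rewrite -mulr_suml -stabY mulr_suml.
    under eq_bigr do rewrite -scalerAl mulrC.
    over.
  rewrite exchange_big /=.
  under eq_bigr => w _.
    rewrite -scaler_sumr word_act_mul (eq_word_act XY1) word_act1.
    over.
  rewrite (bigD1 z) //= eqxx big1 ?addr0 // => w /negPf wz.
  by rewrite eq_sym wz scaler0.
under eq_bigr => z _.
  under eq_bigr do rewrite -scalerAr.
  rewrite -scaler_sumr E scalerA mulrC.
  over.
by rewrite -scaler_suml fh alg_nat.
Qed.

(** The Pluecker vector of [f] is multiplied by det AX and that of [psi0] by det AY, so their tensor
    product is fixed. The second may be divided by its content because [A] has no torsion. *)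
Lemma universal_plucker_fixed : exists psi zeta : {ffun 'I_r -> word} -> R,
  \sum_x psi x * zeta x = 1 /\ plucker_fixed f psi X Y.
Proof.
(* If all these minors vanished, Cauchy-Binet would give s^r = det(psi0 f^T) = 0. *)
have q0 : exists x, minors psi0 x != 0.
  apply: contrapT => nq; have q0 x : minors psi0 x = 0.
    by apply: contrapT => /eqP qx; apply: nq; exists x.
  have := det_minors psi0 (fun y i => f i y).
  rewrite [RHS]big1 => [|x _]; last by rewrite q0 mul0r.
  have -> : \matrix_(i, j) (\sum_y psi0 i y * f j y) = s%:M.
    apply/matrixP => i j; rewrite !mxE /psi0.
    under eq_bigr do rewrite mulr_suml.
    rewrite exchange_big /=.
    under eq_bigr => z _.
      under eq_bigr do rewrite -mulrA.
      rewrite -mulr_sumr e_fix mulrCA mulrC [h z i * _]mulrC.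
      over.
    rewrite -mulr_suml fh eq_sym; case: eqP; rewrite ?mul1r ?mul0r //.
  by rewrite det_scalar => /eqP; rewrite expf_eq0 (negPf s_neq0) andbF.
have [c [psi [zeta [c0 qE psi_zeta]]]] := primitive_multiple q0.
exists psi, zeta; split=> // x x'.
rewrite plucker_fixed_split.
have -> : minors (fun i z => \sum_y (f i y)%:A * word_act X z y) x =
    \det (\matrix_(i, j) AX i j) * (minors f x)%:A.
  rewrite -minors_alg -minors_mulmx; congr (\det _); apply/matrixP => i j.
  rewrite !mxE -sum_alg stabX; apply: eq_bigr => k _.
  by rewrite mxE mulrC mulr_algl.
have -> : \sum_(y' : {ffun 'I_r -> word}) psi y' *: \prod_j word_act Y (y' j) (x' j) =
    \det (\matrix_(i, j) AY i j) * (psi x')%:A.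
  apply: (torsion_free_cancel A_tf c0).
  rewrite scalerAr scalerA -qE -minors_alg -det_tr -minors_mulmx.
  rewrite scaler_sumr; under eq_bigr => y' _ do rewrite scalerA -qE -mulr_algl -minors_alg.
  rewrite -(minors_act _ (fun x y => word_act Y y x)); congr (\det _).
  apply/matrixP => i j; rewrite !mxE psi0_act; apply: eq_bigr => l _.
  by rewrite !mxE.
by rewrite mulrACA det_AXAY mul1r alg_mul.
Qed.
End UniversalFixed.

Section PluckerTensors.
Variables (n N r : nat).
Local Notation word := {ffun 'I_N -> 'I_n * 'I_n}.
Local Notation M := #|{: 'I_r * 'I_N}|.
Local Notation index := {ffun 'I_M -> 'I_n}.

(* An r-tuple of words of length N is given by its row indices and its column
   indices, both read off as one tensor index of length r N. *)
Definition word_tuple (I J : index) : {ffun 'I_r -> word} :=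
  [ffun j => [ffun k => (I (enum_rank (j, k)), J (enum_rank (j, k)))]].

Lemma sum_word_tuple (Z : nmodType) (F : {ffun 'I_r -> word} -> Z) :
  \sum_y F y = \sum_I \sum_J F (word_tuple I J).
Proof.
rewrite pair_big /= (reindex (fun p => word_tuple p.1 p.2)) //=.
pose row (y : {ffun 'I_r -> word}) : index := [ffun m => (y (enum_val m).1 (enum_val m).2).1].
pose col (y : {ffun 'I_r -> word}) : index := [ffun m => (y (enum_val m).1 (enum_val m).2).2].
exists (fun y => (row y, col y)) => [[I J]|y] _ /=.
  congr (_, _); apply/ffunP => m; rewrite !ffunE /=.
    by rewrite -surjective_pairing enum_valK.
  by rewrite -surjective_pairing enum_valK.
apply/ffunP => j; apply/ffunP => k; rewrite !ffunE enum_rankK /=.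
by rewrite -surjective_pairing.
Qed.

Lemma word_act_tuple (S : comPzRingType) (X : 'I_n -> 'I_n -> S) (I J I1 J1 : index) :
  \prod_j word_act X (word_tuple I J j) (word_tuple I1 J1 j) =
  (I == I1)%:R * \prod_m X (J m) (J1 m).
Proof.
rewrite -kpow1 /kpow -big_split /=.
rewrite (reindex (@enum_rank _)) /=; last by apply: onW_bij; exact: enum_rank_bij.
rewrite /word_act /kpow pair_big /=; apply: eq_bigr => - [j k] _ /=.
by rewrite !ffunE.
Qed.

Variables (R : comNzRingType) (f : 'I_r -> word -> R) (psi : {ffun 'I_r -> word} -> R).

(** Row indices are left alone by the action, so the invariance splits into one condition on tensors
    of V for each pair (I, I'). *)
Lemma plucker_fixed_tensors (S : comAlgType R) (X Y : 'I_n -> 'I_n -> S) :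
  plucker_fixed f psi X Y <->
  forall I I' J J' : index,
    \sum_(J1 : index) \sum_(J1' : index)
      (minors f (word_tuple I J1) * psi (word_tuple I' J1')) *:
        (\prod_m X (J m) (J1 m) * \prod_m Y (J1' m) (J' m)) =
    (minors f (word_tuple I J) * psi (word_tuple I' J'))%:A.
Proof.
have E I I' J J' : \sum_y \sum_y' (minors f y * psi y') *:
      ((\prod_j word_act X (word_tuple I J j) (y j)) *
        \prod_j word_act Y (y' j) (word_tuple I' J' j)) =
    \sum_(J1 : index) \sum_(J1' : index)
      (minors f (word_tuple I J1) * psi (word_tuple I' J1')) *:
        (\prod_m X (J m) (J1 m) * \prod_m Y (J1' m) (J' m)).
  rewrite sum_word_tuple (bigD1 I) //= [X in _ + X]big1 ?addr0 => [|I1 II1].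
    apply: eq_bigr => J1 _; rewrite sum_word_tuple (bigD1 I') //=.
    rewrite [X in _ + X]big1 ?addr0 => [|I1' II1'].
      by apply: eq_bigr => J1' _; rewrite !word_act_tuple !eqxx !mul1r.
    rewrite big1 // => J1' _.
    by rewrite !word_act_tuple (negPf II1') mul0r mulr0 scaler0.
  rewrite big1 // => J1 _; rewrite big1 // => y' _.
  by rewrite word_act_tuple eq_sym (negPf II1) !mul0r scaler0.
split=> [fixXY I I' J J'|tens x x']; first by rewrite -E fixXY.
have tupleE (y : {ffun 'I_r -> word}) : exists p : index * index, y = word_tuple p.1 p.2.
  exists ([ffun m => (y (enum_val m).1 (enum_val m).2).1],
    [ffun m => (y (enum_val m).1 (enum_val m).2).2]).
  apply/ffunP => j; apply/ffunP => k; rewrite !ffunE enum_rankK /=.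
  by rewrite -surjective_pairing.
have [[I J] ->] := tupleE x; have [[I' J'] ->] := tupleE x' => /=.
by rewrite E tens.
Qed.
End PluckerTensors.

(** * Equations and tensors defining the group *)

Section WordPolynomials.
Variables (R : comNzRingType) (n : nat).
Local Notation letter := ('I_n * 'I_n)%type.
Local Notation matrix_fun := (forall S : comAlgType R, ('I_n -> 'I_n -> S) -> S).

Definition linear_form (c : letter -> R) (S : comAlgType R) (X : 'I_n -> 'I_n -> S) : S :=
  \sum_p c p *: X p.1 p.2.

Variable mu : letter -> R.

(** Homogeneity of degree N is asked only where the form [mu] is 1, but with the same coefficients
    for all [S]. *)
Definition is_word_poly (N : nat) (F : matrix_fun) : Prop :=
  exists c : {ffun 'I_N -> letter} -> R,
    forall (S : comAlgType R) X, linear_form mu X = 1 :> S ->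
    F S X = \sum_w c w *: word_val X w.

Lemma word_poly_const (a : R) : is_word_poly 0 (fun S X => a%:A).
Proof.
exists (fun=> a) => S X _; rewrite (big_pred1 (ffun0 (card_ord 0))) /=.
  by rewrite /word_val big_ord0.
by move=> w; symmetry; apply/eqP/ffunP => - [].
Qed.

Lemma word_polyD N F F' : is_word_poly N F -> is_word_poly N F' ->
  is_word_poly N (fun S X => F S X + F' S X).
Proof.
move=> [c cE] [c' c'E]; exists (fun w => c w + c' w) => S X X1.
by rewrite cE // c'E // -big_split; apply: eq_bigr => w _; rewrite scalerDl.
Qed.

Lemma word_polyM N F d : is_word_poly N F ->
  is_word_poly N.+1 (fun S X => linear_form d X * F S X).
Proof.
move=> [c cE]; exists (fun w : {ffun _} => d (w ord0) * c [ffun k => w (lift ord0 k)]) => S X X1.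
rewrite cE // mulr_suml.
under [RHS]eq_bigr => w _.
  have -> : word_val X w = X (w ord0).1 (w ord0).2 * word_val X [ffun k => w (lift ord0 k)].
    rewrite /word_val big_ord_recl; congr (_ * _).
    by apply: eq_bigr => k _; rewrite ffunE.
  over.
rewrite (big_ffun_recl (fun i J => (d i * c J) *: (X i.1 i.2 * word_val X J))).
apply: eq_bigr => p _; rewrite mulr_sumr; apply: eq_bigr => J _.
by rewrite -scalerAl -scalerAr scalerA.
Qed.

Lemma word_poly_ext N F F' :
  (forall (S : comAlgType R) X, linear_form mu X = 1 :> S -> F S X = F' S X) ->
  is_word_poly N F -> is_word_poly N F'.
Proof. by move=> FF [c cE]; exists c => S X X1; rewrite -FF // cE. Qed.

(** Multiplication by [mu] raises the degree and changes no value where [mu] is 1. *)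
Lemma word_poly_raise N N' F : (N <= N')%N -> is_word_poly N F -> is_word_poly N' F.
Proof.
move=> /subnK <-; elim: (N' - N)%N => // k IHk /IHk h.
by apply: word_poly_ext (word_polyM mu h) => S X X1; rewrite X1 mul1r.
Qed.

Definition word_poly F := exists N, is_word_poly N F.

Lemma word_poly_add F F' : word_poly F -> word_poly F' ->
  word_poly (fun S X => F S X + F' S X).
Proof.
move=> [N h] [N' h']; exists (maxn N N').
by apply: word_polyD; [apply: word_poly_raise h; rewrite leq_maxl|
  apply: word_poly_raise h'; rewrite leq_maxr].
Qed.

Lemma word_poly_mmap (l : nat) (d : 'I_l -> letter -> R) (q : mpoly.mpoly l R) :
  word_poly (fun S X => mpoly.mmap (in_alg S) (fun k => linear_form (d k) X) q).
Proof.
have ext F F' : (forall (S : comAlgType R) X, F S X = F' S X) -> word_poly F -> word_poly F'.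
  by move=> FF [N h]; exists N; apply: word_poly_ext h => S X _; exact: FF.
rewrite /mpoly.mmap; elim: (mpoly.msupp q) => [|m s IHs].
  exists 0%N; apply: word_poly_ext (word_poly_const 0) => S X _.
  by rewrite big_nil scale0r.
apply: (ext _ _ _ (word_poly_add _ IHs)) => [S X|]; first by rewrite big_cons.
rewrite /mpoly.mmap1; elim: (index_enum _) => [|i r IHr].
  exists 0%N; apply: word_poly_ext (word_poly_const (mpoly.mcoeff m q)) => S X _.
  by rewrite big_nil mulr1.
have wM F k : word_poly F ->
    word_poly (fun S X => linear_form (d i) X ^+ k * F S X).
  move=> hF; elim: k => [|k [N IHk]].
    by apply: (ext _ _ _ hF) => S X; rewrite mul1r.
  exists N.+1; apply: word_poly_ext (word_polyM (d i) IHk) => S X _.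
  by rewrite exprS mulrA.
apply: (ext _ _ _ (wM _ _ IHr)) => S X; rewrite big_cons mulrCA; congr (_ * _).
Qed.
End WordPolynomials.

(** * Bases of modules of linear relations *)

Section KernelBasis.
Variables (R : idomainType) (A : lmodType R) (W : finType) (alpha : W -> A).
Hypotheses (R_pid : principal R) (A_tf : torsion_free A).

Lemma submod_torsion_free (M : lmodType R) (V : submodClosed M) :
  torsion_free M -> torsion_free (submod V).
Proof.
move=> Mtf a x ax0; have /Mtf [->|x0] : a *: submod_val V x = 0.
- by rewrite -linearZ ax0 linear0.
- by left.
by right; apply: val_inj.
Qed.

(** The span of the [alpha w] is torsion-free, hence free, so the evaluation map from R^W onto it
    splits and its kernel is a direct summand with basis [f]. The family [h] is the coordinate
    system of the kernel composed with the projection from R^W. *)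
Lemma kernel_basis : exists (r : nat) (f : 'I_r -> W -> R) (h : W -> 'I_r -> R),
  [/\ forall i j, \sum_w f i w * h w j = (i == j)%:R,
      forall i, \sum_w f i w *: alpha w = 0 &
      forall c : W -> R, \sum_w c w *: alpha w = 0 ->
        forall w, c w = \sum_j (\sum_z c z * h z j) * f j w].
Proof.
have ideals I : is_submod (I : R^o -> Prop) -> ideal_dual_sys True I.
  exact: principal_dual_sys.
pose M := mk_submod (span_is_submod alpha).
have alphaM w : alpha w \in M by apply/mk_submodP; exact: mem_span.
pose al w : submod M := Sub (alpha w) (alphaM w).
have [||t [m [theta [mE _]]]] := fin_gen_dual_sys (V := submod M) ideals.
- exact: submod_torsion_free.
- have [k [g gP]] := fin_gen_fin al; exists k, g => x; split=> // _.
  apply/gP; have /mk_submodP [c xc] := valP x; exists c; apply: val_inj.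
  rewrite -[RHS]/(submod_val M _) linear_sum /= xc; apply: eq_bigr => w _.
  by [].
pose ev (c : {ffun W -> R^o}) : submod M := \sum_w (c w : R) *: al w.
have ev_lin a c d : ev (a *: c + d) = a *: ev c + ev d.
  rewrite /ev scaler_sumr -big_split; apply: eq_bigr => w _ /=.
  by rewrite !ffunE scalerDl -scalerA.
have hL : is_submod (fun c => ev c = 0).
  split=> [|a c d c0 d0]; last by rewrite ev_lin c0 d0 scaler0 addr0.
  by rewrite /ev big1 // => w _; rewrite ffunE scale0r.
pose L := mk_submod hL.
have row_lin a (c d : submod L) :
    \row_i (val (a *: c + d) : {ffun W -> R^o}) (enum_val i) =
    a *: (\row_i (val c : {ffun W -> R^o}) (enum_val i) : 'rV[R]_#|W|) +
    \row_i (val d : {ffun W -> R^o}) (enum_val i).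
  by apply/rowP => i; rewrite [val _](linearP (submod_val L)) !mxE !ffunE.
have [|r [F [chi [FE Fb]]]] := embedded_dual_sys ideals (h := mk_linear row_lin).
  move=> c d /rowP cd; apply/val_inj/ffunP => w; rewrite -[w]enum_rankK.
  by have := cd (enum_rank w); rewrite !mxE.
have /choice [sg sgE] : forall k, exists c : {ffun W -> R^o}, ev c = m k.
  move=> k; have /mk_submodP [c kc] := valP (m k); exists [ffun w => c w].
  apply: val_inj; rewrite -[LHS]/(submod_val M _) linear_sum /= kc.
  by apply: eq_bigr => w _; rewrite ffunE.
pose pr (c : {ffun W -> R^o}) := c - \sum_k (theta k (ev c) : R) *: sg k.
have pr_ker c : pr c \in L.
  apply/mk_submodP; have -> : ev (pr c) = ev c - ev (\sum_k (theta k (ev c) : R) *: sg k).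
    exact: (linearB (mk_linear ev_lin)).
  have -> : ev (\sum_k (theta k (ev c) : R) *: sg k) = \sum_k (theta k (ev c) : R) *: m k.
    apply: etrans (linear_sum (mk_linear ev_lin) _ _ _) _; apply: eq_bigr => k _.
    by rewrite -sgE [LHS]linearZ.
  by rewrite -mE subrr.
pose q c : submod L := Sub (pr c) (pr_ker c).
have q_lin a c d : q (a *: c + d) = a *: q c + q d.
  apply: val_inj; rewrite [RHS](linearP (submod_val L)) /= /pr ev_lin.
  rewrite scalerBr addrACA -opprD; congr (_ - _).
  rewrite [in RHS]scaler_sumr -big_split; apply: eq_bigr => k _ /=.

  by rewrite linearP scalerDl -scalerA.
have q_id (c : submod L) : q (val c) = c.
  apply: val_inj; rewrite /= /pr; have /mk_submodP -> := valP c.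
  by rewrite big1 ?subr0 // => k _; rewrite linear0 scale0r.
pose delta (w : W) : {ffun W -> R^o} := [ffun z => (z == w)%:R].
have deltaE (c : {ffun W -> R^o}) : c = \sum_w (c w : R) *: delta w.
  apply/ffunP => z; rewrite sum_ffunE (bigD1 z) //= big1 ?addr0 => [|w wz].
    by rewrite !ffunE eqxx [RHS]mulr1.
  by rewrite !ffunE eq_sym (negPf wz) [LHS]mulr0.
pose h w j : R := chi j (q (delta w)).
have hE j (c : {ffun W -> R^o}) : \sum_w c w * h w j = chi j (q c).
  rewrite {2}[c]deltaE -[q _]/(mk_linear q_lin _) !linear_sum; apply: eq_bigr => w _.
  by rewrite !linearZ.
exists r, (fun i w => (val (F i) : {ffun W -> R^o}) w), h; split=> [i j|i|c c0 w].
- by rewrite hE q_id Fb // eq_sym.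
- have /mk_submodP /(congr1 (submod_val M)) := valP (F i).
  by rewrite linear0 linear_sum => {2}<-; apply: eq_bigr => w _; rewrite linearZ.
pose c' : {ffun W -> R^o} := [ffun w => c w].
have c'L : c' \in L.
  apply/mk_submodP/val_inj; rewrite -[LHS]/(submod_val M _) linear_sum /= -[RHS]c0.
  by apply: eq_bigr => z _; rewrite ffunE.
have := q_id (Sub c' c'L); rewrite /= => qc.
have := FE (q c'); rewrite {1}qc => /(congr1 (submod_val L)).
rewrite linear_sum => /ffunP /(_ w); rewrite [X in X = _]ffunE => ->.
rewrite sum_ffunE; apply: eq_bigr => j _; rewrite linearZ /= ffunE -hE; congr (_ * _).
by apply: eq_bigr => z _; rewrite ffunE.
Qed.
End KernelBasis.

Section PresentedAlgebra.
Import mpoly.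
Variables (R : comNzRingType) (A S : comAlgType R) (l s : nat).
Variables (x : 'I_l -> A) (q : 'I_s -> {mpoly R[l]}) (y : 'I_l -> S).
Hypothesis x_gen : forall a, exists p, mmap (in_alg A) x p = a.
Hypothesis x_rel : forall p, mmap (in_alg A) x p = 0 ->
  exists c : 'I_s -> {mpoly R[l]}, p = \sum_i c i * q i.
Hypothesis y_rel : forall i, mmap (in_alg S) y (q i) = 0.

Lemma presented_hom : exists g : {lrmorphism A -> S},
  forall p, g (mmap (in_alg A) x p) = mmap (in_alg S) y p.
Proof.
have /choice [p pE] := x_gen.
pose g a := mmap (in_alg S) y (p a).
have gE u : g (mmap (in_alg A) x u) = mmap (in_alg S) y u.
  apply/eqP; rewrite -subr_eq0 /g -mmapB.
  have [|c ->] := x_rel (p := p (mmap (in_alg A) x u) - u).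
    by rewrite mmapB pE subrr.
  by rewrite rmorph_sum big1 // => i _; rewrite rmorphM /= y_rel mulr0.
have g_lin a u v : g (a *: u + v) = a *: g u + g v.
  rewrite -[u]pE -[v]pE !gE -mulr_algl.
  have -> : a%:A = mmap (in_alg A) x a%:MP by rewrite mmapC.
  by rewrite -rmorphM -rmorphD gE rmorphD rmorphM /= mmapC mulr_algl.
have g_mon : monoid_morphism g.
  split=> [|u v].
    by have := gE 1; rewrite !rmorph1.
  by rewrite -[u]pE -[v]pE -rmorphM !gE rmorphM.
pose g' : {lrmorphism A -> S} := HB.pack_for {lrmorphism A -> S} g
  (GRing.isLinear.Build R A S *:%R g g_lin) (GRing.isMonoidMorphism.Build A S g g_mon).
by exists g'.
Qed.
End PresentedAlgebra.

Lemma sum_enum_val (Z : nmodType) (W : finType) (F : W -> Z) :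
  \sum_(k < #|W|) F (enum_val k) = \sum_w F w.
Proof.
by rewrite [RHS](reindex (@enum_val W W)) //; apply: onW_bij; exact: enum_val_bij.
Qed.

Section MorphismWords.
Variables (A B : comPzRingType) (g : A -> B) (n N : nat).
Hypotheses (g0 : g 0 = 0) (g1 : g 1 = 1) (gM : {morph g : x y / x * y}).

Lemma morph_word_val (X : 'I_n -> 'I_n -> A) (w : {ffun 'I_N -> 'I_n * 'I_n}) :
  g (word_val X w) = word_val (fun i j => g (X i j)) w.
Proof. exact: (big_morph g gM g1). Qed.

Lemma morph_word_act (X : 'I_n -> 'I_n -> A) (x y : {ffun 'I_N -> 'I_n * 'I_n}) :
  g (word_act X x y) = word_act (fun i j => g (X i j)) x y.
Proof.
apply: etrans (big_morph g gM g1 _ _ _) _; apply: eq_bigr => k _.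
by rewrite /letter_act gM; case: eqP; rewrite ?g0 ?g1.
Qed.
End MorphismWords.

Section MatrixGroup.
Variables (R : comNzRingType) (G : affGroup R) (n N : nat) (a : 'I_n -> 'I_n -> G).
Hypothesis comul_a : forall i j, comul G (a i j) = \sum_k a i k ⊙ a k j.
Hypothesis counit_a : forall i j, counit G (a i j) = (i == j)%:R.
Local Notation word := {ffun 'I_N -> 'I_n * 'I_n}.

Let inl1 (u : G) : G ⊗ G := u ⊙ 1.
Let inr1 (u : G) : G ⊗ G := 1 ⊙ u.
Let inl0 : inl1 0 = 0. Proof. exact: tens0l. Qed.
Let inr0 : inr1 0 = 0. Proof. exact: tens0r. Qed.
Let inlM : {morph inl1 : u v / u * v}.
Proof. by move=> u v; rewrite /inl1 mul_tens mulr1. Qed.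
Let inrM : {morph inr1 : u v / u * v}.
Proof. by move=> u v; rewrite /inr1 mul_tens mulr1. Qed.
(** The comultiplication of the matrix [a] is the product of its copies in the left and right tensor
    factors, so the formulas for words of a matrix product apply inside O(G) ⊗ O(G). *)
Let comulE i j : comul G (a i j) = \sum_k inl1 (a i k) * inr1 (a k j).
Proof.
by rewrite comul_a; apply: eq_bigr => k _; rewrite mul_tens mulr1 mul1r.
Qed.
Let comul1 := (comul_monoid G).1.
Let comulM := (comul_monoid G).2.
Let comul0 : comul G 0 = 0. Proof. exact: linear0. Qed.
Let inlrE (u v : G) : inl1 u * inr1 v = u ⊙ v.
Proof. by rewrite mul_tens mulr1 mul1r. Qed.

Lemma comul_word_val (y : word) :
  comul G (word_val a y) = \sum_x word_val a x ⊙ word_act a x y.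
Proof.
rewrite (morph_word_val comul1 comulM).
rewrite (eq_word_val comulE) (word_val_mul (fun i k => inl1 (a i k)) (fun k j => inr1 (a k j))).
apply: eq_bigr => x _.
rewrite -(morph_word_val (g := inl1) (erefl 1) inlM).
by rewrite -(morph_word_act (g := inr1) inr0 (erefl 1) inrM) inlrE.
Qed.

Lemma comul_word_act (x y : word) :
  comul G (word_act a x y) = \sum_z word_act a x z ⊙ word_act a z y.
Proof.
rewrite (morph_word_act comul0 comul1 comulM).
rewrite (eq_word_act comulE).
rewrite -(word_act_mul (fun i k => inl1 (a i k)) (fun k j => inr1 (a k j))).
apply: eq_bigr => z _.
rewrite -(morph_word_act (g := inl1) inl0 (erefl 1) inlM).
by rewrite -(morph_word_act (g := inr1) inr0 (erefl 1) inrM) inlrE.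
Qed.

Lemma counit_word_act (x y : word) : counit G (word_act a x y) = (x == y)%:R.
Proof.
rewrite (morph_word_act (rmorph0 _) (rmorph1 _) (rmorphM (counit G))).
by rewrite (eq_word_act counit_a) word_act1.
Qed.

Lemma counit_word_val (x : word) :
  counit G (word_val a x) = word_val (fun i j => (i == j)%:R) x.
Proof.
rewrite (morph_word_val (rmorph1 _) (rmorphM (counit G))).
exact: eq_word_val.
Qed.

Hypothesis G_flat : flat G.
Variables (r : nat) (f : 'I_r -> word -> R) (h : word -> 'I_r -> R).
Hypothesis f_rel : forall i, \sum_w f i w *: word_val a w = 0.
Hypothesis f_all : forall c : word -> R, \sum_w c w *: word_val a w = 0 ->
  forall w, c w = \sum_j (\sum_z c z * h z j) * f j w.

(* Applying the comultiplication to a relation between the words shows that its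
   image under the universal matrix is again a combination of relations; by
   flatness these may be taken with constant coefficients. *)
Lemma relations_stable i x :
  \sum_y f i y *: word_act a x y =
  \sum_j f j x *: \sum_z h z j *: \sum_y f i y *: word_act a z y.
Proof.
pose b z := \sum_y f i y *: word_act a z y.
have rel0 : \sum_(k < #|{: word}|) word_val a (enum_val k) ⊙ b (enum_val k) = 0.
  rewrite (sum_enum_val (fun w => word_val a w ⊙ b w)).
  transitivity (comul G (\sum_y f i y *: word_val a y)); last by rewrite f_rel linear0.
  rewrite linear_sum; under [RHS]eq_bigr do rewrite linearZ /= comul_word_val scaler_sumr.
  rewrite exchange_big; apply: eq_bigr => z _ /=; rewrite /b tens_sumr.
  by apply: eq_bigr => y _; rewrite scale_tensr.
have [k [t [c [bE t0]]]] := flat_equational G_flat rel0.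
have bE' z : b z = \sum_j t (enum_rank z) j *: c j.
  by rewrite -bE enum_rankK.
have tE j w : t (enum_rank w) j = \sum_l (\sum_z t (enum_rank z) j * h z l) * f l w.
  apply: (f_all (c := fun w => t (enum_rank w) j)).
  rewrite -[RHS](t0 j) -(sum_enum_val (fun w => t (enum_rank w) j *: word_val a w)).
  by apply: eq_bigr => i' _; rewrite enum_valK.
rewrite -/(b x) bE'; under eq_bigr do rewrite tE scaler_suml.
rewrite exchange_big; apply: eq_bigr => l _ /=.
under eq_bigr do rewrite mulrC -scalerA scaler_suml.
rewrite -scaler_sumr; congr (_ *: _); rewrite exchange_big; apply: eq_bigr => z _ /=.
rewrite -/(b z) bE' scaler_sumr; apply: eq_bigr => j _.
by rewrite scalerA mulrC.
Qed.
End MatrixGroup.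

Section Points.
Variables (R : idomainType) (G : affGroup R) (V : submodClosed G).
Variables (rho : repn G (submod V)) (n : nat) (v : 'I_n -> submod V).
Variable phi : 'I_n -> {linear submod V -> R^o}.
Hypotheses (G_flat : flat G) (rho_reg : regular_subrep rho).
Hypotheses (vphi : dual_sys v phi) (vfree : dual_basis v phi).
Hypothesis oneV : 1 \in V.
Local Notation a := (coact_mx rho v phi).
Local Notation entry := (entry v phi).

Let gram i j : dual_gram v phi i j = (i == j)%:R. Proof. exact: vfree. Qed.

Definition one_coord (j : 'I_n) : R := phi j (Sub 1 oneV).

(** By flatness, Delta(1) = 1 ⊗ 1 already holds in V ⊗ O(G). *)
Lemma coact_one i : \sum_j one_coord j *: a i j = (one_coord i)%:A.
Proof.
have rho1 : rho (Sub 1 oneV) = (Sub 1 oneV : submod V) ⊙ 1.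
  apply: (G_flat (f := submod_val V)); first exact: val_inj.
  rewrite rho_reg tmap_tens /=; exact: (comul_monoid G).1.
have := congr1 (@slice R (submod V) n phi G i) rho1.
rewrite slice_tens (coactE rho vphi) slice_sum.
rewrite (bigD1 i) //= vfree eqxx scale1r [X in _ + X]big1 ?addr0 // => k /negPf ki.
by rewrite vfree eq_sym ki scale0r.
Qed.

Section Point.
Variables (S : comAlgType R) (g : gl (bc S (submod V))) (x : {lrmorphism G -> S}).

Lemma repn_point_entry : g =1 repn_point rho x <-> forall i j, entry g i j = x (a i j).
Proof.
have E i j : entry (repn_point rho x) i j = x (a i j).
  rewrite /entry (repn_pointE rho vphi) -[LHS]/(entry (mx_end v phi _) i j).
  rewrite entry_mx_end => [|i' j'].
    by under eq_bigr do rewrite gram alg_nat; rewrite (bigD1 j) //= eqxx mulr1 big1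
      ?addr0 // => k /negPf ->; rewrite mulr0.
  under eq_bigr do rewrite gram; rewrite (bigD1 i') //= eqxx scale1r big1 ?addr0 // => k /negPf ki.
  by rewrite eq_sym ki scale0r.
split=> [gx i j|gx t]; first by rewrite -E /entry gx.
rewrite (point_glE rho vphi); apply: (bc_linear_ext vphi) => i j.
by rewrite gx -E /entry (point_glE rho vphi).
Qed.

Lemma repn_point_inv_entry : g =1 repn_point rho x ->
  forall i j, entry (gl_inv g) i j = x (antip G (a i j)).
Proof.
move=> gx i j; pose h := mx_inverse_sym (point_mx_inverse rho vphi x).
have -> : entry (gl_inv g) i j = entry (mx_gl vphi h) i j.
  rewrite /entry; congr (bc_coordinate _ _ _ _).
  rewrite -{1}[bci S (v j)](gl_funK (mx_gl vphi h)).
  have -> t : gl_inv (mx_gl vphi h) t = g t by rewrite gx (repn_pointE rho vphi).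
  by rewrite gl_funK.
have [_ _ EX _] := h; rewrite entry_mx_end //.
under eq_bigr do rewrite gram alg_nat; rewrite (bigD1 j) //= eqxx mulr1 big1.
  by rewrite addr0.
by move=> k /negPf ->; rewrite mulr0.
Qed.
End Point.
End Points.

Section PointRelations.
Import mpoly.
Variables (R : idomainType) (G : affGroup R) (V : submodClosed G).
Variables (rho : repn G (submod V)) (n : nat) (v : 'I_n -> submod V).
Variable phi : 'I_n -> {linear submod V -> R^o}.
Hypotheses (rho_reg : regular_subrep rho) (vphi : dual_sys v phi).
Hypothesis oneV : 1 \in V.
Variables (l s : nat) (x : 'I_l -> G) (q : 'I_s -> {mpoly R[l]}).
Hypothesis x_gen : forall u, exists p, mmap (in_alg G) x p = u.
Hypothesis x_rel : forall p, mmap (in_alg G) x p = 0 <->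
  exists c : 'I_s -> {mpoly R[l]}, p = \sum_i c i * q i.
Hypothesis xV : forall k, x k \in V.
Local Notation a := (coact_mx rho v phi).
Local Notation letter := ('I_n * 'I_n)%type.

(** Combining u = sum_j phi_j(u) v_j with v_j = sum_i epsilon(v_i) a_ij gives a linear form in the
    matrix entries whose value at the coaction matrix is u. *)
Definition elt_form (u : submod V) (p : letter) : R :=
  (phi p.2 u : R) * (counit G (val (v p.1)) : R).

Lemma elt_formE (S : comAlgType R) (X : 'I_n -> 'I_n -> S) u :
  linear_form (elt_form u) X =
  \sum_i (counit G (val (v i)) : R) *: \sum_j (phi j u : R) *: X i j.
Proof.
rewrite /linear_form -(pair_big xpredT xpredT (fun i j => elt_form u (i, j) *: X i j)) /=.
apply: eq_bigr => i _; rewrite scaler_sumr; apply: eq_bigr => j _.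
by rewrite scalerA mulrC.
Qed.

Lemma elt_form_coact u : linear_form (elt_form u) a = val u.
Proof.
rewrite elt_formE; under eq_bigr do rewrite scaler_sumr.
rewrite exchange_big /= {2}[u]vphi -[RHS]/(submod_val V _) linear_sum.
apply: eq_bigr => j _; rewrite linearZ /= (regular_val_coact_mx rho_reg vphi) scaler_sumr.
by apply: eq_bigr => i _; rewrite !scalerA mulrC.
Qed.

(** The form of the function 1 serves as the homogenizing variable. *)
Definition hom_form : letter -> R := elt_form (Sub 1 oneV).

(** At a matrix fixing the vector 1 the form evaluates to epsilon(1). *)
Lemma hom_form1 (S : comAlgType R) (X : 'I_n -> 'I_n -> S) :
  (forall i, \sum_j one_coord phi oneV j *: X i j = (one_coord phi oneV i)%:A) ->
  linear_form hom_form X = 1.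
Proof.
move=> X1; rewrite elt_formE; under eq_bigr do rewrite X1 scalerA.
rewrite -scaler_suml.
have -> : \sum_i (counit G (val (v i)) : R) * one_coord phi oneV i = counit G 1.
  rewrite -[X in _ = counit G X]/(submod_val V (Sub 1 oneV)).
  rewrite [Sub 1 oneV]vphi !linear_sum; apply: eq_bigr => i _.
  by rewrite !linearZ /= mulrC.
by rewrite rmorph1 scale1r.
Qed.

Let gen_elt k : submod V := Sub (x k) (xV k).

(* The points of G are the matrices satisfying finitely many polynomial
   equations, which can be homogenized since G fixes the vector 1. *)
Lemma point_equations : exists N (I : finType) (c : I -> {ffun 'I_N -> letter} -> R),
  (forall i, \sum_w c i w *: word_val a w = 0) /\
  forall (S : comAlgType R) (X : 'I_n -> 'I_n -> S),
    (forall i, \sum_j one_coord phi oneV j *: X i j = (one_coord phi oneV i)%:A) ->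
    (forall i, \sum_w c i w *: word_val X w = 0) ->
    exists g : {lrmorphism G -> S}, forall i j, g (a i j) = X i j.
Proof.
have a1 : linear_form hom_form a = 1 by exact: elt_form_coact.
pose y (S : comAlgType R) (X : 'I_n -> 'I_n -> S) k := linear_form (elt_form (gen_elt k)) X.
have ya : y G a = x by apply: funext => k; exact: elt_form_coact.
have poly_mmap p : word_poly hom_form (fun S X => mmap (in_alg S) (y S X) p).
  exact: word_poly_mmap.
have /choice [p pE] : forall ij : letter, exists p, mmap (in_alg G) x p = a ij.1 ij.2.
  by move=> ij; exact: x_gen.
(* The equations [inl] make the values at the generators satisfy the presentation, which yields a
   homomorphism; the equations [inr] say that each X_ij is the prescribed polynomial in those
   values, so that this homomorphism sends a_ij to X_ij. *)
pose F (t : 'I_s + letter) (S : comAlgType R) (X : 'I_n -> 'I_n -> S) : S :=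
  match t with
  | inl k => mmap (in_alg S) (y S X) (q k)
  | inr ij => linear_form (fun ij' => (ij' == ij)%:R) X * 1%:A + mmap (in_alg S) (y S X) (- p ij)
  end.
have lin1 ij (S : comAlgType R) (X : 'I_n -> 'I_n -> S) :
    linear_form (fun ij' => (ij' == ij)%:R) X = X ij.1 ij.2.
  rewrite /linear_form (bigD1 ij) //= eqxx scale1r big1 ?addr0 // => ij' /negPf ->.
  by rewrite scale0r.
have F_poly t : word_poly hom_form (F t).
  case: t => [k|ij]; first exact: poly_mmap.
  apply: word_poly_add (poly_mmap _).
  by exists 1%N; apply: word_polyM; exact: word_poly_const.
have /choice [N0 N0P] := F_poly.
(* A common degree to which all equations can be raised. *)
pose N := (\sum_t N0 t)%N.
have F_polyN t : is_word_poly hom_form N (F t).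
  by apply: word_poly_raise (N0P t); rewrite /N (bigD1 t) //= leq_addr.
have /choice [c cP] := F_polyN.
have q0 k : mmap (in_alg G) x (q k) = 0.
  apply/x_rel; exists (fun k' => (k' == k)%:R).
  rewrite (bigD1 k) //= eqxx mul1r big1 ?addr0 // => k' /negPf ->.
  by rewrite mul0r.
exists N, ('I_s + letter)%type, c; split=> [t|S X X1 cX].
  rewrite -cP //; case: t => [k|ij] /=; rewrite ya; first exact: q0.
  by rewrite lin1 mmapN pE scale1r mulr1 subrr.
have X1' := hom_form1 X1.
have FX t : F t S X = 0 by rewrite cP.
have [|g gE] := presented_hom (y := y S X) x_gen (fun p => (x_rel p).1).
  by move=> k; exact: (FX (inl k)).
exists g => i j; rewrite -[a i j](pE (i, j)) gE.
have := FX (inr (i, j)); rewrite /= lin1 mmapN scale1r mulr1.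
by move/eqP; rewrite subr_eq0 => /eqP.
Qed.
End PointRelations.

Section TensorFamilies.
Variables (R : comNzRingType) (V : lmodType R).

Lemma tensor_family (I : finType) (P : I -> forall S : comAlgType R, gl (bc S V) -> Prop) :
  (forall i, exists (m n : nat) (t : tspace V m n), forall (S : comAlgType R) (g : gl (bc S V)),
     tspace_act g (tspace_bc S t) = tspace_bc S t <-> P i S g) ->
  exists (k : nat) (m n : 'I_k -> nat) (ts : forall i, tspace V (m i) (n i)),
    forall (S : comAlgType R) (g : gl (bc S V)),
      (forall i, tspace_act g (tspace_bc S (ts i)) = tspace_bc S (ts i)) <-> forall i, P i S g.
Proof.
move=> h.
have /choice [T TP] : forall i, exists t : {mn : nat * nat & tspace V mn.1 mn.2},
    forall (S : comAlgType R) (g : gl (bc S V)),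
      tspace_act g (tspace_bc S (tagged t)) = tspace_bc S (tagged t) <-> P i S g.
  by move=> i; have [m [n [t tP]]] := h i; exists (existT _ (m, n) t).
exists #|I|, (fun i => (tag (T (enum_val i))).1), (fun i => (tag (T (enum_val i))).2),
  (fun i => tagged (T (enum_val i))) => S g.
split=> [fixT i|PI i]; last exact/TP.
by rewrite -[i]enum_rankK; exact/TP.
Qed.

Lemma vector_tensor (n : nat) (e : 'I_n -> V) (f : 'I_n -> {linear V -> R^o})
    (u : 'I_n -> R) : dual_sys e f -> dual_basis e f ->
  exists (m m' : nat) (t : tspace V m m'), forall (S : comAlgType R) (g : gl (bc S V)),
    tspace_act g (tspace_bc S t) = tspace_bc S t <->
    forall i, \sum_j u j *: entry e f g i j = (u i)%:A.
Proof.
move=> ef efb; exists 1%N, 0%N.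
have [t tP] := tensor_with_coordinates ef efb
  (fun (I : {ffun 'I_1 -> 'I_n}) (J : {ffun 'I_0 -> 'I_n}) => u (I ord0)).
exists t => S g; rewrite tP.
have sum0 (Z : nmodType) (F : {ffun 'I_0 -> 'I_n} -> Z) : \sum_J F J = F (ffun0 (card_ord 0)).
  by rewrite (big_pred1 (ffun0 (card_ord 0))) // => J; symmetry; apply/eqP/ffunP => - [].
have E (I : {ffun 'I_1 -> 'I_n}) (J : {ffun 'I_0 -> 'I_n}) :
    \sum_(I' : {ffun 'I_1 -> 'I_n}) \sum_(J' : {ffun 'I_0 -> 'I_n}) u (I' ord0) *:
      (\prod_k entry e f g (I k) (I' k) * \prod_k entry e f (gl_inv g) (J' k) (J k)) =
    \sum_j u j *: entry e f g (I ord0) j.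
  under eq_bigr do rewrite sum0 big_ord1 big_ord0 mulr1.
  rewrite (big_ffun_recl (fun j (_ : {ffun 'I_0 -> 'I_n}) => u j *: entry e f g (I ord0) j)).
  by apply: eq_bigr => j _; rewrite sum0.
split=> [fix_t i|fix_u I J]; last by rewrite E fix_u.
by have := fix_t [ffun=> i] (ffun0 (card_ord 0)); rewrite E ffunE.
Qed.
End TensorFamilies.

(** * The group as the stabilizer of finitely many tensors *)

Section Reconstruction.
Import mpoly.
Variables (R : idomainType) (G : affGroup R) (V : submodClosed G).
Variables (rho : repn G (submod V)) (n : nat) (v : 'I_n -> submod V).
Variable phi : 'I_n -> {linear submod V -> R^o}.
Hypotheses (R_pid : principal R) (G_red : linearly_reductive (generic_fibre G)).
Hypotheses (G_flat : flat G) (rho_reg : regular_subrep rho).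
Hypotheses (vphi : dual_sys v phi) (vfree : dual_basis v phi).
Hypothesis oneV : 1 \in V.
Variables (l s : nat) (x : 'I_l -> G) (q : 'I_s -> {mpoly R[l]}).
Hypothesis x_gen : forall u, exists p, mmap (in_alg G) x p = u.
Hypothesis x_rel : forall p, mmap (in_alg G) x p = 0 <->
  exists c : 'I_s -> {mpoly R[l]}, p = \sum_i c i * q i.
Hypothesis xV : forall k, x k \in V.
Local Notation a := (coact_mx rho v phi).
Local Notation entry := (entry v phi).
Local Notation u := (one_coord phi oneV).

Let gram i j : dual_gram v phi i j = (i == j)%:R. Proof. exact: vfree. Qed.

Lemma point_tensors : exists (k : nat) (m n : 'I_k -> nat)
    (ts : forall i : 'I_k, tspace (submod V) (m i) (n i)),
  forall (S : comAlgType R) (g : gl (bc S (submod V))),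
    (exists x : {lrmorphism G -> S}, g =1 repn_point rho x) <->
    (forall i : 'I_k, tspace_act g (tspace_bc S (ts i)) = tspace_bc S (ts i)).
Proof.
have [N [I [c [ca c_point]]]] := point_equations rho_reg vphi oneV x_gen x_rel xV.
have G_tf : torsion_free G by exact: flat_torsion_free.
have comul_a i j : comul G (a i j) = \sum_k a i k ⊙ a k j by exact: comul_coact_mx.
have counit_a i j : counit G (a i j) = (i == j)%:R.
  by rewrite (counit_coact_mx rho vphi) gram.
have [r [f [h [fh f_rel f_all]]]] :=
  kernel_basis (fun w : {ffun 'I_N -> 'I_n * 'I_n} => word_val a w) R_pid G_tf.
have stab := relations_stable comul_a G_flat f_rel f_all.
(* The antipode carries the identities for [a] over to its inverse matrix, which governs the dual
   factors. *)
pose a' i j := antip G (a i j).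
have antip_act y z : antip G (word_act a y z) = word_act a' y z.
  exact: (morph_word_act (rmorph0 _) (rmorph1 _) (rmorphM (antip G))).
pose A i j := \sum_z h z j *: \sum_y f i y *: word_act a z y.
have stab' i z : \sum_y f i y *: word_act a' z y = \sum_j f j z *: antip G (A i j).
  have := congr1 (antip G) (stab i z); rewrite !linear_sum => stab_iz.
  under eq_bigr do rewrite -antip_act -linearZ.
  by rewrite stab_iz; apply: eq_bigr => j _; rewrite linearZ.
have aa1 i j : \sum_k a i k * a' k j = (i == j)%:R.
  have [/(_ i j) h1 _ _ _] := point_mx_inverse rho vphi (idfun : {lrmorphism G -> G}).
  by rewrite [LHS]h1 gram alg_nat.
have [d [d0 [e [e_fix e_im e_comm]]]] := reductive_projector G_flat
  (comul_word_act comul_a) (counit_word_act counit_a) G_red fh stab.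
have e_comm' y z : \sum_t e y t *: word_act a' t z = \sum_t e t z *: word_act a' y t.
  have := congr1 (antip G) (e_comm y z); rewrite !linear_sum => e_yz.
  under eq_bigr do rewrite -antip_act -linearZ.
  by rewrite e_yz; apply: eq_bigr => t _; rewrite linearZ -antip_act.
have [psi [zeta [psi_zeta fix_a]]] :=
  universal_plucker_fixed R_pid G_tf fh aa1 stab stab' d0 e_fix e_im e_comm'.
pose P (S : comAlgType R) (g : gl (bc S (submod V))) :=
  (forall i, \sum_j u j *: entry g i j = (u i)%:A) /\
  plucker_fixed f psi (entry g) (entry (gl_inv g)).
have pointP (S : comAlgType R) (g : gl (bc S (submod V))) :
    (exists y : {lrmorphism G -> S}, g =1 repn_point rho y) <-> P S g.
  (* A point y is a specialization of the universal point, whose invariance is [fix_a]. *)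
  split=> [[y gy]|[g1 fix_g]].
    have yX := (repn_point_entry rho vphi vfree g y).1 gy.
    have yY := repn_point_inv_entry vphi vfree gy.
    split=> [i|t t'].
      under eq_bigr do rewrite yX -linearZ.
      by rewrite -linear_sum (coact_one G_flat rho_reg vphi vfree oneV) linearZ rmorph1.
    have actX z z' : word_act (entry g) z z' = y (word_act a z z').
      rewrite (morph_word_act (rmorph0 _) (rmorph1 _) (rmorphM y)).
      exact: eq_word_act.
    have actY z z' : word_act (entry (gl_inv g)) z z' = y (word_act a' z z').
      rewrite (morph_word_act (rmorph0 _) (rmorph1 _) (rmorphM y)).
      exact: eq_word_act.
    have := congr1 y (fix_a t t'); rewrite linearZ rmorph1 => <-.
    rewrite !linear_sum; apply: eq_bigr => z _; rewrite !linear_sum; apply: eq_bigr => z' _.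
    rewrite linearZ rmorphM !rmorph_prod /=; congr (_ *: (_ * _)).
      by apply: eq_bigr => j _; rewrite actX.
    by apply: eq_bigr => j _; rewrite actY.
  have fX : forall i, \sum_y f i y *: word_val (entry g) y = 0.
    apply: (plucker_fixed_vanish fh psi_zeta fix_g) => i.
    (* The counit applied to [f_rel] shows that the identity matrix satisfies the relations. *)
    have counit0 : (counit G (\sum_y f i y *: word_val a y))%:A = 0 :> S.
      by rewrite f_rel linear0 scale0r.
    apply: etrans counit0; rewrite linear_sum alg_sum; apply: eq_bigr => y _.
    rewrite linearZ /= (counit_word_val counit_a) [in RHS]alg_mul mulr_algl; congr (_ *: _).
    rewrite -[RHS]/(in_alg S _) (morph_word_val (rmorph1 (in_alg S)) (rmorphM (in_alg S))).
    by apply: eq_word_val => j k; rewrite /= alg_nat.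
  have [|y yX] := c_point S (entry g) g1.
    move=> i; under eq_bigr => w _ do rewrite (f_all _ (ca i)) scaler_suml.
    rewrite exchange_big big1 //= => j _.
    by under eq_bigr do rewrite -scalerA; rewrite -scaler_sumr fX scaler0.
  by exists y; apply/(repn_point_entry rho vphi vfree) => i j; rewrite yX.
pose M := #|{: 'I_r * 'I_N}|; pose index := {ffun 'I_M -> 'I_n}.
(* [None] is the vector 1 of [V]; [Some (I1, I2)] prescribes the row indices of the two Pluecker
   vectors. *)
pose Q (t : option (index * index)) (S : comAlgType R) (g : gl (bc S (submod V))) :=
  match t with
  | None => forall i, \sum_j u j *: entry g i j = (u i)%:A
  | Some (I1, I2) => forall J J' : index,
      \sum_(J1 : index) \sum_(J1' : index)
        (minors f (word_tuple I1 J1) * psi (word_tuple I2 J1')) *: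
        (\prod_m entry g (J m) (J1 m) * \prod_m entry (gl_inv g) (J1' m) (J' m)) =
      (minors f (word_tuple I1 J) * psi (word_tuple I2 J'))%:A
  end.
have PQ S g : P S g <-> forall t, Q t S g.
  split=> [[g1 fix_g] [[I1 I2]|] //|QS].
    by move=> J J'; exact: ((plucker_fixed_tensors f psi _ _).1 fix_g).
  split; first exact: (QS None).
  by apply/plucker_fixed_tensors => I1 I2; exact: (QS (Some (I1, I2))).
have [|k [m [m' [ts tsP]]]] := tensor_family (P := Q).
  case=> [[I1 I2]|]; last exact: vector_tensor.
  exists M, M; exact: tensor_with_coordinates.
by exists k, m, m', ts => S g; rewrite pointP PQ tsP.
Qed.
End Reconstruction.

Theorem theorem3 (R : idomainType) (R_dedekind : dedekind R)
    (G : affGroup R) (G_fp : alg_fin_presented G) (G_flat : flat G) :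
  exists (V : submodClosed G) (rho : repn G (submod V)),
    [/\ fin_presented (submod V),
        flat (submod V),
        regular_subrep rho,
        closed_immersion_in_gl rho &
        principal R -> linearly_reductive (generic_fibre G) ->
        exists (k : nat) (m n : 'I_k -> nat)
            (ts : forall i : 'I_k, tspace (submod V) (m i) (n i)),
          forall (S : comAlgType R) (g : gl (bc S (submod V))),
            (exists x : {lrmorphism G -> S}, g =1 repn_point rho x) <->
            (forall i : 'I_k, tspace_act g (tspace_bc S (ts i)) = tspace_bc S (ts i))].
Proof.
have R_noeth : noetherian R by case: R_dedekind.
have [l [s [x [q [x_gen x_rel]]]]] := G_fp.
(* The function 1 joins the generators so that it lies in [V] and can serve for homogenization. *)
pose y (i : 'I_l.+1) : G := if unlift ord0 i is Some k then x k else 1.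
have [V [V_fg yV V_stable]] := stable_submodule R_noeth G_flat y.
have xV k : x k \in V by have := yV (lift ord0 k); rewrite /y liftK.
have oneV : 1 \in V by have := yV ord0; rewrite /y unlift_none.
have [rho rho_reg] := restricted_coaction G_flat V_stable.
have V_tf : torsion_free (submod V).
  by apply: submod_torsion_free; exact: flat_torsion_free.
have {}V_fg : fin_gen (fun _ : submod V => True).
  have [n [m mP]] := V_fg.
  have mV i : m i \in V by apply/mP; exact: mem_span.
  exists n, (fun i => Sub (m i) (mV i)) => w; split=> // _.
  have /mP [c wc] := valP w; exists c; apply: val_inj.
  by rewrite -[RHS]/(submod_val V _) linear_sum.
(* Here [V] is obtained as a projective module; over a principal ideal domain the same [V] receives
   a basis below. *)
have V_proj : has_dual_sys False (submod V).
  by apply: fin_gen_dual_sys => // I; exact: dedekind_dual_sys.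
exists V, rho; split=> //.
- exact: dual_sys_fin_presented V_proj.
- exact: dual_sys_flat V_proj.
- have [n [v [phi [vphi _]]]] := V_proj.
  exact: (regular_closed_immersion rho_reg vphi x_gen xV).
move=> R_pid G_red.
have [|n [v [phi [vphi /(_ Logic.I) vfree]]]] := fin_gen_dual_sys (b := True) _ V_tf V_fg.
  by move=> I; exact: principal_dual_sys.
exact: (point_tensors R_pid G_red G_flat rho_reg vphi vfree oneV x_gen x_rel xV).
Qed.
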